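(* Let $k$ be a positive integer and let $\vec p=(p_1,\dots,p_k)$ with $p_i>0$ and $\sum_i p_i=1$. The competitive continuous Knock 'em Down game with parameter $\vec p$ has value $0$, i.e. $\sup_\alpha\inf_\beta K(\alpha,\beta)=\inf_\beta\sup_\alpha K(\alpha,\beta)=0$ (over mixed strategies $\alpha,\beta$), and it has at least one optimal strategy. Indeed, if $(\alpha_n)_{n\ge1}$ is any asymptotically optimal sequence of mixed strategies for the $n$-token competitive Knock 'em Down games with die probabilities $\vec p$ (regarded as probability measures on normalized allocations), then any weak limit of a subsequence of $(\alpha_n)$ is an optimal strategy for the continuous game.
   Context: Continuous game: a (pure) allocation is $\vec x\in\mathbb R^k$ with $\sum_i x_i=0$. Let $Z_1,\dots,Z_k$ be independent standard normals (the same for both players), and let $T_{\vec x}=\max_i\left(\frac{x_i}{p_i}+\frac{Z_i}{\sqrt{p_i}}\right)$. Set $\Pr[\vec x\text{ beats }\vec y]=\Pr[T_{\vec x}<T_{\vec y}]+\frac12\Pr[T_{\vec x}=T_{\vec y}]$ and $K(\vec x,\vec y)=\frac12\left(\Pr[\vec x\text{ beats }\vec y]-\Pr[\vec y\text{ beats }\vec x]\right)$. Mixed strategies are Borel probability measures on allocations, with $K(\alpha,\beta)=\iint K(\vec x,\vec y)\,\alpha(d\vec x)\,\beta(d\vec y)$. A mixed strategy $\alpha$ is optimal if no mixed strategy $\beta$ (equivalently, no pure strategy) satisfies $K(\beta,\alpha)>0$. $n$-token game: a token allocation is a vector $\vec\xi$ of nonnegative integers with $\sum_i\xi_i=n$.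 Its normalized form is $\vec x$ with $x_i=(\xi_i-p_in)/\sqrt n$, so $\sum_i x_i=0$. Let $A_n$ be the finite set of normalized allocations. Let $Y_{i,t}$, $1\le i\le k$, be independent Poisson processes with rates $p_i$ (counting die throws showing side $i$; the same for both players). The clearance time of $\vec\xi$ is $\max_i\inf\{t\ge0:Y_{i,t}\ge\xi_i\}$. For $\vec x,\vec y\in A_n$, $\Pr[\vec x\text{ beats }\vec y]$ is the probability that the clearance time of $\vec x$ is strictly smaller than that of $\vec y$ plus half the probability that they are equal, and $K_n(\vec x,\vec y)=\frac12\left(\Pr[\vec x\text{ beats }\vec y]-\Pr[\vec y\text{ beats }\vec x]\right)$. A mixed strategy $\alpha_n$ is a probability measure on $A_n$ (viewed also as a probability measure on $\mathbb R^k$), with $K_n(\alpha_n,\vec y)=\int K_n(\vec x,\vec y)\,\alpha_n(d\vec x)$. A sequence $(\alpha_n)$ is asymptotically optimal if $\min_{\vec y\in A_n}K_n(\alpha_n,\vec y)\to0$ as $n\to\infty$. Weak convergence means weak convergence of probability measures on $\mathbb R^k$. *)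

(* Defs.v *)
From HB Require Import structures.
From mathcomp Require Import all_boot all_order all_algebra.
From mathcomp Require Import all_classical all_reals all_analysis.

Set Implicit Arguments.
Unset Strict Implicit.
Unset Printing Implicit Defensive.

Import Order.TTheory GRing.Theory Num.Theory.
Import numFieldNormedType.Exports.

Local Open Scope classical_set_scope.
Local Open Scope ring_scope.

(* R^k as a measurable space, with the sigma-algebra generated by its opens. *)
Definition borel_rV (R : realType) (k : nat) :=
  g_sigma_algebraType (@open 'rV[R]_k).

Section Probability.
Context {R : realType} {d : measure_display} {Om : measurableType d}.
Variable P : probability Om R.

Definition mutually_independent (I : finType) (F : I -> set (set Om)) : Prop :=
  forall (J : {set I}) (E : I -> set Om), (forall i, i \in J -> F i (E i)) ->
    P (\bigcap_(i in [set` J]) E i) = (\prod_(i in J) P (E i))%E.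

Definition independent_RVs d' (V : measurableType d') (I : finType)
    (X : I -> Om -> V) : Prop :=
  mutually_independent (fun i => g_sigma_algebra_preimage (X i)).

Definition iid_standard_normal (k : nat) (Z : 'I_k -> {RV P >-> R}) : Prop :=
  independent_RVs (fun i => Z i : Om -> R) /\
  forall i (B : set R), measurable B -> P (Z i @^-1` B) = normal_prob 0 1 B.

(* Time is indexed by all of R; only times t >= 0 are constrained or used. *)
Record poisson_process (rate : R) (N : R -> {RV P >-> nat}) : Prop := {
  poisson_process_start : forall w, N 0 w = 0%N ;
  poisson_process_nondecreasing :
    forall w s t, 0 <= s -> s <= t -> (N s w <= N t w)%N ;
  poisson_process_right_continuous :
    forall w s, 0 <= s -> ((N t w)%:R : R) @[t --> s^'+] --> ((N s w)%:R : R) ;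
  poisson_process_independent_increments :
    forall (m : nat) (t : nat -> R), 0 <= t 0%N ->
      (forall j, t j <= t j.+1) ->
      independent_RVs
        (fun (j : 'I_m) w => (N (t j.+1) w - N (t j) w)%N) ;
  poisson_process_increment_law :
    forall s t, 0 <= s -> s < t -> forall j : nat,
      P [set w | (N t w - N s w)%N = j] = (poisson_pmf (rate * (t - s)) j)%:E
}.

(* The processes are independent as processes: the sigma-algebras generated
   by their whole paths are mutually independent. *)
Definition independent_processes (k : nat) (Y : 'I_k -> R -> {RV P >-> nat})
    : Prop :=
  mutually_independent (fun i =>
    <<s \bigcup_(t in [set t : R | 0 <= t])
          g_sigma_algebra_preimage (Y i t : Om -> nat) >>).

Definition independent_poisson_processes (k : nat) (p : 'I_k -> R)
    (Y : 'I_k -> R -> {RV P >-> nat}) : Prop :=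
  (forall i, poisson_process (p i) (Y i)) /\ independent_processes Y.

(* S and T are the finishing times of the two players; the smaller wins. *)
Definition prob_beats (S T : Om -> \bar R) : R :=
  fine (P [set w | (S w < T w)%E]) + 2^-1 * fine (P [set w | S w = T w]).

Definition payoff (S T : Om -> \bar R) : R :=
  2^-1 * (prob_beats S T - prob_beats T S).

End Probability.

Section ContinuousGame.
Context {R : realType} {k : nat}.
Variable p : 'I_k -> R.
Context {d : measure_display} {Om : measurableType d}.
Variables (P : probability Om R) (Z : 'I_k -> {RV P >-> R}).

Definition allocation : set (borel_rV R k) :=
  [set x : 'rV[R]_k | \sum_i x ord0 i = 0].

(* Maxima of times are taken in \bar R, where -oo is the neutral element. *)
Definition cont_time (x : 'rV[R]_k) (w : Om) : \bar R :=
  (\big[maxe/-oo]_(i < k) (x ord0 i / p i + Z i w / Num.sqrt (p i))%:E)%E.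

Definition cont_payoff (x y : 'rV[R]_k) : R :=
  payoff P (cont_time x) (cont_time y).

Definition cont_mixed : set (probability (borel_rV R k) R) :=
  [set alpha | alpha allocation = 1%E].

Definition cont_payoff_mixed (alpha beta : probability (borel_rV R k) R) : R :=
  \int[beta]_(y in allocation) \int[alpha]_(x in allocation) cont_payoff x y.

Definition cont_optimal (alpha : probability (borel_rV R k) R) : Prop :=
  cont_mixed alpha /\
  ~ exists2 beta, cont_mixed beta & 0 < cont_payoff_mixed beta alpha.

(* Extended-real sup and inf, as real [sup] and [inf] default to 0. *)
Definition cont_lower_value : \bar R :=
  ereal_sup [set ereal_inf [set (cont_payoff_mixed alpha beta)%:E
                           | beta in cont_mixed]
            | alpha in cont_mixed].

Definition cont_upper_value : \bar R :=
  ereal_inf [set ereal_sup [set (cont_payoff_mixed alpha beta)%:E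
                           | alpha in cont_mixed]
            | beta in cont_mixed].

End ContinuousGame.

Section TokenGame.
Context {R : realType} {k : nat}.
Variable p : 'I_k -> R.

Definition normalize (n : nat) (xi : 'I_k -> nat) : 'rV[R]_k :=
  \row_i (((xi i)%:R - p i * n%:R) / Num.sqrt n%:R).

Definition token_allocation (n : nat) : set (borel_rV R k) :=
  [set normalize n xi | xi in [set xi : 'I_k -> nat | (\sum_i xi i)%N = n]].

(* Inverse of [normalize], see [tokensK]; only meaningful on
   [token_allocation n]. *)
Definition tokens (n : nat) (x : 'rV[R]_k) (i : 'I_k) : nat :=
  Num.truncn (p i * n%:R + Num.sqrt n%:R * x ord0 i).

Lemma tokensK (n : nat) (xi : 'I_k -> nat) :
  (0 < n)%N -> tokens n (normalize n xi) = xi.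
Proof.
move=> n0; apply/funext => i; rewrite /tokens mxE mulrCA divff ?mulr1.
  by rewrite addrC subrK natrK.
by rewrite gt_eqF// sqrtr_gt0 ltr0n.
Qed.

Context {d : measure_display} {Om : measurableType d}.
Variables (P : probability Om R) (Y : 'I_k -> R -> {RV P >-> nat}).

(* The value is +oo when some count is never reached. *)
Definition clearance_time (xi : 'I_k -> nat) (w : Om) : \bar R :=
  (\big[maxe/-oo]_(i < k)
     ereal_inf [set t%:E | t in [set t : R | (0 <= t)%R /\ (xi i <= Y i t w)%N]])%E.

Definition token_payoff (n : nat) (x y : 'rV[R]_k) : R :=
  payoff P (clearance_time (tokens n x)) (clearance_time (tokens n y)).

Definition token_mixed (n : nat) : set (probability (borel_rV R k) R) :=
  [set alpha | alpha (token_allocation n) = 1%E].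

Definition token_payoff_mixed (n : nat) (alpha : probability (borel_rV R k) R)
    (y : 'rV[R]_k) : R :=
  \int[alpha]_(x in token_allocation n) token_payoff n x y.

(* [token_allocation n] is finite, so the infimum is a minimum. *)
Definition asymptotically_optimal
    (alpha : nat -> probability (borel_rV R k) R) : Prop :=
  (forall n, (0 < n)%N -> token_mixed n (alpha n)) /\
  ereal_inf [set (token_payoff_mixed n (alpha n) y)%:E
            | y in token_allocation n] @[n --> \oo] --> 0%E.

End TokenGame.

Definition weakly_converges (R : realType) (k : nat)
    (alpha : nat -> probability (borel_rV R k) R)
    (mu : probability (borel_rV R k) R) : Prop :=
  forall f : 'rV[R]_k -> R, continuous f ->
    (exists M : R, forall x, `|f x| <= M) ->
    (\int[alpha n]_x f x) @[n --> \oo] --> \int[mu]_x f x.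

(* Main.v *)
Require Import Defs.
From HB Require Import structures.
From mathcomp Require Import all_boot all_order all_algebra.
From mathcomp Require Import all_classical all_reals all_analysis.
From mathcomp Require Import measurable_realfun.
From mathcomp Require Import lra ring.

Set Implicit Arguments.
Unset Strict Implicit.
Unset Printing Implicit Defensive.

Import Order.TTheory GRing.Theory Num.Theory.
Import numFieldNormedType.Exports.

Local Open Scope classical_set_scope.
Local Open Scope ring_scope.

(* Fix finitely many allocations [y_j] with pairwise distinct coordinates and
   compare them with one allocation [x].  Given the noise, at most one [y_j] per
   coordinate can nearly tie with [x], so replacing the sign of [T_x - T_(y_j)] by
   a clipped version changes the sum over [j] by at most a constant that does not
   depend on the number of [y_j].  Clipped sums are continuous in [x], hence pass
   to weak limits, and a bound uniform in the number of [y_j] can be divided by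
   that number: if [sum_j K(y_j, mu) <= C] for all families, then
   [K(y, mu) <= 0] for all [y].

   For the token games the weak limit is combined with a central limit theorem
   for the Poisson counts at time [n] (by Stein's method, then products of tent
   functions) and with the concentration of clearance times around their linear
   approximation.  For existence, near-optimal strategies on the first [n] points
   of a countable dense set have an ultralimit, a finitely additive mean; its
   countably additive part is the law of a random vector [V] built from random
   bits, and the mass lost at infinity only helps the opponent, because a huge
   allocation loses almost surely.  So the law of [V] is optimal. *)

(** * Means of bounded measurable functions *)

(** The payoff is discontinuous: two allocations that share a coordinate can tie with positive
    probability, so a weak limit cannot be inserted into it directly. Clipping the sign restores
    continuity, but its error is not small for a single opponent; it is only bounded when summed
    over many opponents whose coordinates are all distinct. Such families exist near every [y]:
    shift [y] by small multiples, of both signs, of a direction without zero coordinates. Opposite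
    shifts resolve a tie in opposite ways and ties count one half, so their payoffs average to that
    of [y]. Such a direction exists only for two or more sides; with one side there is a single
    allocation and every mixed strategy is optimal.

    Existence is proved inside the continuous game, since that clause of the theorem provides no
    Poisson processes and mass could escape along a sequence of strategies. The ultralimit is only
    finitely additive; random bits can still represent it, because a compactly supported Lipschitz
    function depends on finitely many bits up to a uniform error. *)

Definition bounded_measurable d (T : measurableType d) (R : realType)
    (f : T -> R) :=
  measurable_fun setT f /\ exists M : R, forall x, `|f x| <= M.

Section BoundedMeasurable.
Context d (T : measurableType d) (R : realType).
Implicit Types f g : T -> R.

Lemma bounded_measurable_cst (c : R) : bounded_measurable (fun _ : T => c).
Proof. by split => //; exists `|c|. Qed.

Lemma bounded_measurableD f g : bounded_measurable f -> bounded_measurable g ->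
  bounded_measurable (fun x => f x + g x).
Proof.
move=> [mf [M fM]] [mg [N gN]]; split; first by apply: measurable_funD.
by exists (M + N) => x; rewrite (le_trans (ler_normD _ _))// lerD.
Qed.

Lemma bounded_measurableN f : bounded_measurable f ->
  bounded_measurable (fun x => - f x).
Proof.
move=> [mf [M fM]]; split; first exact: (measurableT_comp (@oppr_measurable _ _)).
by exists M => x; rewrite normrN.
Qed.

Lemma bounded_measurableB f g : bounded_measurable f -> bounded_measurable g ->
  bounded_measurable (fun x => f x - g x).
Proof. by move=> bf bg; apply/bounded_measurableD/bounded_measurableN. Qed.

Lemma bounded_measurableM f g : bounded_measurable f -> bounded_measurable g ->
  bounded_measurable (fun x => f x * g x).
Proof.
move=> [mf [M fM]] [mg [N gN]]; split; first exact: measurable_funM.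
by exists (M * N) => x; rewrite normrM ler_pM.
Qed.

Lemma bounded_measurableZl c f : bounded_measurable f ->
  bounded_measurable (fun x => c * f x).
Proof. exact/bounded_measurableM/bounded_measurable_cst. Qed.

Lemma bounded_measurable_sum (I : Type) (s : seq I) (F : I -> T -> R) :
  (forall i, bounded_measurable (F i)) ->
  bounded_measurable (fun x => \sum_(i <- s) F i x).
Proof.
move=> bF; elim: s => [|i s IH].
  by under eq_fun do rewrite big_nil; exact: bounded_measurable_cst.
by under eq_fun do rewrite big_cons; exact: bounded_measurableD.
Qed.

Lemma bounded_measurable_prod (I : Type) (s : seq I) (F : I -> T -> R) :
  (forall i, bounded_measurable (F i)) ->
  bounded_measurable (fun x => \prod_(i <- s) F i x).
Proof.
move=> bF; elim: s => [|i s IH].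
  by under eq_fun do rewrite big_nil; exact: bounded_measurable_cst.
by under eq_fun do rewrite big_cons; exact: bounded_measurableM.
Qed.

Lemma bounded_measurable_indic (A : set T) : measurable A ->
  bounded_measurable (\1_A : T -> R).
Proof.
move=> mA; split; first exact: measurable_indic.
by exists 1 => x; rewrite indicE; case: (x \in A); rewrite ?normr0 ?normr1.
Qed.

Lemma bounded_measurable_comp d' (T' : measurableType d') (g : T' -> R)
    (X : T -> T') : measurable_fun setT X -> bounded_measurable g ->
  bounded_measurable (fun x => g (X x)).
Proof.
by move=> mX [mg [M gM]]; split; [exact: measurableT_comp | exists M].
Qed.

Lemma bounded_measurable_norm f : bounded_measurable f ->
  bounded_measurable (fun x => `|f x|).
Proof.
move=> [mf [M fM]]; split; first exact: measurableT_comp.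
by exists M => x; rewrite normr_id.
Qed.

Variable P : probability T R.

Lemma bounded_measurable_integrable f : bounded_measurable f ->
  P.-integrable setT (EFin \o f).
Proof.
move=> [mf [M fM]]; apply: measurable_bounded_integrable => //.
  by rewrite (@le_lt_trans _ _ 1%E) ?ltry// probability_le1.
exists M; split; [exact: num_real|move=> r Mr x _].
exact: le_trans (fM x) (ltW Mr).
Qed.

Hint Resolve bounded_measurable_integrable : core.

Lemma meanD f g : bounded_measurable f -> bounded_measurable g ->
  \int[P]_x (f x + g x) = \int[P]_x f x + \int[P]_x g x.
Proof. by move=> bf bg; rewrite RintegralD//; exact: bounded_measurable_integrable. Qed.

Lemma meanB f g : bounded_measurable f -> bounded_measurable g ->
  \int[P]_x (f x - g x) = \int[P]_x f x - \int[P]_x g x.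
Proof. by move=> bf bg; rewrite RintegralB//; exact: bounded_measurable_integrable. Qed.

Lemma meanZl c f : bounded_measurable f ->
  \int[P]_x (c * f x) = c * \int[P]_x f x.
Proof. by move=> bf; rewrite RintegralZl//; exact: bounded_measurable_integrable. Qed.

Lemma mean_cst c : \int[P]_x c = c.
Proof. by rewrite Rintegral_cst// [X in fine X](@probability_setT _ _ _ P) mulr1. Qed.

Lemma mean_sum (I : Type) (s : seq I) (F : I -> T -> R) :
  (forall i, bounded_measurable (F i)) ->
  \int[P]_x (\sum_(i <- s) F i x) = \sum_(i <- s) \int[P]_x F i x.
Proof.
move=> bF; elim: s => [|i s IH].
  by under eq_Rintegral do rewrite big_nil; rewrite mean_cst big_nil.
under eq_Rintegral do rewrite big_cons.
by rewrite meanD ?IH ?big_cons//; exact: bounded_measurable_sum.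
Qed.

Lemma mean_le f g : bounded_measurable f -> bounded_measurable g ->
  (forall x, f x <= g x) -> \int[P]_x f x <= \int[P]_x g x.
Proof. by move=> bf bg fg; apply: le_Rintegral => //; exact: bounded_measurable_integrable. Qed.

Lemma mean_norm_le f (M : R) : bounded_measurable f -> (forall x, `|f x| <= M) ->
  `|\int[P]_x f x| <= M.
Proof.
move=> bf fM; rewrite ler_norml -{1}(mean_cst (- M)) -{2}(mean_cst M).
have fMM x : - M <= f x <= M by rewrite -ler_norml.
by apply/andP; split; apply: mean_le => //;
  [exact: bounded_measurable_cst|move=> x|exact: bounded_measurable_cst|move=> x];
  case/andP: (fMM x).
Qed.

Lemma mean_dist_le f g (M : R) : bounded_measurable f -> bounded_measurable g ->
  (forall x, `|f x - g x| <= M) -> `|\int[P]_x f x - \int[P]_x g x| <= M.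
Proof.
move=> bf bg fgM; rewrite -meanB//; apply: mean_norm_le => //.
exact: bounded_measurableB.
Qed.

Lemma mean_eq_ae f g : bounded_measurable f -> bounded_measurable g ->
  {ae P, forall x, f x = g x} -> \int[P]_x f x = \int[P]_x g x.
Proof.
move=> [mf _] [mg _] fg; congr fine; apply: ae_eq_integral => //;
  [exact/measurable_EFinP|exact/measurable_EFinP|].
by apply: filterS fg => x /= -> _.
Qed.

Lemma mean_dist_le_ae f g (M : R) : bounded_measurable f ->
  bounded_measurable g -> 0 <= M -> {ae P, forall x, `|f x - g x| <= M} ->
  `|\int[P]_x f x - \int[P]_x g x| <= M.
Proof.
move=> bf bg M0 fgM; rewrite -meanB//.
(* Truncating the difference at [M] changes it on a null set only and makes the bound hold
   everywhere. *)
pose h x := Num.max (- M) (Num.min M (f x - g x)).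
have hM x : `|h x| <= M.
  rewrite /h ler_norml le_max lexx/= ge_max ge_min lexx andbT.
  by rewrite (le_trans _ M0)// oppr_le0.
have bh : bounded_measurable h.
  split; last by exists M.
  apply: measurable_maxr => //; apply: measurable_minr => //.
  exact: (bounded_measurableB bf bg).1.
rewrite (@mean_eq_ae _ h)//; first exact: mean_norm_le.
  exact: bounded_measurableB.
apply: filterS fgM => x; rewrite ler_norml => /andP[h1 h2].
by rewrite /h min_r// max_r.
Qed.

Lemma mean_indic (A : set T) : measurable A -> \int[P]_x \1_A x = fine (P A).
Proof. by move=> mA; rewrite /Rintegral integral_indic// setIT. Qed.

Lemma mean_dominated_cvg (F : nat -> T -> R) f (M : R) :
  (forall n, measurable_fun setT (F n)) -> measurable_fun setT f ->
  (forall n x, `|F n x| <= M) -> {ae P, forall x, F n x @[n --> \oo] --> f x} ->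
  \int[P]_x F n x @[n --> \oo] --> \int[P]_x f x.
Proof.
move=> mF mf FM Ff.
have bF n : bounded_measurable (F n) by split => //; exists M.
have M0 : 0 <= M := le_trans (normr_ge0 (F 0%N point)) (FM 0%N point).
have cF : {ae P, forall x, setT x -> (F n x)%:E @[n --> \oo] --> (f x)%:E}.
  by apply: filterS Ff => x Ffx _; apply: cvg_EFin; [exact: nearW|exact: Ffx].
have [if_ _ cvF] := @dominated_convergence _ _ _ P setT measurableT
  (fun n x => (F n x)%:E) (fun x => (f x)%:E) (fun=> M%:E)
  (fun n => (measurable_EFinP _ _).2 (mF n)) ((measurable_EFinP _ _).2 mf)
  cF
  (bounded_measurable_integrable (bounded_measurable_cst M))
  (aeW _ (fun x n _ => FM n x)).
apply: fine_cvg; rewrite fineK//.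
exact: integrable_fin_num.
Qed.

End BoundedMeasurable.

Lemma mean_pushforward d (T : measurableType d) d' (T' : measurableType d')
    (R : realType) (P : probability T R) (X : {RV P >-> T'}) (g : T' -> R) :
  bounded_measurable g ->
  \int[distribution P X]_y g y = \int[P]_x g (X x).
Proof.
move=> bg; rewrite /Rintegral integral_distribution//.
  by apply/measurable_EFinP; case: bg.
apply: (bounded_measurable_integrable P).
exact: bounded_measurable_comp.
Qed.

Section Fubini.
Context d1 (T1 : measurableType d1) d2 (T2 : measurableType d2) (R : realType).
Variable f : T1 -> T2 -> R.
Hypothesis bf : bounded_measurable (fun z : T1 * T2 => f z.1 z.2).

Lemma bounded_measurable_section x : bounded_measurable (f x).
Proof.
case: bf => mf [M fM]; split; last by exists M => y; exact: (fM (x, y)).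
exact: (measurable_fun_pair2 x mf).
Qed.

Lemma bounded_measurable_section' y : bounded_measurable (f ^~ y).
Proof.
case: bf => mf [M fM]; split; last by exists M => x; exact: (fM (x, y)).
exact: (measurable_fun_pair1 y mf).
Qed.

Let intf (P1 : probability T1 R) (P2 : probability T2 R) :
  (P1 \x P2)%E.-integrable setT (EFin \o (fun z : T1 * T2 => f z.1 z.2)).
Proof. exact: (@bounded_measurable_integrable _ _ _ (P1 \x P2)%E). Qed.

Lemma bounded_measurable_mean (P2 : probability T2 R) :
  bounded_measurable (fun x => \int[P2]_y f x y).
Proof.
split.
  apply: measurableT_comp => //.
  exact: (measurable_fubini_F (intf \d_point P2)).
case: bf => mf [M fM]; exists M => x; apply: mean_norm_le => [|y].
  exact: bounded_measurable_section.
exact: (fM (x, y)).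
Qed.

Lemma mean_Fubini (P1 : probability T1 R) (P2 : probability T2 R) :
  \int[P1]_x \int[P2]_y f x y = \int[P2]_y \int[P1]_x f x y.
Proof.
have E1 x : (\int[P2]_y f x y)%:E = (\int[P2]_y (f x y)%:E)%E.
  rewrite fineK//; apply: integrable_fin_num => //.
  exact/bounded_measurable_integrable/bounded_measurable_section.
have E2 y : (\int[P1]_x f x y)%:E = (\int[P1]_x (f x y)%:E)%E.
  rewrite fineK//; apply: integrable_fin_num => //.
  exact/bounded_measurable_integrable/bounded_measurable_section'.
rewrite {1}/Rintegral; under eq_integral do rewrite E1.
rewrite [RHS]/Rintegral; under [in RHS]eq_integral do rewrite E2.
by congr fine; exact: (Fubini (intf P1 P2)).
Qed.

End Fubini.

(** * Payoffs and maximum times *)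

Section Payoff.
Context d (Om : measurableType d) (R : realType) (P : probability Om R).

Definition finish_sign (s t : \bar R) : R := (s < t)%E%:R - (t < s)%E%:R.

Lemma finish_sign_norm s t : `|finish_sign s t| <= 1.
Proof.
rewrite /finish_sign; case: (ltgtP s t) => _ //=;
  by rewrite ?(subr0, sub0r, normrN, normr1, normr0).
Qed.

Lemma finish_sign_EFin (a b : R) : finish_sign a%:E b%:E = Num.sg (b - a).
Proof.
rewrite /finish_sign !lte_fin; case: (ltgtP a b) => ab /=.
- by rewrite subr0 gtr0_sg// subr_gt0.
- by rewrite sub0r ltr0_sg// subr_lt0.
- by rewrite ab !subrr sgr0.
Qed.

Lemma bounded_measurable_finish_sign (S T : Om -> \bar R) :
  measurable_fun setT S -> measurable_fun setT T ->
  bounded_measurable (fun w => finish_sign (S w) (T w)).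
Proof.
move=> mS mT.
have mlt (U V : Om -> \bar R) : measurable_fun setT U -> measurable_fun setT V ->
    bounded_measurable (fun w => (U w < V w)%E%:R : R).
  move=> mU mV.
  have -> : (fun w => (U w < V w)%E%:R : R) = \1_[set w | (U w < V w)%E].
    by apply/funext => w; rewrite indicE mem_setE.
  apply: bounded_measurable_indic.
  by rewrite -[X in measurable X]setTI; exact: emeasurable_fun_lt.
exact: bounded_measurableB (mlt _ _ mS mT) (mlt _ _ mT mS).
Qed.

(** Ties carry the same half weight for both players, so they cancel in the difference and only the
    sign is left. *)
Lemma payoffE (S T : Om -> \bar R) :
  measurable_fun setT S -> measurable_fun setT T ->
  payoff P S T = 2^-1 * \int[P]_w finish_sign (S w) (T w).
Proof.
move=> mS mT.
have mlt (U V : Om -> \bar R) : measurable_fun setT U -> measurable_fun setT V ->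
    measurable [set w | (U w < V w)%E].
  by move=> mU mV; rewrite -[X in measurable X]setTI; exact: emeasurable_fun_lt.
have fE (U V : Om -> \bar R) : (fun w => (U w < V w)%E%:R : R) =
    \1_[set w | (U w < V w)%E].
  by apply/funext => w; rewrite indicE mem_setE.
rewrite /finish_sign meanB; last 2 first.
- by rewrite fE; apply: bounded_measurable_indic; exact: mlt.
- by rewrite fE; apply: bounded_measurable_indic; exact: mlt.
rewrite !fE !mean_indic; [|exact: mlt..].
rewrite /payoff /prob_beats.
have -> : [set w | T w = S w] = [set w | S w = T w].
  by apply/seteqP; split => w /= ->.
by congr (_ * _); ring.
Qed.

Lemma payoff_norm (S T : Om -> \bar R) :
  measurable_fun setT S -> measurable_fun setT T -> `|payoff P S T| <= 2^-1.
Proof.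
move=> mS mT; rewrite payoffE// normrM ger0_norm// ler_piMr//.
apply: mean_norm_le; first exact: bounded_measurable_finish_sign.
by move=> w; exact: finish_sign_norm.
Qed.

End Payoff.

Lemma sgr_norm_le1 (R : realDomainType) (x : R) : `|Num.sg x| <= 1.
Proof. by rewrite normr_sg lern1 leq_b1. Qed.

Lemma measurable_sgr (R : realType) : measurable_fun setT (@Num.sg R).
Proof.
have -> : @Num.sg R = \1_`]0, +oo[ \- \1_`]-oo, 0[.
  apply/funext => x /=; rewrite !indicE !mem_setE !in_itv/= andbT.
  by case: sgrP; rewrite ?(subr0, sub0r, subrr).
by apply: measurable_funB; exact: measurable_indic.
Qed.

Lemma finite_pos_lower_bound (R : realType) (I : finType) (f : I -> R) :
  (forall i, 0 < f i) -> exists2 e : R, 0 < e & forall i, e <= f i.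
Proof.
move=> f0; exists (\big[Num.min/1]_i f i) => [|i]; last exact: bigmin_le.
by apply: lt_bigmin => // i _; exact: f0.
Qed.

Section MaxTime.
Context (R : realType) (K : nat) (p : 'I_K.+1 -> R).
Hypothesis p_gt0 : forall i, 0 < p i.
Implicit Types (x y : 'rV[R]_K.+1) (z : 'I_K.+1 -> R).

Definition coord_time x z i : R := x ord0 i / p i + z i / Num.sqrt (p i).

(** The start value is itself one of the coordinates, so this is the true maximum and stays in [R];
    hence the number of sides is written [K.+1]. *)
Definition max_time x z : R :=
  \big[Num.max/coord_time x z ord0]_i coord_time x z i.

Lemma coord_time_le_max x z i : coord_time x z i <= max_time x z.
Proof. exact: le_bigmax. Qed.

Lemma max_time_attained x z : exists i, max_time x z = coord_time x z i.
Proof.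
rewrite /max_time; elim/big_ind : _ => [|_ _ [i ->] [j ->]|i _]; last 2 first.
- by case: leP => _; [exists j|exists i].
- by exists i.
- by exists ord0.
Qed.

Lemma max_time_le x z c : (forall i, coord_time x z i <= c) -> max_time x z <= c.
Proof. by move=> h; have [i ->] := max_time_attained x z. Qed.

Lemma max_time_dist x y z z' (e : R) :
  (forall i, `|coord_time x z i - coord_time y z' i| <= e) ->
  `|max_time x z - max_time y z'| <= e.
Proof.
move=> h; rewrite ler_distl; apply/andP; split; last first.
  apply: max_time_le => i; have := h i; rewrite ler_distl => /andP[_ hi].
  by rewrite (le_trans hi)// lerD2r coord_time_le_max.
rewrite lerBlDr; apply: max_time_le => i; have := h i.
rewrite ler_distl lerBlDr => /andP[hi _].
by rewrite (le_trans hi)// lerD2r coord_time_le_max.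
Qed.

Lemma max_time_ereal x z :
  (\big[maxe/-oo]_i (coord_time x z i)%:E)%E = (max_time x z)%:E.
Proof.
apply/eqP; rewrite eq_le; apply/andP; split.
  apply: bigmax_le => [|i _]; first exact: leNye.
  by rewrite lee_fin coord_time_le_max.
by have [i ->] := max_time_attained x z; exact: le_bigmax.
Qed.

Lemma measurable_max_time d (U : measurableType d) (X : U -> 'rV[R]_K.+1)
    (Z : U -> 'I_K.+1 -> R) :
  (forall i, measurable_fun setT (fun u => X u ord0 i)) ->
  (forall i, measurable_fun setT (fun u => Z u i)) ->
  measurable_fun setT (fun u => max_time (X u) (Z u)).
Proof.
move=> mX mZ.
have mc i : measurable_fun setT (fun u => coord_time (X u) (Z u) i).
  by apply: measurable_funD; apply: measurable_funM.
rewrite /max_time; elim: (index_enum _) => [|i s IH].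
  under eq_fun do rewrite big_nil.
   exact: (mc ord0).
by under eq_fun do rewrite big_cons; exact: measurable_maxr.
Qed.

(** Agrees with [Num.sg t] once [|t| >= e > 0], but is Lipschitz with constant [1 / e]. *)
Definition clip (e t : R) : R := Num.max (-1) (Num.min 1 (t / e)).

Lemma clip_norm e t : `|clip e t| <= 1.
Proof.
rewrite /clip ler_norml le_max lexx/= ge_max ge_min lexx/= andbT.
by rewrite (le_trans (lerN10 R)).
Qed.

Lemma clip_lipschitz (e s t : R) : 0 < e -> `|clip e s - clip e t| <= `|s - t| / e.
Proof.
move=> e0; have -> : `|s - t| / e = `|s / e - t / e|.
  by rewrite -mulrBl normrM [`|e^-1|]gtr0_norm ?invr_gt0.
rewrite /clip /Num.max /Num.min; move: (s / e) (t / e) => {s t} s t.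
rewrite ler_normr !ler_norml.
repeat case: ifPn; rewrite -?leNgt => *; lra.
Qed.

Lemma sgr_clip_dist (e a b : R) : 0 < e -> `|a - b| <= e ->
  `|Num.sg a - clip e b| <= 2 * (`|b| <= e)%R%:R.
Proof.
move=> e0 ab; have [be|be] := leP `|b| e.
  by rewrite mulr1 (le_trans (ler_normB _ _))// lerD ?sgr_norm_le1 ?clip_norm.
rewrite mulr0; move: be; rewrite lter_normr => /orP[eb|eb].
  have a0 : 0 < a by move: ab; rewrite ler_distl => /andP[]; lra.
  have be' : 1 <= b / e by rewrite ler_pdivlMr// mul1r ltW.
  by rewrite gtr0_sg// /clip min_l// max_r ?subrr ?normr0//; lra.
have a0 : a < 0 by move: ab; rewrite ler_distl => /andP[]; lra.
have be' : b / e <= -1 by rewrite ler_pdivrMr// mulN1r; lra.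
rewrite ltr0_sg// /clip min_r; last by rewrite (le_trans be')//; lra.
by rewrite max_l// subrr normr0.
Qed.

Definition coordinatewise_injective (J : Type) (y : J -> 'rV[R]_K.+1) :=
  forall i, injective (fun j => y j ord0 i).

(* If two of the allocations finished within [e] of [c] through the same
   coordinate, they would be too close there; so at most one per coordinate. *)
Lemma card_near_ties (J : finType) (y : J -> 'rV[R]_K.+1) :
  coordinatewise_injective y ->
  exists2 e : R, 0 < e &
    forall (c : R) z,
      (#|[pred j | (`|c - max_time (y j) z| <= e)%R]| <= K.+1)%N.
Proof.
move=> y_inj.
(* The value 1 at equal indices is a placeholder that keeps [gap] positive. *)
pose gap (t : 'I_K.+1 * (J * J)) : R :=
  if t.2.1 == t.2.2 then 1 else
  `|y t.2.1 ord0 t.1 - y t.2.2 ord0 t.1| / p t.1.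
have [|e e0 le_gap] := @finite_pos_lower_bound _ _ gap.
  move=> [i [j j']]; rewrite /gap /=; case: ifPn => // jj'.
  rewrite divr_gt0// normr_gt0 subr_eq0; apply: contra jj' => /eqP /y_inj ->.
  exact: eqxx.
(* Two times within a third of the gap from [c] differ by at most two thirds of it. *)
exists (e / 3) => [|c z]; first by rewrite divr_gt0.
have /choice[f fE] : forall j, exists i, max_time (y j) z = coord_time (y j) z i.
  by move=> j; exact: max_time_attained.
rewrite -[X in (_ <= X)%N]card_ord; apply: (@leq_card_in _ _ f) => j j'.
rewrite !inE !fE => hj hj' ff; apply/eqP/negPn/negP => jj'.
have := le_gap (f j, (j, j')); rewrite /gap /= (negbTE jj').
have -> : `|y j ord0 (f j) - y j' ord0 (f j)| / p (f j) =
    `|coord_time (y j) z (f j) - coord_time (y j') z (f j)|.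
  rewrite /coord_time opprD addrACA subrr addr0 -mulrBl normrM.
  by rewrite [`|(p _)^-1|]gtr0_norm// invr_gt0.
apply/negP; rewrite -ltNge.
have := ler_distD c (coord_time (y j) z (f j)) (coord_time (y j') z (f j)).
rewrite distrC in hj; rewrite -ff in hj' *; lra.
Qed.

(** An index costs at most 2, and only if it nearly ties, so [card_near_ties] gives the bound. The
    slack [e] around [a j] makes room for the token game, whose rescaled clearance times are only
    approximately maximum times; in the continuous game [a j] is the difference of maximum times
    itself. *)
Lemma sum_sgr_clip (J : finType) (y : J -> 'rV[R]_K.+1) :
  coordinatewise_injective y ->
  exists2 e : R, 0 < e & forall (a : J -> R) (c : R) z,
    (forall j, `|a j - (c - max_time (y j) z)| <= e) ->
    `|\sum_j Num.sg (a j) - \sum_j clip e (c - max_time (y j) z)|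
      <= 2 * K.+1%:R.
Proof.
move=> /card_near_ties[e e0 ecard]; exists e => // a c z ae.
rewrite -sumrB (le_trans (ler_norm_sum _ _ _))//.
apply: (@le_trans _ _ (\sum_j 2 * (`|c - max_time (y j) z| <= e)%R%:R)).
  by apply: ler_sum => j _; exact: sgr_clip_dist.
rewrite -mulr_sumr ler_wpM2l// -natr_sum ler_nat.
apply: leq_trans (ecard c z); rewrite -sum1_card [leqRHS]big_mkcond/=.
by apply: leq_sum => j _; rewrite inE; case: (_ <= _)%R.
Qed.

End MaxTime.

(** * Independence in product form and the continuous payoff *)

Definition mfun_of d d' (T : measurableType d) (T' : measurableType d')
  (f : T -> T') (mf : measurable_fun setT f) : {mfun T >-> T'} :=
  mfun_Sub (mem_set mf : f \in mfun).

Lemma null_set_ae_not d (T : measurableType d) (R : realType) (P : probability T R)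
    (A : set T) : measurable A -> P A = 0%E -> {ae P, forall w, ~ A w}.
Proof.
move=> mA PA; exists A; split=> // w /=; exact: contrapT.
Qed.

Lemma measurable_eqr d (T : measurableType d) (R : realType) (f g : T -> R) :
  measurable_fun setT f -> measurable_fun setT g ->
  measurable [set x | f x = g x].
Proof.
move=> mf mg.
have := measurable_fun_eqr mf mg measurableT (I : measurable [set true]).
by rewrite setTI; congr (measurable _); apply/seteqP; split => z /= /eqP.
Qed.

Section ProductRule.
Context d (Om : measurableType d) (R : realType) (P : probability Om R).

Definition product_rule (I : finType) (W : I -> Om -> R) :=
  forall B : I -> set R, (forall i, measurable (B i)) ->
    P [set w | forall i, B i (W i w)] = (\prod_i P (W i @^-1` B i))%E.

Lemma iid_product_rule (k : nat) (Z : 'I_k -> {RV P >-> R}) :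
  iid_standard_normal Z -> product_rule (fun i => Z i : Om -> R).
Proof.
move=> [indZ _] B mB.
have := indZ [set: 'I_k]%SET (fun i => Z i @^-1` B i).
rewrite (_ : (\bigcap_(i in [set` [set: 'I_k]%SET]) (Z i @^-1` B i)) =
  [set w | forall i, B i (Z i w)]); last first.
  apply/seteqP; split => w /= h i => [|_]; [by apply: h; rewrite /= inE|exact: h].
under eq_bigl do rewrite inE.
apply => i _; exists (B i) => //; by rewrite setTI.
Qed.

Lemma product_rule2 (I : finType) (W : I -> Om -> R) (i j : I) (A B : set R) :
  product_rule W -> i != j -> measurable A -> measurable B ->
  P (W i @^-1` A `&` W j @^-1` B) = (P (W i @^-1` A) * P (W j @^-1` B))%E.
Proof.
move=> prW ij mA mB.
pose C l := if l == i then A else if l == j then B else setT.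
have mC l : measurable (C l) by rewrite /C; case: ifP => // _; case: ifP.
have Ci : C i = A by rewrite /C eqxx.
have Cj : C j = B by rewrite /C eq_sym (negbTE ij) eqxx.
have := prW C mC; rewrite (bigD1 i)//= (bigD1 j)/=; last by rewrite eq_sym.
rewrite Ci Cj big1 ?mule1 => [<-|l /andP[li lj]]; last first.
  by rewrite /C (negbTE li) (negbTE lj) preimage_setT probability_setT.
congr (P _); apply/seteqP; split => w /=.
  by move=> [Aw Bw] l; rewrite /C; case: eqP => [->//|_]; case: eqP => [->|].
by move=> h; split; [have := h i; rewrite Ci|have := h j; rewrite Cj].
Qed.

(* Independent variables have the product of their laws as joint law, and a
   line is null for the product of an atomless law with another law. *)
Lemma independent_on_line0 (I : finType) (W : I -> {RV P >-> R}) (i j : I)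
    (a r : R) :
  product_rule (fun i => W i : Om -> R) -> i != j ->
  (forall x : R, P (W i @^-1` [set x]) = 0%E) ->
  P [set w | W i w = a + r * W j w] = 0%E.
Proof.
move=> prW ij atomless.
have mXY : measurable_fun setT (fun w => (W j w, W i w)).
  by apply: measurable_fun_pair.
pose XY : {RV P >-> (R * R)%type} := mfun_of mXY.
pose L : set (R * R) :=
  [set z | z.2 = a + r * z.1].
have mL : measurable L.
  apply: (@measurable_eqr _ (R * R)%type R (fun z => z.2) (fun z => a + r * z.1)).
    exact: measurable_snd.
  by apply: measurable_funD => //; apply: measurable_funM.
have := @product_measure_unique _ _ _ _ R (distribution P (W j))
  (distribution P (W i)) (distribution P XY) _ L mL.
move=> /(_ _)/wrap[|PE].
  move=> A B mA mB; rewrite /distribution /pushforward /=.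
  by rewrite eq_sym in ij; exact: (product_rule2 prW ij).
rewrite [LHS](_ : _ = distribution P XY L)// -PE.
rewrite /product_measure1; apply: integral0_eq => /= x _.
rewrite (_ : xsection L x = [set a + r * x]); first exact: atomless.
by apply/seteqP; split => y /=; rewrite /xsection/= inE.
Qed.

End ProductRule.

Section ContinuousPayoff.
Context (R : realType) (K : nat) (p : 'I_K.+1 -> R).
Hypothesis p_gt0 : forall i, 0 < p i.
Context d (Om : measurableType d) (P : probability Om R).
Variable Z : 'I_K.+1 -> {RV P >-> R}.

Lemma cont_timeE x w : cont_time p Z x w = (max_time p x (Z ^~ w))%:E.
Proof. by rewrite -max_time_ereal. Qed.

Lemma measurable_cont_time x : measurable_fun setT (cont_time p Z x).
Proof.
rewrite (_ : cont_time p Z x = EFin \o (fun w => max_time p x (Z ^~ w))).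
  apply/measurable_EFinP; exact: (@measurable_max_time _ _ p _ _ (fun=> x)).
by apply/funext => w; rewrite cont_timeE.
Qed.

Lemma cont_payoffE x y : cont_payoff p Z x y =
  2^-1 * \int[P]_w Num.sg (max_time p y (Z ^~ w) - max_time p x (Z ^~ w)).
Proof.
rewrite /cont_payoff payoffE; [|exact: measurable_cont_time..].
congr (_ * _); apply: eq_Rintegral => w _.
by rewrite !cont_timeE finish_sign_EFin.
Qed.

Lemma bounded_measurable_max_time_sgr d' (U : measurableType d')
    (X Y : U -> 'rV[R]_K.+1) (W : U -> 'I_K.+1 -> R) :
  (forall i, measurable_fun setT (fun u => X u ord0 i)) ->
  (forall i, measurable_fun setT (fun u => Y u ord0 i)) ->
  (forall i, measurable_fun setT (fun u => W u i)) ->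
  bounded_measurable
    (fun u => Num.sg (max_time p (Y u) (W u) - max_time p (X u) (W u))).
Proof.
move=> mX mY mW; split; last by exists 1 => u; exact: sgr_norm_le1.
apply: (measurableT_comp (@measurable_sgr R)); apply: measurable_funB;
  exact: measurable_max_time.
Qed.

Lemma bounded_measurable_cont_payoff d' (U : measurableType d')
    (X Y : U -> 'rV[R]_K.+1) :
  (forall i, measurable_fun setT (fun u => X u ord0 i)) ->
  (forall i, measurable_fun setT (fun u => Y u ord0 i)) ->
  bounded_measurable (fun u => cont_payoff p Z (X u) (Y u)).
Proof.
move=> mX mY; under eq_fun do rewrite cont_payoffE.
apply: bounded_measurableZl.
apply: (@bounded_measurable_mean _ _ _ _ _ (fun u w =>
  Num.sg (max_time p (Y u) (Z ^~ w) - max_time p (X u) (Z ^~ w)))).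
apply: (@bounded_measurable_max_time_sgr _ (U * Om)%type (X \o fst) (Y \o fst)
  (fun uw => Z ^~ uw.2)) => i /=.
- exact: (measurableT_comp (mX i)).
- exact: (measurableT_comp (mY i)).
- exact: (measurableT_comp (f := Z i)).
Qed.

Lemma cont_payoffN x y : cont_payoff p Z x y = - cont_payoff p Z y x.
Proof.
rewrite !cont_payoffE -mulrN; congr (_ * _).
have -> : - (\int[P]_w Num.sg (max_time p x (Z ^~ w) - max_time p y (Z ^~ w))) =
    -1 * (\int[P]_w Num.sg (max_time p x (Z ^~ w) - max_time p y (Z ^~ w))).
  by rewrite mulN1r.
rewrite -meanZl.
  by apply: eq_Rintegral => w _; rewrite mulN1r -sgrN opprB.
exact: (@bounded_measurable_max_time_sgr _ Om (fun=> y) (fun=> x) (fun w => Z ^~ w)).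
Qed.

Lemma cont_payoff_norm x y : `|cont_payoff p Z x y| <= 2^-1.
Proof. by apply: payoff_norm; exact: measurable_cont_time. Qed.

Lemma cont_payoffxx x : cont_payoff p Z x x = 0.
Proof. by have := cont_payoffN x x; lra. Qed.

Hypothesis iid_Z : iid_standard_normal Z.

(** Two coordinate times agree only if [Z i] is a fixed affine function of [Z j], and such a line is
    null by [independent_on_line0]. So the critical coordinate is almost surely unique, as
    [cvg_sgr_max_time] requires. *)
Lemma ae_distinct_coord_times y :
  {ae P, forall w, forall i j, i != j ->
    coord_time p y (Z ^~ w) i != coord_time p y (Z ^~ w) j}.
Proof.
suff h i j : i != j ->
    {ae P, forall w, coord_time p y (Z ^~ w) i != coord_time p y (Z ^~ w) j}.
  have : {ae P, forall w, forall ij : 'I_K.+1 * 'I_K.+1,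
      ij.1 != ij.2 ->
      coord_time p y (Z ^~ w) ij.1 != coord_time p y (Z ^~ w) ij.2}.
    apply: filter_forall => -[i j] /=.
    have [->|ij] := eqVneq i j; first by apply: aeW.
    by apply: filterS (h _ _ ij) => w hw _.
  by apply: filterS => w hw i j ij; exact: (hw (i, j)).
move=> ij.
have s_gt0 l : 0 < Num.sqrt (p l) by rewrite sqrtr_gt0.
pose a := (y ord0 j / p j - y ord0 i / p i) * Num.sqrt (p i).
pose r := Num.sqrt (p i) / Num.sqrt (p j).
have mA : measurable [set w | Z i w = a + r * Z j w].
  apply: measurable_eqr => //.
  by apply: measurable_funD => //; apply: measurable_funM.
have := null_set_ae_not mA (independent_on_line0 a r (iid_product_rule iid_Z) ij _).
move=> /(_ _)/wrap[x|].
  rewrite iid_Z.2//; have /null_content_dominatesP := @normal_prob_dominates R 0 1.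
  by apply => //; exact: lebesgue_measure_set1.
apply: filterS => w /= hw; apply/eqP => e; apply: hw.
move: e; rewrite /coord_time /a /r.
have := s_gt0 i; have := s_gt0 j; move: (Num.sqrt (p i)) (Num.sqrt (p j)) => s t.
move=> t0 s0 e.
have -> : Z i w = (y ord0 i / p i + Z i w / s - y ord0 i / p i) * s.
  by rewrite addrAC subrr add0r divfK// gt_eqF.
rewrite e; field; rewrite !gt_eqF//.
Qed.

End ContinuousPayoff.

(** * The perturbation criterion *)

Lemma cvg_finite_sum (R : realType) (T : Type) (F : set_system T) {FF : Filter F}
    (I : Type) (s : seq I) (f : I -> T -> R) (a : I -> R) :
  (forall i, f i t @[t --> F] --> a i) ->
  \sum_(i <- s) f i t @[t --> F] --> \sum_(i <- s) a i.
Proof.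
move=> fa; elim: s => [|i s IH].
  by rewrite big_nil; under eq_fun do rewrite big_nil; exact: cvg_cst.
by rewrite big_cons; under eq_fun do rewrite big_cons; exact: cvgD.
Qed.

Lemma cvg_dist_harmonic (R : realType) (f : nat -> R) (y C : R) :
  (forall m, `|f m - y| <= C * m.+1%:R^-1) -> f m @[m --> \oo] --> y.
Proof.
move=> fC; apply/cvgrPdist_le => e e0.
have h : C * harmonic m @[m --> \oo] --> C * 0 by apply: cvgMr; exact: cvg_harmonic.
rewrite mulr0 in h; near=> m.
rewrite distrC (le_trans (fC m))//.
by near: m; apply: (cvgr_le _ h).
Unshelve. all: by end_near. Qed.

Lemma sgr_near (R : realDomainType) (a b : R) : `|a - b| < `|b| ->
  Num.sg a = Num.sg b.
Proof.
have [b0|b0|->] := ltgtP b 0; last by rewrite normr0 ltNge normr_ge0.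
  by rewrite (ltr0_norm b0) ltr_distl => ab; rewrite !ltr0_sg//; lra.
by rewrite (gtr0_norm b0) ltr_distl => ab; rewrite !gtr0_sg//; lra.
Qed.

Lemma sgr_opposite (R : realDomainType) (a b : R) : a * b < 0 ->
  Num.sg a + Num.sg b = 0.
Proof.
move=> ab; have /eqP : Num.sg (a * b) = -1 by rewrite ltr0_sg.
rewrite sgrM; case: (sgrP a) => _; case: (sgrP b) => _;
  by rewrite ?(mul0r, mulr0, mul1r, mulN1r, opprK, subrr, addNr) // => /eqP; lra.
Qed.

Lemma le0_natmul_bounded (R : realType) (a C : R) :
  (forall n : nat, n%:R * a <= C) -> a <= 0.
Proof.
move=> h; rewrite leNgt; apply/negP => a0.
have := h (Num.bound (C / a)).
have := h 0%N; rewrite mul0r => C0.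
have := archi_boundP (divr_ge0 C0 (ltW a0)); rewrite ltr_pdivrMr// => h1 h2.
by move: (lt_le_trans h1 h2); rewrite ltxx.
Qed.

Section Perturbation.
Context (R : realType) (K : nat) (p : 'I_K.+1 -> R).
Hypothesis p_gt0 : forall i, 0 < p i.

(* At a tie [T_x = T_y], the unique critical coordinate of [y] decides the
   perturbed games, in opposite ways for the two perturbations. *)
Lemma cvg_sgr_max_time (x y : 'rV[R]_K.+1) (z : 'I_K.+1 -> R)
    (u v : nat -> 'rV[R]_K.+1) :
  (forall i j, i != j -> coord_time p y z i != coord_time p y z j) ->
  (forall i, u m ord0 i @[m --> \oo] --> y ord0 i) ->
  (forall i, v m ord0 i @[m --> \oo] --> y ord0 i) ->
  (forall m i, (u m ord0 i - y ord0 i) * (v m ord0 i - y ord0 i) < 0) ->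
  Num.sg (max_time p x z - max_time p (u m) z) +
  Num.sg (max_time p x z - max_time p (v m) z) @[m --> \oo] -->
  2 * Num.sg (max_time p x z - max_time p y z).
Proof.
move=> y_dist uy vy uv.
have near_coord (w : nat -> 'rV[R]_K.+1) : (forall i, w m ord0 i @[m --> \oo] --> y ord0 i) ->
    forall e : R, 0 < e ->
    \forall m \near \oo, forall i, `|coord_time p (w m) z i - coord_time p y z i| < e.
  move=> wy e e0; apply: filter_forall => i.
  have : coord_time p (w m) z i @[m --> \oo] --> coord_time p y z i.
    by apply: cvgD; [apply: cvgMl; exact: wy|exact: cvg_cst].
  by move=> /cvgrPdist_lt /(_ e e0); apply: filterS => m; rewrite distrC.
set t := max_time p x z - max_time p y z.
have [t0|t0] := eqVneq t 0.
  have [i0 Ti0] := max_time_attained p y z.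
  (* The margin by which the critical coordinate [i0] leads: perturbations of less than half of it
     leave [i0] critical. The 1 at [i0] is a placeholder. *)
  have [|e e0 le_e] := @finite_pos_lower_bound R 'I_K.+1 (fun j =>
      if j == i0 then 1 else max_time p y z - coord_time p y z j).
    move=> j; case: ifPn => // ji.
    by rewrite subr_gt0 lt_neqAle coord_time_le_max andbT Ti0 y_dist.
  have crit (w : nat -> 'rV[R]_K.+1) : (forall i, w m ord0 i @[m --> \oo] --> y ord0 i) ->
      \forall m \near \oo, max_time p x z - max_time p (w m) z =
        - ((w m ord0 i0 - y ord0 i0) / p i0).
    move=> wy; have := near_coord w wy (e / 2) (divr_gt0 e0 (ltr0Sn R 1)).
    apply: filterS => m hm.
    have -> : max_time p (w m) z = coord_time p (w m) z i0.
      apply/eqP; rewrite eq_le coord_time_le_max andbT; apply: max_time_le => j.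
      have := hm j; have := hm i0; have := le_e j; case: eqVneq => [->//|_].
      by rewrite !ltr_distl Ti0; lra.
    have -> : max_time p x z = max_time p y z by move/eqP: t0; rewrite subr_eq0 => /eqP.
    by rewrite Ti0 /coord_time; lra.
  apply: cvg_near_cst; near=> m.
  rewrite t0 sgr0 mulr0 (near (crit u uy) m)// (near (crit v vy) m)//.
  apply: sgr_opposite; rewrite mulrNN mulrACA pmulr_llt0 ?uv//.
  by rewrite mulr_gt0// invr_gt0.
(* Without a tie the sign is locally constant, so both perturbed games inherit the sign of [t]. *)
have nz (w : nat -> 'rV[R]_K.+1) : (forall i, w m ord0 i @[m --> \oo] --> y ord0 i) ->
    \forall m \near \oo, Num.sg (max_time p x z - max_time p (w m) z) = Num.sg t.
  move=> wy; have t0' : 0 < `|t| / 2 by rewrite divr_gt0// normr_gt0.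
  have := near_coord w wy _ t0'; apply: filterS => m hm.
  apply: sgr_near.
  have -> : max_time p x z - max_time p (w m) z - t =
      - (max_time p (w m) z - max_time p y z) by rewrite /t; lra.
  rewrite normrN (@le_lt_trans _ _ (`|t| / 2))//; last first.
    by rewrite gtr_pMr ?normr_gt0// invf_lt1// ltr1n.
  by apply: max_time_dist => i; exact/ltW/hm.
apply: cvg_near_cst; near=> m.
by rewrite (near (nz u uy) m)// (near (nz v vy) m)// -mulr2n mulr_natl.
Unshelve. all: by end_near. Qed.

Context d (Om : measurableType d) (P : probability Om R).
Variable Z : 'I_K.+1 -> {RV P >-> R}.
Hypothesis iid_Z : iid_standard_normal Z.

(** Dominated convergence over the noise. Both perturbations are taken together, because one alone
    would settle the ties of [x] and [y] in favour of one side. *)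
Lemma cvg_cont_payoff (x y : 'rV[R]_K.+1) (u v : nat -> 'rV[R]_K.+1) :
  (forall i, u m ord0 i @[m --> \oo] --> y ord0 i) ->
  (forall i, v m ord0 i @[m --> \oo] --> y ord0 i) ->
  (forall m i, (u m ord0 i - y ord0 i) * (v m ord0 i - y ord0 i) < 0) ->
  cont_payoff p Z (u m) x + cont_payoff p Z (v m) x @[m --> \oo] -->
  2 * cont_payoff p Z y x.
Proof.
move=> uy vy uv.
pose G (y' : 'rV[R]_K.+1) w := Num.sg (max_time p x (Z ^~ w) - max_time p y' (Z ^~ w)).
have bG y' : bounded_measurable (G y').
  exact: (@bounded_measurable_max_time_sgr _ _ p _ _ (fun=> y') (fun=> x) (fun w => Z ^~ w)).
have KE m : cont_payoff p Z (u m) x + cont_payoff p Z (v m) x =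
    2^-1 * \int[P]_w (G (u m) w + G (v m) w).
  by rewrite meanD// !cont_payoffE mulrDr.
under eq_fun do rewrite KE.
have -> : 2 * cont_payoff p Z y x = 2^-1 * \int[P]_w (2 * G y w).
  by rewrite meanZl// cont_payoffE; lra.
apply: cvgMr; apply: (mean_dominated_cvg (M := 2)).
- by move=> m; apply: measurable_funD; [exact: (bG _).1|exact: (bG _).1].
- exact: (bounded_measurableZl 2 (bG y)).1.
- by move=> m w; rewrite (le_trans (ler_normD _ _))// lerD ?sgr_norm_le1.
- apply: filterS (ae_distinct_coord_times p_gt0 iid_Z y) => w yw.
  exact: cvg_sgr_max_time.
Qed.

Section Criterion.
Hypothesis K_gt0 : (0 < K)%N.
Context d' (U : measurableType d') (nu : probability U R).
Variables (V : U -> 'rV[R]_K.+1) (rho : U -> R).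
Hypothesis mV : forall i, measurable_fun setT (fun u => V u ord0 i).
Hypothesis mrho : bounded_measurable rho.
Variable D : set 'rV[R]_K.+1.
Hypothesis D_dense : forall y : 'rV[R]_K.+1, \sum_i y ord0 i = 0 ->
  forall e : R, 0 < e -> exists2 x, D x & forall i, `|x ord0 i - y ord0 i| < e.

(** The weight [rho] is the constant 1 for weak limits. In the existence proof it is the indicator
    of the part of the mass that stays finite, and the constant [c] of the criterion then pays for
    the rest. *)
Lemma bounded_measurable_cont_payoffr y :
  bounded_measurable (fun u => rho u * cont_payoff p Z y (V u)).
Proof.
apply: bounded_measurableM => //.
exact: (@bounded_measurable_cont_payoff _ _ p _ _ _ _ _ _ (fun=> y)).
Qed.

(** A direction inside the hyperplane of allocations along which different multiples differ in every
    coordinate; [0 < K] keeps its first coordinate nonzero. *)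
Definition tilt : 'rV[R]_K.+1 := \row_i (if i == ord0 then - K%:R else 1).

Lemma sum_tilt : \sum_i tilt ord0 i = 0.
Proof.
rewrite big_ord_recl mxE eqxx; under eq_bigr do rewrite mxE /=.
by rewrite sumr_const card_ord addNr.
Qed.

Lemma tilt_ge1 i : 1 <= `|tilt ord0 i|.
Proof.
rewrite mxE; case: ifP => _; last by rewrite normr1.
by rewrite normrN normr_nat ler1n.
Qed.

Definition tilt_level N (t : bool * 'I_N) : R := (-1) ^+ t.1 * t.2.+1%:R.

Lemma tilt_level_inj N (t t' : bool * 'I_N) :
  `|tilt_level t - tilt_level t'| < 1 -> t = t'.
Proof.
have nat_eq (a b : nat) : `|a%:R - b%:R : R| < 1 -> a = b.
  move=> ab; apply/eqP; rewrite eqn_leq; move: ab.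
  by rewrite ltr_distl ltrBlDr !natr1 !ltr_nat !ltnS => /andP[-> ->].
case: t t' => [[] l] [[] l']; rewrite /tilt_level /= ?(expr0, expr1, mul1r, mulN1r).
- by rewrite opprK addrC => /nat_eq[] /val_inj ->.
- have : 1 <= l.+1%:R :> R by rewrite ler1n.
  have : 1 <= l'.+1%:R :> R by rewrite ler1n.
  by rewrite ltr_norml => *; exfalso; lra.
- have : 1 <= l.+1%:R :> R by rewrite ler1n.
  have : 1 <= l'.+1%:R :> R by rewrite ler1n.
  by rewrite ltr_norml => *; exfalso; lra.
- by move=> /nat_eq[] /val_inj ->.
Qed.

(* The [2 N] small tilts of [y], of both signs, have payoffs that sum to nearly
   [2 N] times the payoff of [y], whereas [C] does not depend on [N]. *)
Lemma cont_payoff_criterion (c C : R) :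
  (forall (J : finType) (y : J -> 'rV[R]_K.+1), (forall j, D (y j)) ->
    coordinatewise_injective y ->
    \sum_j \int[nu]_u (rho u * cont_payoff p Z (y j) (V u)) + #|J|%:R * c <= C) ->
  forall y : 'rV[R]_K.+1, \sum_i y ord0 i = 0 ->
    \int[nu]_u (rho u * cont_payoff p Z y (V u)) + c <= 0.
Proof.
(* In the limit the [2 * N] tilts contribute [2 * N] times the left side, which is at most [C];
   hence [C / 2]. *)
move=> hyp y sum_y; apply: (@le0_natmul_bounded _ _ (C / 2)) => N.
pose step (m : nat) : R := m.+1%:R^-1.
have step_gt0 m : 0 < step m by rewrite invr_gt0.
pose tgt m (t : bool * 'I_N) : 'rV[R]_K.+1 := y + (tilt_level t * step m) *: tilt.
have tgtE m t i : tgt m t ord0 i = y ord0 i + tilt_level t * step m * tilt ord0 i.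
  by rewrite !mxE.
have sum_tgt m t : \sum_i tgt m t ord0 i = 0.
  under eq_bigr do rewrite tgtE.
  by rewrite big_split/= sum_y add0r -mulr_sumr sum_tilt mulr0.
(* Different tilts are at least a step apart in every coordinate, and at least a step away from [y].
   With an error of a quarter step, the approximants in [D] stay distinct and on their own side of
   [y]. *)
have /choice[g gP] : forall mt : nat * (bool * 'I_N), exists x, D x /\
    forall i, `|x ord0 i - tgt mt.1 mt.2 ord0 i| < step mt.1 / 4.
  move=> [m t] /=; have [|x Dx hx] := D_dense (sum_tgt m t) (e := step m / 4).
    by rewrite divr_gt0.
  by exists x.
have g_inj m : coordinatewise_injective (fun t => g (m, t)).
  move=> i t t' gtt; apply: tilt_level_inj.
  have := (gP (m, t)).2 i; have := (gP (m, t')).2 i; rewrite /= -gtt !tgtE.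
  set a := g _ _ _; rewrite !ltr_distl => h1 h2.
  have h3 : `|(tilt_level t - tilt_level t') * step m * tilt ord0 i| < step m / 2.
    by rewrite !mulrBl ltr_norml; lra.
  move: h3; rewrite !normrM (gtr0_norm (step_gt0 m)) => h3.
  have h4 : `|tilt_level t - tilt_level t'| * step m < step m / 2.
    apply: le_lt_trans h3; rewrite ler_peMr ?tilt_ge1// mulr_ge0// ltW//.
  rewrite [step m / 2]mulrC ltr_pM2r// in h4.
  by move: h4; rewrite ltr_distl; lra.
have g_cvg t i : g (m, t) ord0 i @[m --> \oo] --> y ord0 i.
  apply: (@cvg_dist_harmonic _ _ _ (4^-1 + `|tilt_level t| * `|tilt ord0 i|)) => m.
  have := (gP (m, t)).2 i; rewrite /= tgtE -/(step m).
  set a := g _ _ _ => h.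
  have -> : a - y ord0 i = (a - (y ord0 i + tilt_level t * step m * tilt ord0 i))
     + tilt_level t * step m * tilt ord0 i by ring.
  rewrite (le_trans (ler_normD _ _))// mulrDl lerD//; first by rewrite [4^-1 * _]mulrC ltW.
  by rewrite !normrM (gtr0_norm (step_gt0 m)) mulrAC.
have g_opp m l i : (g (m, (true, l)) ord0 i - y ord0 i) *
    (g (m, (false, l)) ord0 i - y ord0 i) < 0.
  have := (gP (m, (true, l))).2 i; have := (gP (m, (false, l))).2 i.
  rewrite /= !tgtE /tilt_level /= expr0 expr1 mul1r mulN1r.
  set a := g _ _ _; set b := g _ _ _.
  have : step m <= `|l.+1%:R * step m * tilt ord0 i|.
    rewrite !normrM normr_nat (gtr0_norm (step_gt0 m)).
    rewrite -[leLHS]mulr1 ler_pM ?tilt_ge1 ?(ltW (step_gt0 m))//.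
    by rewrite ler_peMl ?ler1n// ltW.
  rewrite !mulNr; set q := _ * _ * _; have := step_gt0 m.
  rewrite !ltr_distl => s0 qs h1 h2.
  move: qs; rewrite ler_normr => /orP[qs|qs].
    by rewrite nmulr_rlt0; lra.
  by rewrite pmulr_rlt0; lra.
pose I0 := \int[nu]_u (rho u * cont_payoff p Z y (V u)).
have S_cvg : \sum_(t : bool * 'I_N) \int[nu]_u (rho u * cont_payoff p Z (g (m, t)) (V u))
    @[m --> \oo] --> \sum_(l < N) (2 * I0).
  (* Tilts of equal level and opposite sign are paired, as [cvg_cont_payoff] speaks of such
     pairs. *)
  have SE m : \sum_(t : bool * 'I_N) \int[nu]_u (rho u * cont_payoff p Z (g (m, t)) (V u)) =
     \sum_(l < N) \int[nu]_u (rho u * (cont_payoff p Z (g (m, (true, l))) (V u) +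
        cont_payoff p Z (g (m, (false, l))) (V u))).
    transitivity (\sum_(b : bool) \sum_(l < N)
        \int[nu]_u (rho u * cont_payoff p Z (g (m, (b, l))) (V u))).
      by rewrite pair_bigA; apply: eq_bigr => -[].
    rewrite big_bool /= -big_split/=; apply: eq_bigr => l _.
    rewrite -meanD; [|exact: bounded_measurable_cont_payoffr..].
    by apply: eq_Rintegral => u _; rewrite mulrDr.
  under eq_fun do rewrite SE.
  apply: cvg_finite_sum => l.
  have -> : 2 * I0 = \int[nu]_u (rho u * (2 * cont_payoff p Z y (V u))).
    rewrite /I0 -meanZl; last exact: bounded_measurable_cont_payoffr.
    by apply: eq_Rintegral => u _; rewrite mulrCA.
  have [mr [M rM]] := mrho.
  have mK y' : measurable_fun setT (fun u => cont_payoff p Z y' (V u)).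
    by have [] := bounded_measurable_cont_payoff p Z (X := fun=> y')
      (fun=> measurable_cst _) mV.
  apply: (mean_dominated_cvg (M := M)).
  - by move=> m; apply: measurable_funM => //; apply: measurable_funD.
  - by apply: measurable_funM => //; apply: measurable_funM.
  - move=> m u; rewrite normrM -[leRHS]mulr1 ler_pM//.
    rewrite (le_trans (ler_normD _ _))//.
    have := cont_payoff_norm p Z (g (m, (true, l))) (V u).
    have := cont_payoff_norm p Z (g (m, (false, l))) (V u).
    lra.
  - apply: aeW => u; apply: cvgMr.
    by apply: cvg_cont_payoff => // m i; exact: g_opp.
have : \sum_(l < N) (2 * I0) <= C - #|{: bool * 'I_N}|%:R * c.
  rewrite -(cvg_lim _ S_cvg)//; apply: limr_le; first by apply/cvg_ex; eexists; exact: S_cvg.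
  apply: nearW => m; rewrite lerBrDr.
  by apply: hyp => // t; exact: (gP (m, t)).1.
rewrite sumr_const card_ord card_prod card_bool card_ord natrM -mulr_natl.
by rewrite -/I0; lra.
Qed.

End Criterion.
End Perturbation.

(** * Borel measurability on row vectors, and optimality in the continuous game *)

Lemma continuous_borel_rV (R : realType) (k : nat) (f : 'rV[R]_k -> R) :
  continuous f -> measurable_fun setT (f : borel_rV R k -> R).
Proof.
move=> /continuousP cf; apply: (measurability _ (RGenOpens.measurableE R)).
move=> _ [_ [a [b ->] <-]]; rewrite setTI.
by apply: sub_sigma_algebra; exact/cf/interval_open.
Qed.

Lemma measurable_coord (R : realType) (k : nat) i :
  measurable_fun setT (fun x : borel_rV R k => x ord0 i).
Proof. by apply: continuous_borel_rV; exact: coord_continuous. Qed.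

Lemma measurable_allocation (R : realType) (k : nat) :
  measurable (@allocation R k).
Proof.
apply: (@measurable_eqr _ (borel_rV R k) R (fun x => \sum_i x ord0 i) (fun=> 0)) => //.
elim: (index_enum _) => [|i s IH].
  under eq_fun do rewrite big_nil.
  exact: measurable_cst.
by under eq_fun do rewrite big_cons; apply: measurable_funD => //;
  exact: measurable_coord.
Qed.

Section FullSet.
Context d (T : measurableType d) (R : realType) (P : probability T R).
Variable D : set T.
Hypotheses (mD : measurable D) (PD : P D = 1%E).

Lemma ae_full : {ae P, forall x, D x}.
Proof.
have PDC : P (~` D) = 0%E by rewrite probability_setC// PD subee.
have := null_set_ae_not (measurableC mD) PDC.
by apply: filterS => x /= /contrapT.
Qed.

Lemma mean_full (f : T -> R) : bounded_measurable f ->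
  \int[P]_(x in D) f x = \int[P]_x f x.
Proof.
move=> bf; rewrite Rintegral_mkcond patch_indic; apply: mean_eq_ae => //.
  by apply: bounded_measurableM => //; exact: bounded_measurable_indic.
by apply: filterS ae_full => x Dx /=; rewrite indicE mem_set// mulr1.
Qed.

Lemma mean_full_le (f : T -> R) (c : R) : bounded_measurable f ->
  (forall x, D x -> f x <= c) -> \int[P]_x f x <= c.
Proof.
move=> bf fc.
rewrite -(mean_cst P c) -(mean_full bf) -(mean_full (bounded_measurable_cst T c)).
apply: le_Rintegral => //; apply: (integrableS measurableT) => //;
  apply: bounded_measurable_integrable => //.
exact: bounded_measurable_cst.
Qed.

End FullSet.

Section Optimality.
Context (R : realType) (K : nat) (p : 'I_K.+1 -> R).
Context d (Om : measurableType d) (P : probability Om R).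
Variable Z : 'I_K.+1 -> {RV P >-> R}.
Implicit Types alpha beta mu : probability (borel_rV R K.+1) R.

Let bKl y : bounded_measurable (fun x : borel_rV R K.+1 => cont_payoff p Z x y).
Proof.
apply: (@bounded_measurable_cont_payoff _ _ p _ _ _ Z _ (borel_rV R K.+1) id (fun=> y)) => // i.
exact: measurable_coord.
Qed.

Let bK : bounded_measurable
  (fun xy : borel_rV R K.+1 * borel_rV R K.+1 => cont_payoff p Z xy.1 xy.2).
Proof.
apply: (@bounded_measurable_cont_payoff _ _ p _ _ _ Z _
  (borel_rV R K.+1 * borel_rV R K.+1)%type fst snd) => i.
- exact: (measurableT_comp (@measurable_coord R K.+1 i)).
- exact: (measurableT_comp (@measurable_coord R K.+1 i)).
Qed.

Let bmean mu :
  bounded_measurable (fun x : borel_rV R K.+1 => \int[mu]_y cont_payoff p Z x y).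
Proof.
exact: (@bounded_measurable_mean _ (borel_rV R K.+1) _ (borel_rV R K.+1) _
  (cont_payoff p Z) bK mu).
Qed.

Let bmean' mu :
  bounded_measurable (fun x : borel_rV R K.+1 => \int[mu]_y cont_payoff p Z y x).
Proof.
apply: (@bounded_measurable_mean _ (borel_rV R K.+1) _ (borel_rV R K.+1) _
  (fun y x => cont_payoff p Z x y)).
exact: (bounded_measurable_comp (@measurable_swap _ _ _ _) bK).
Qed.

Lemma cont_payoff_mixedE alpha beta : cont_mixed alpha -> cont_mixed beta ->
  cont_payoff_mixed p Z alpha beta =
  \int[beta]_y \int[alpha]_x cont_payoff p Z x y.
Proof.
move=> ma mb; rewrite /cont_payoff_mixed.
under eq_Rintegral do rewrite (mean_full (@measurable_allocation _ _) ma)//.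
rewrite (mean_full (@measurable_allocation _ _) mb)//; exact: bmean'.
Qed.

Lemma cont_payoff_mixedN alpha beta : cont_mixed alpha -> cont_mixed beta ->
  cont_payoff_mixed p Z alpha beta = - cont_payoff_mixed p Z beta alpha.
Proof.
move=> ma mb; rewrite !cont_payoff_mixedE//.
rewrite -(@mean_Fubini _ _ _ _ _ _ bK) -mulN1r -meanZl; last exact: bmean'.
apply: eq_Rintegral => x _ /=; rewrite -meanZl//.
by apply: eq_Rintegral => y _; rewrite mulN1r -cont_payoffN.
Qed.

(** By Fubini, the payoff of a mixed opponent is an average of payoffs of pure ones. *)
Lemma cont_optimal_intro mu : cont_mixed mu ->
  (forall y : 'rV[R]_K.+1, \sum_i y ord0 i = 0 -> \int[mu]_x cont_payoff p Z y x <= 0) ->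
  cont_optimal p Z mu.
Proof.
move=> mm hmu; split=> // -[beta mb]; apply/negP; rewrite -leNgt.
rewrite cont_payoff_mixedE// -(@mean_Fubini _ _ _ _ _ _ bK).
apply: (mean_full_le (@measurable_allocation _ _) mb) => [|y].
  exact: bmean.
exact: hmu.
Qed.

Lemma cont_optimal_ge0 mu beta : cont_optimal p Z mu -> cont_mixed beta ->
  0 <= cont_payoff_mixed p Z mu beta.
Proof.
move=> [mm opt] mb; rewrite cont_payoff_mixedN// oppr_ge0 leNgt.
by apply/negP => h; apply: opt; exists beta.
Qed.

Lemma cont_payoff_mixedxx alpha : cont_mixed alpha ->
  cont_payoff_mixed p Z alpha alpha = 0.
Proof. by move=> ma; have := cont_payoff_mixedN ma ma; lra. Qed.

(** By antisymmetry every strategy has payoff 0 against itself, so the lower value is at most 0 and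
    the upper value at least 0; [mu] supplies the two other inequalities. *)
Lemma cont_valueE mu : cont_optimal p Z mu ->
  cont_lower_value p Z = 0%E /\ cont_upper_value p Z = 0%E.
Proof.
move=> opt; have [mm _] := opt; split; apply/eqP; rewrite eq_le; apply/andP; split.
- apply: ge_ereal_sup => _ [alpha ma <-].
  by apply: ereal_inf_lbound; exists alpha => //; rewrite cont_payoff_mixedxx.
- apply: (@le_trans _ _ (ereal_inf
      [set (cont_payoff_mixed p Z mu beta)%:E | beta in cont_mixed])); last first.
    by apply: ereal_sup_ubound; exists mu.
  apply: le_ereal_inf_tmp => _ [beta mb <-].
  by rewrite lee_fin; exact: cont_optimal_ge0.
- apply: (@le_trans _ _ (ereal_sup
      [set (cont_payoff_mixed p Z alpha mu)%:E | alpha in cont_mixed])).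
    by apply: ereal_inf_lbound; exists mu.
  apply: ge_ereal_sup => _ [alpha ma <-].
  by rewrite lee_fin cont_payoff_mixedN// oppr_le0; exact: cont_optimal_ge0.
- apply: le_ereal_inf_tmp => _ [beta mb <-].
  by apply: ereal_sup_ubound; exists beta => //; rewrite cont_payoff_mixedxx.
Qed.

End Optimality.

(** * Finite symmetric games and ultralimits *)

Section FiniteGame.
Context (R : realType) (n : nat).
Local Notation I := 'I_n.+1.
Variable A : I -> I -> R.
Hypothesis A_anti : forall i j, A i j = - A j i.
Hypothesis A_le1 : forall i j, `|A i j| <= 1.

Let probability_vector (w : I -> R) := (forall i, 0 <= w i) /\ \sum_i w i = 1.
Let gain (w : I -> R) i := \sum_j A i j * w j.
Let regret w i := Num.max (gain w i) 0.

Let regret_ge0 w i : 0 <= regret w i.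
Proof. by rewrite le_max lexx orbT. Qed.

Let gain_form0 (w : I -> R) : \sum_i w i * gain w i = 0.
Proof.
have E : \sum_i w i * gain w i = - \sum_i w i * gain w i.
  rewrite {1}(eq_bigr (fun i => \sum_j w i * (A i j * w j))); last first.
    by move=> i _; rewrite mulr_sumr.
  rewrite exchange_big -sumrN; apply: eq_bigr => i _ /=.
  rewrite mulr_sumr -sumrN; apply: eq_bigr => j _.
  by rewrite A_anti; ring.
by move: E; lra.
Qed.

Let gain_le (w : I -> R) i : (forall i, 0 <= w i) -> `|gain w i| <= \sum_j w j.
Proof.
move=> w0; rewrite (le_trans (ler_norm_sum _ _ _))//; apply: ler_sum => j _.
by rewrite normrM (ger0_norm (w0 j)) ler_piMl.
Qed.

(** The potential is the sum of squared positive regrets; it decays like [1 / r] because the cross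
    term of the square vanishes by [gain_form0]. *)
Let step (w : I -> R) (r : nat) : probability_vector w ->
  \sum_i regret w i ^+ 2 <= n.+1%:R / r.+1%:R ->
  exists2 w', probability_vector w' &
    \sum_i regret w' i ^+ 2 <= n.+1%:R / r.+2%:R.
Proof.
move=> [w0 w1] wr; pose s := \sum_i regret w i.
have s0 : 0 <= s by apply: sumr_ge0 => i _.
(* Without positive regret [w] is already optimal, and the normalization by [s] below would be
   void. *)
have [s_eq0|s_neq0] := eqVneq s 0.
  exists w => //; rewrite big1 ?divr_ge0// => i _.
  have /eqP := s_eq0; rewrite psumr_eq0//= => /allP /(_ i).
  by rewrite mem_index_enum => /(_ isT) /eqP ->; rewrite expr0n.
have s_gt0 : 0 < s by rewrite lt_neqAle eq_sym s_neq0.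
(* With this step size [(1 - t)^2 / (r + 1) + t^2] is exactly [1 / (r + 2)]. *)
pose t : R := r.+2%:R^-1.
have t0 : 0 <= t by rewrite invr_ge0.
have t1 : 0 <= 1 - t by rewrite subr_ge0 invf_le1// ler1n.
pose w' i := (1 - t) * w i + t / s * regret w i.
have pw' : probability_vector w'.
  split=> [i|]; first by rewrite addr_ge0// mulr_ge0// divr_ge0.
  by rewrite big_split/= -!mulr_sumr w1 -/s divfK//; ring.
exists w' => //.
have gain_w' i : gain w' i = (1 - t) * gain w i + t / s * gain (regret w) i.
  rewrite /gain !mulr_sumr -big_split/=; apply: eq_bigr => j _.
  by rewrite /w'; ring.
have regret_w' i : regret w' i ^+ 2 <=
    ((1 - t) * regret w i + t / s * gain (regret w) i) ^+ 2.
  rewrite -[leRHS]real_normK ?num_real// lerXn2r ?nnegrE//.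
  rewrite {1}/regret gain_w' ge_max normr_ge0 andbT.
  rewrite (le_trans _ (ler_norm _))// lerD2r ler_wpM2l//.
  by rewrite /regret le_max lexx.
apply: (le_trans (ler_sum _ (fun i _ => regret_w' i))).
have -> : \sum_i ((1 - t) * regret w i + t / s * gain (regret w) i) ^+ 2 =
    (1 - t) ^+ 2 * (\sum_i regret w i ^+ 2) +
    2 * (1 - t) * (t / s) * (\sum_i regret w i * gain (regret w) i) +
    \sum_i (t / s * gain (regret w) i) ^+ 2.
  rewrite !mulr_sumr -!big_split/=; apply: eq_bigr => i _; ring.
rewrite gain_form0 mulr0 addr0.
apply: (@le_trans _ _ ((1 - t) ^+ 2 * (n.+1%:R / r.+1%:R) + n.+1%:R * t ^+ 2)).
  apply: lerD; first by rewrite ler_wpM2l// sqr_ge0.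
  apply: (@le_trans _ _ (\sum_(i < n.+1) t ^+ 2)); last first.
    by rewrite sumr_const card_ord mulr_natl.
  apply: ler_sum => i _; rewrite -[leLHS]real_normK ?num_real//.
  rewrite lerXn2r ?nnegrE// normrM ger0_norm ?divr_ge0//.
  by rewrite mulrAC ler_pdivrMr// ler_wpM2l// gain_le.
rewrite /t -[r.+2]addn1 natrD; set a : R := r.+1%:R.
have a0 : 0 < a by rewrite ltr0n.
rewrite le_eqVlt; apply/orP; left; apply/eqP; field.
by rewrite !gt_eqF// addr_gt0.
Qed.

(* Blackwell's approachability argument: mixing [w] with its normalized
   positive regrets contracts the regrets, since antisymmetry kills the
   quadratic form of [A]. *)
Lemma finite_symmetric_game (e : R) : 0 < e ->
  exists w : I -> R, [/\ forall i, 0 <= w i, \sum_i w i = 1 &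
    forall i, \sum_j A i j * w j <= e].
Proof.
move=> e0.
have main r : exists2 w, probability_vector w &
    \sum_i regret w i ^+ 2 <= n.+1%:R / r.+1%:R.
  elim: r => [|r [w pw wr]]; last exact: (step pw wr).
  pose w (i : I) : R := (i == ord0)%:R.
  have pw : probability_vector w.
    split=> [i|]; first by rewrite /w ler0n.
    by rewrite (bigD1 ord0)//= /w eqxx big1 ?addr0// => i /negbTE ->.
  exists w => //; rewrite divr1 -[n.+1 in leRHS]card_ord -sum1_card natr_sum.
  apply: ler_sum => i _; rewrite -[leRHS](expr1n _ 2) lerXn2r ?nnegrE//.
  rewrite ge_max ler01 andbT (le_trans (ler_norm _))// -pw.2.
  by apply: gain_le; exact: pw.1.
pose r := Num.bound (n.+1%:R / e ^+ 2).
have [w [w0 w1] wr] := main r; exists w; split=> // i.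
apply: (@le_trans _ _ (regret w i)); first by rewrite le_max lexx.
rewrite -(@ler_pXn2r _ 2)// ?nnegrE ?(ltW e0)//.
apply: le_trans (_ : n.+1%:R / r.+1%:R <= _); last first.
  rewrite ler_pdivrMr// mulrC -ler_pdivrMr ?exprn_gt0//.
  rewrite (le_trans (ltW (archi_boundP _)))// ?divr_ge0 ?exprn_ge0 ?(ltW e0)//.
  by rewrite ler_nat.
apply: le_trans wr; rewrite (bigD1 i)//= lerDl.
by apply: sumr_ge0 => j _; rewrite exprn_ge0.
Qed.

End FiniteGame.

Section UltraLimit.
Context (R : realType).

(** An ultrafilter containing all eventual sets: it assigns a limit to every bounded sequence,
    linearly and compatibly with ordinary limits. *)
Definition ultra_nat : set_system nat :=
  sval (cid (ultraFilterLemma (F := \oo : set_system nat) _)).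

#[local] Instance ultra_nat_ultra : UltraFilter ultra_nat.
Proof. by rewrite /ultra_nat; case: cid => G []. Qed.

Lemma ultra_nat_eventually : \oo `<=` ultra_nat.
Proof. by rewrite /ultra_nat; case: cid => G []. Qed.

(** Compactness of [[- M, M]] gives a cluster point, and an ultrafilter converges to each of its
    cluster points. *)
Lemma cvg_ultra_nat (a : nat -> R) (M : R) : (forall n, `|a n| <= M) ->
  a n @[n --> ultra_nat] --> lim (a n @[n --> ultra_nat]).
Proof.
move=> aM.
have aI : (a @ ultra_nat) `[- M, M]%classic.
  by apply: nearW => n /=; rewrite in_itv/= -ler_norml.
have [l [_ al]] := segment_compact (fmap_proper_filter a _ : ProperFilter (a @ ultra_nat)) aI.
apply/cvg_ex; exists l => B lB.
have [//|BC] := in_ultra_setVsetC (a @^-1` B) ultra_nat_ultra.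
by have [x [nB Bx]] := al (~` B) B BC lB.
Qed.

End UltraLimit.

(** * Vague limits of finitely additive means *)

Section UnitInterval.
Context (R : realType).

Let mI : measurable `[0 : R, 1[%classic.
Proof. exact: measurable_itv. Qed.

Definition unit_law (A : set R) : \bar R := mrestr (@lebesgue_measure R) mI A.

Let unit_law0 : unit_law set0 = 0%E.
Proof. exact: measure0. Qed.

Let unit_law_ge0 A : (0 <= unit_law A)%E.
Proof. exact: measure_ge0. Qed.

Let unit_law_sigma_additive : semi_sigma_additive unit_law.
Proof.
exact: (@measure_semi_sigma_additive _ _ _ (mrestr (@lebesgue_measure R) mI)).
Qed.

HB.instance Definition _ := isMeasure.Build _ R R unit_law
  unit_law0 unit_law_ge0 unit_law_sigma_additive.

Let unit_law_setT : unit_law setT = 1%E.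
Proof.
by rewrite /unit_law /mrestr setTI lebesgue_measure_itv/= lte_fin ltr01 oppr0 adde0.
Qed.

HB.instance Definition _ :=
  @Measure_isProbability.Build _ R R unit_law unit_law_setT.

Lemma unit_law_itv (A : set R) (a m : R) : 0 <= a -> 0 <= m -> a + m <= 1 ->
  (forall u, 0 <= u < 1 -> A u <-> a <= u < a + m) -> unit_law A = m%:E.
Proof.
move=> a0 m0 am1 AE; rewrite /unit_law /mrestr.
rewrite (_ : A `&` _ = `[a, a + m[%classic); last first.
  apply/seteqP; split => u /=; rewrite !in_itv/=.
    by move=> [Au u01]; apply/AE.
  move=> uam; have u01 : 0 <= u < 1 by move: uam; lra.
  by split => //; apply/AE.
rewrite lebesgue_measure_itv/= lte_fin ltrDl; case: ltP => m0'.
  by rewrite -EFinD addrAC subrr add0r.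
by congr EFin; lra.
Qed.

End UnitInterval.
Arguments unit_law R : clear implicits.

(* A finitely additive mean, as obtained from an ultralimit of means. *)
Record is_mean (X : Type) (R : realType) (L : (X -> R) -> R) : Prop := {
  is_meanD : forall f g (M : R), (forall x, `|f x| <= M) ->
    (forall x, `|g x| <= M) -> L (fun x => f x + g x) = L f + L g ;
  is_meanZ : forall (c : R) f (M : R), (forall x, `|f x| <= M) ->
    L (fun x => c * f x) = c * L f ;
  is_mean_le : forall f g (M : R), (forall x, `|f x| <= M) ->
    (forall x, `|g x| <= M) -> (forall x, f x <= g x) -> L f <= L g ;
  is_mean_cst : forall c : R, L (fun=> c) = c
}.

Section MeanTheory.
Context (X : Type) (R : realType) (L : (X -> R) -> R).
Hypothesis LP : is_mean L.

Lemma is_mean_sum (I : Type) (s : seq I) (F : I -> X -> R) (M : R) :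
  (forall i x, `|F i x| <= M) ->
  L (fun x => \sum_(i <- s) F i x) = \sum_(i <- s) L (F i).
Proof.
move=> FM; elim: s => [|i s IH].
  by under [in LHS]eq_fun do rewrite big_nil; rewrite big_nil (is_mean_cst LP).
under [in LHS]eq_fun do rewrite big_cons.
rewrite big_cons -IH; apply: (@is_meanD _ _ _ LP _ _ (M *+ (size s).+1)) => x.
  have M0 : 0 <= M := le_trans (normr_ge0 _) (FM i x).
  by rewrite (le_trans (FM i x))// mulrS lerDl mulrn_wge0.
have M0 : 0 <= M := le_trans (normr_ge0 _) (FM i x).
rewrite (le_trans (ler_norm_sum _ _ _))//.
apply: (@le_trans _ _ (\sum_(i <- s) M)); first exact: ler_sum.
by rewrite big_const_seq count_predT iter_addr_0 mulrS lerDr.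
Qed.

Lemma is_mean_dist f g (M e : R) : (forall x, `|f x| <= M) ->
  (forall x, `|g x| <= M) -> (forall x, `|f x - g x| <= e) -> `|L f - L g| <= e.
Proof.
have half f' g' : (forall x, `|f' x| <= M) -> (forall x, `|g' x| <= M) ->
    (forall x, `|f' x - g' x| <= e) -> L f' <= L g' + e.
  move=> fM gM fg; rewrite -(is_mean_cst LP e).
  have N x : `|g' x| <= M + `|e| by rewrite (le_trans (gM x))// lerDl.
  have N' (x : X) : `|e| <= M + `|e| by rewrite lerDr (le_trans _ (gM x)).
  rewrite -(@is_meanD _ _ _ LP _ _ _ N N').
  apply: (@is_mean_le _ _ _ LP _ _ (M + `|e|)) => x.
  - by rewrite (le_trans (fM x))// lerDl.
  - by rewrite (le_trans (ler_normD _ _))// lerD2r.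
  - by have := fg x; rewrite ler_distl => /andP[].
move=> fM gM fg; rewrite ler_distl lerBlDr !half// => x.
by rewrite distrC.
Qed.

End MeanTheory.

Section BitMeasure.
Context (X : Type) (R : realType) (L : (X -> R) -> R).
Hypothesis LP : is_mean L.
Variable b : nat -> X -> bool.
Local Notation prefix_of x N := (mkseq (b ^~ x) N).

Let mass (s : seq bool) : R := L (fun x => (prefix_of x (size s) == s)%:R).

Let nat_norm (c : bool) : `|c%:R| <= 1 :> R.
Proof. by case: c; rewrite ?normr0 ?normr1. Qed.

Let mass_ge0 s : 0 <= mass s.
Proof.
rewrite -(is_mean_cst LP 0); apply: (@is_mean_le _ _ _ LP _ _ 1) => // x.
by rewrite normr0.
Qed.

Let mass_rcons s : mass (rcons s false) + mass (rcons s true) = mass s.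
Proof.
rewrite /mass !size_rcons -(@is_meanD _ _ _ LP _ _ 1)//.
congr L; apply/funext => x; rewrite mkseqS !eqseq_rcons.
by case: (b _ x); case: (_ == s); rewrite /= ?addr0 ?add0r.
Qed.

Let mass_nil : mass [::] = 1.
Proof. by rewrite /mass -[RHS](is_mean_cst LP). Qed.

(** The mass of the strings of the same length that precede [s] lexicographically: each 1 in [s]
    contributes the sibling cell on its left. *)
Let left_end (s : seq bool) : R :=
  \sum_(i < size s) (nth false s i)%:R * mass (rcons (take i s) false).

Let left_end_rcons s c :
  left_end (rcons s c) = left_end s + c%:R * mass (rcons s false).
Proof.
rewrite /left_end size_rcons big_ord_recr/= nth_rcons ltnn eqxx.
rewrite -cats1 take_size_cat//; congr (_ + _); apply: eq_bigr => i _.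
by rewrite nth_cat ltn_ord take_cat ltn_ord.
Qed.

(* Nested subdivision of the unit interval: the cell of each bit string gets the
   length that [L] gives to it, so the bits of a uniform point follow [L]. *)
Fixpoint bit_path (N : nat) (u : R) : seq bool :=
  if N is N'.+1 then
    let s := bit_path N' u in rcons s (left_end s + mass (rcons s false) <= u)
  else [::].

Definition bit (l : nat) (u : R) : bool := nth false (bit_path l.+1 u) l.

Let size_bit_path N u : size (bit_path N u) = N.
Proof. by elim: N => //= N IH; rewrite size_rcons IH. Qed.

Lemma bit_pathE N u : bit_path N u = mkseq (bit ^~ u) N.
Proof.
elim: N => //= N IH; rewrite mkseqS -IH; congr rcons.
by rewrite /bit /= nth_rcons size_bit_path ltnn eqxx.
Qed.

Lemma measurable_bit_path N s : measurable [set u | bit_path N u = s].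
Proof.
elim: N s => [|N IH] s /=.
  by case: s => [|c s]; [rewrite (_ : [set _ | _] = setT)|
    rewrite (_ : [set _ | _] = set0)]; rewrite //; apply/seteqP; split.
case/lastP: s => [|s c].
  rewrite (_ : [set _ | _] = set0)//; apply/seteqP; split => // u /= e.
  by have := congr1 size e; rewrite size_rcons.
rewrite (_ : [set _ | _] = [set u | bit_path N u = s] `&`
  (if c then [set u | left_end s + mass (rcons s false) <= u]
   else [set u | u < left_end s + mass (rcons s false)])); last first.
  apply/seteqP; split => u /=.
    by move=> /rcons_inj[-> <-]; split=> //; case: leP.
  by move=> [->]; case: c => /= h; rewrite ?h// leNgt h.
apply: measurableI => //; case: c.
  rewrite (_ : [set _ | _] = `[left_end s + mass (rcons s false), +oo[%classic) //.
  by apply/seteqP; split => u /=; rewrite in_itv/= andbT.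
rewrite (_ : [set _ | _] = `]-oo, left_end s + mass (rcons s false)[%classic) //.
Qed.

Lemma measurable_bit l : measurable [set u | bit l u].
Proof.
rewrite (_ : [set u | bit l u] = \bigcup_(t : (l.+1).-tuple bool)
    (if nth false t l then [set u | bit_path l.+1 u = t] else set0)).
  apply: countable_bigcupT_measurable; first exact: countableP.
  by move=> t; case: ifP => _ //; exact: measurable_bit_path.
apply/seteqP; split => [u /= bu|u [t _]].
  have sz : size (bit_path l.+1 u) == l.+1 by rewrite size_bit_path.
  by exists (Tuple sz) => //; rewrite [nth _ _ _]bu.
case: ifP => // tl e; change (is_true (nth false (bit_path l.+1 u) l)).
by rewrite (e : bit_path l.+1 u = t).
Qed.

(** Induction on the last bit: the threshold in [bit_path] cuts the cell of [s] into the cells of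
    its two children, whose masses add up by [mass_rcons]. *)
Let bit_path_itv s : [/\ 0 <= left_end s, left_end s + mass s <= 1 &
  forall u, 0 <= u < 1 ->
    bit_path (size s) u = s <-> left_end s <= u < left_end s + mass s].
Proof.
elim/last_ind: s => [|s c [a0 am IH]].
  by rewrite mass_nil /left_end big_ord0; split; [|lra|move=> u u01; rewrite add0r].
have m0 := mass_ge0 (rcons s false); have m1 := mass_ge0 (rcons s true).
have ms := mass_rcons s; rewrite left_end_rcons; split.
- by case: (c); rewrite /= ?mul1r ?mul0r; lra.
- by case: (c); rewrite /= ?mul1r ?mul0r; lra.
move=> u u01; rewrite size_rcons /=; split.
  move=> /rcons_inj[/(IH _ u01) h]; rewrite ?size_rcons => e.
  have bs : bit_path (size s) u = s by apply/IH.
  by move: e; rewrite bs; case: (c) => [|/negbT]; rewrite -?ltNge /= ?mul1r ?mul0r => e; lra.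
move=> h; have bs : bit_path (size s) u = s by apply/IH => //; case: (c) h; rewrite /= ?mul1r ?mul0r; lra.
rewrite bs; congr rcons; case: c h; rewrite /= ?mul1r ?mul0r => h; first by lra.
by apply/negbTE; rewrite -ltNge; lra.
Qed.

Let expand (N : nat) (Q : seq bool -> R) s : size s = N ->
  Q s = \sum_(t : N.-tuple bool) Q t * (s == t)%:R.
Proof.
move=> sN; have sN' : size s == N by apply/eqP.
rewrite (bigD1 (Tuple sN'))//= eqxx mulr1 big1 ?addr0// => t.
by rewrite -val_eqE/= eq_sym => /negbTE ->; rewrite mulr0.
Qed.

Let indE (N : nat) (t : N.-tuple bool) :
  (fun u => (bit_path N u == t :> seq bool)%:R : R) = \1_[set u | bit_path N u = t].
Proof.
apply/funext => u; rewrite indicE; congr ((nat_of_bool _)%:R).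
by apply/eqP/idP; rewrite inE.
Qed.

Let bI (N : nat) (t : N.-tuple bool) :
  bounded_measurable (fun u => (bit_path N u == t :> seq bool)%:R : R).
Proof. by rewrite indE; apply: bounded_measurable_indic; exact: measurable_bit_path. Qed.

Lemma bounded_measurable_bits (N : nat) (Q : seq bool -> R) :
  bounded_measurable (fun u => Q (mkseq (bit ^~ u) N)).
Proof.
under eq_fun do rewrite -bit_pathE (expand Q (size_bit_path _ _)).
by apply: bounded_measurable_sum => t; exact/bounded_measurableZl/bI.
Qed.

(** A function of [N] bits is a finite combination of cell indicators, so finite additivity of [L]
    suffices, although the right side is not an integral. *)
Lemma mean_bits (N : nat) (Q : seq bool -> R) :
  \int[unit_law R]_u Q (mkseq (bit ^~ u) N) = L (fun x => Q (prefix_of x N)).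
Proof.
transitivity (\int[unit_law R]_u \sum_(t : N.-tuple bool) Q t * (bit_path N u == t)%:R).
  by apply: eq_Rintegral => u _; rewrite -bit_pathE; exact/expand/size_bit_path.
rewrite mean_sum; last by move=> t; exact: (bounded_measurableZl (Q t) (bI t)).
under [in RHS]eq_fun do rewrite (expand Q (size_mkseq _ _)).
rewrite (@is_mean_sum _ _ _ LP _ _ _ (\sum_(t : N.-tuple bool) `|Q t|)); last first.
  move=> t x; rewrite normrM (le_trans (ler_piMr _ (nat_norm _)))//.
  by rewrite (bigD1 t)//= lerDl sumr_ge0.
apply: eq_bigr => t _; rewrite (@meanZl _ _ _ (unit_law R) (Q t)
  (fun u => (bit_path N u == t)%:R) (bI t)).
rewrite (@is_meanZ _ _ _ LP (Q t) (fun x => (prefix_of x N == t)%:R) 1)//.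
congr (_ * _).
rewrite indE mean_indic; last exact: measurable_bit_path.
have [a0 am tE] := bit_path_itv t.
rewrite [X in fine X](_ : _ = (mass t)%:E); first by rewrite /mass size_tuple.
apply: (@unit_law_itv _ _ (left_end t)) => // u u01.
by rewrite -(tE u u01) size_tuple.
Qed.

End BitMeasure.

Lemma measurable_exists_countable d (T : measurableType d) (I : countType)
    (A : I -> set T) : (forall i, measurable (A i)) ->
  measurable [set u | exists i, A i u].
Proof.
move=> mA; rewrite (_ : [set u | _] = \bigcup_i A i).
  by apply: countable_bigcupT_measurable => //; exact: countableP.
by apply/seteqP; split => u /= [i]; exists i.
Qed.

Lemma measurable_forall_countable d (T : measurableType d) (I : countType)
    (A : I -> set T) : (forall i, measurable (A i)) ->
  measurable [set u | forall i, A i u].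
Proof.
move=> mA; rewrite (_ : [set u | _] = ~` [set u | exists i, (~` A i) u]).
  by apply/measurableC/measurable_exists_countable => i; exact: measurableC.
apply/seteqP; split => u /=; first by move=> h [i]; apply.
by move=> h i; apply: contrapT => Ai; apply: h; exists i.
Qed.

Lemma ae_forall_countable d (T : measurableType d) (R : realType)
    (P : probability T R) (I : countType) (A : I -> T -> Prop) :
  (forall i, {ae P, forall u, A i u}) -> {ae P, forall u, forall i, A i u}.
Proof.
move=> h; have : {ae P, forall u, forall n : nat,
    if unpickle n is Some i then A i u else True}.
  apply: ae_foralln => n; case: (unpickle n : option I) => [i|]; first exact: h.
  exact: aeW.
by apply: filterS => u hu i; have := hu (pickle i); rewrite pickleK.
Qed.

Section Quantizer.
Context (R : realType) (r L : nat).

Definition grid_point (j : nat) : rat := j%:R / L.+1%:R - r%:R.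

(** Reads a real off its upper cut [beta]: the first point of a grid of mesh [1 / (L + 1)] on
    [[- r, r]] that lies in the cut. If there is none, [find] returns the length of the list and the
    value is one mesh beyond [r]. *)
Definition quantize (beta : rat -> bool) : R :=
  (find (beta \o grid_point) (iota 0 (2 * r * L.+1).+1))%:R / L.+1%:R - r%:R.

Lemma ratr_grid_point j : ratr (grid_point j) = j%:R / L.+1%:R - r%:R :> R.
Proof. by rewrite rmorphB/= fmorph_div/= !rmorph_nat. Qed.

(** The second alternative is the case where [v] falls off the grid. Then [v] and its reading both
    leave the support of the test functions, so their distance does not matter. *)
Lemma quantizeP (v : R) (beta : rat -> bool) :
  (forall q, beta q -> v <= ratr q) -> (forall q, ~~ beta q -> ratr q <= v) ->
  `|quantize beta - v| <= L.+1%:R^-1 \/ (r%:R <= `|quantize beta| /\ r%:R <= `|v|).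
Proof.
move=> h1 h2; rewrite /quantize; set J := (2 * r * L.+1)%N.
set f := find _ _.
have L0 : 0 < L.+1%:R^-1 :> R by rewrite invr_gt0.
have J_end : J%:R / L.+1%:R = 2 * r%:R :> R.
  by rewrite /J natrM natrM mulfK.
have [fJ|fJ] := leqP f J; last first.
  have fE : f = J.+1.
    by apply/eqP; rewrite eqn_leq fJ andbT -[leqRHS](size_iota 0) find_size.
  have : ~~ beta (grid_point J).
    have := @before_find _ 0%N (beta \o grid_point) (iota 0 J.+1) J fJ.
    by rewrite nth_iota//= => ->.
  move=> /h2; rewrite ratr_grid_point J_end => rv; right.
  rewrite fE -natr1 mulrDl J_end mul1r.
  have aux (a b : R) : 0 < a -> b <= 2 * b + a - b by lra.
  have aux' (b : R) : 2 * b - b <= v -> b <= v by lra.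
  by rewrite !ler_normr; split; apply/orP; left; [exact: aux|exact: aux'].
have bf : beta (grid_point f).
  have : has (beta \o grid_point) (iota 0 J.+1) by rewrite has_find size_iota ltnS.
  by move=> /(nth_find 0%N); rewrite -/f nth_iota.
have := h1 _ bf; rewrite ratr_grid_point => vf.
case: (posnP f) => [f0|f_gt0].
  right; move: vf; rewrite f0 mul0r sub0r => vf.
  by rewrite normrN normr_nat lexx ler_normr; split => //; apply/orP; right; lra.
left; have : ~~ beta (grid_point f.-1).
  have := @before_find _ 0%N (beta \o grid_point) (iota 0 J.+1) f.-1.
  rewrite -/f prednK// leqnn nth_iota; last by rewrite prednK// (leq_trans fJ).
  by rewrite add0n => /(_ isT) /= ->.
move=> /h2; rewrite ratr_grid_point.
have -> : f.-1%:R = f%:R - 1 :> R by rewrite -[in RHS](prednK f_gt0) -natr1 addrK.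
have aux (a a' c : R) : v <= a - c -> a - a' - c <= v -> v - a' <= a - c <= v + a'.
  by move=> ? ?; apply/andP; split; lra.
by rewrite mulrBl mul1r ler_distl => fv; exact: aux.
Qed.

Lemma quantize_cst (c : bool) (beta : rat -> bool) : (forall q, beta q = c) ->
  r%:R <= `|quantize beta|.
Proof.
move=> bc; rewrite /quantize; set J := (2 * r * L.+1)%N.
have L0 : 0 < L.+1%:R^-1 :> R by rewrite invr_gt0.
have J_end : J%:R / L.+1%:R = 2 * r%:R :> R.
  by rewrite /J natrM natrM mulfK.
have -> : find (beta \o grid_point) (iota 0 J.+1) = if c then 0%N else J.+1.
  case: c bc => bc; first by rewrite /= bc.
  rewrite hasNfind ?size_iota//; apply/hasPn => j _ /=; by rewrite bc.
case: c bc => bc; first by rewrite mul0r sub0r normrN normr_nat.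
rewrite -natr1 mulrDl J_end mul1r ler_normr.
have aux (a b' : R) : 0 < a -> b' <= 2 * b' + a - b' by lra.
by apply/orP; left; exact: aux.
Qed.

End Quantizer.

Section VagueLimit.
Context (X : Type) (R : realType) (L : (X -> R) -> R).
Hypothesis LP : is_mean L.
Context (K : nat) (xi : 'I_K -> X -> R).

(** Comparisons of the coordinates with all rationals encode the point in countably many bits;
    numbers that are not codes give a constant bit. *)
Let below (l : nat) (x : X) : bool :=
  if unpickle l is Some iq then xi iq.1 x < ratr iq.2 else false.

Let B (i : 'I_K) (q : rat) (u : R) : bool := bit L below (pickle (i, q)) u.

Let nu : probability R R := unit_law R.

Let mB i q : measurable [set u | B i q u].
Proof. exact: measurable_bit. Qed.

(* [B i ^~ u] is a random cut of the rationals; where it is empty or full, the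
   coordinate [i] has escaped to infinity. *)
Definition proper_cut : set R := [set u | forall i : 'I_K,
  [/\ exists q, B i q u, exists q, ~~ B i q u &
    forall qq : rat * rat, qq.1 <= qq.2 -> B i qq.1 u -> B i qq.2 u]].

Lemma measurable_proper_cut : measurable proper_cut.
Proof.
have mBC i q : measurable [set u | ~~ B i q u].
  rewrite (_ : [set _ | _] = ~` [set u | B i q u]); first exact: measurableC (mB _ _).
  by apply/seteqP; split => u /= /negP.
apply: (measurable_forall_countable (I := 'I_K)) => i.
rewrite [X in measurable X](_ : _ = [set u | exists q, B i q u] `&`
  ([set u | exists q, ~~ B i q u] `&`
  [set u | forall qq : rat * rat, qq.1 <= qq.2 -> B i qq.1 u -> B i qq.2 u])); last first.
  by apply/seteqP; split => u /=; [move=> []|move=> [? []]].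
apply: measurableI.
  by apply: (measurable_exists_countable (A := fun q => [set u | B i q u])); exact: mB.
apply: measurableI; first exact: (measurable_exists_countable (A := fun q => [set u | ~~ B i q u])).
apply: (measurable_forall_countable (I := (rat * rat)%type)) => -[q q'] /=.
have [qq|qq] := boolP (q <= q'); last first.
  by rewrite [X in measurable X](_ : _ = setT)//; apply/seteqP; split => u.
rewrite [X in measurable X](_ : _ = [set u | ~~ B i q u] `|` [set u | B i q' u]).
  exact: measurableU.
apply/seteqP; split => u /= => [/(_ isT) h|[/negP|]//].
by have [/h|] := boolP (B i q u); [right|left].
Qed.

(** The default 0 off [proper_cut] is masked by the indicator in [mean_vague_limit]. *)
Definition cut_value (i : 'I_K) (u : R) : R :=
  if u \in proper_cut then inf [set ratr q | q in [set q | B i q u]] else 0.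

Lemma cut_value_le i u q : proper_cut u -> B i q u -> cut_value i u <= ratr q.
Proof.
move=> Gu Bq; rewrite /cut_value mem_set//; apply: ge_inf; last by exists q.
have [_ [q0 Bq0] mono] := Gu i; exists (ratr q0) => _ [q' /= Bq' <-].
rewrite leNgt ltr_rat; apply/negP => qq; move: Bq0.
by rewrite (mono (q', q0) (ltW qq) Bq').
Qed.

Lemma cut_value_ge i u q : proper_cut u -> ~~ B i q u -> ratr q <= cut_value i u.
Proof.
move=> Gu Bq; rewrite /cut_value mem_set//.
have [[q1 Bq1] _ mono] := Gu i; apply: lb_le_inf; first by exists (ratr q1), q1.
move=> _ [q' /= Bq' <-]; rewrite ler_rat leNgt; apply/negP => qq; move: Bq.
by rewrite (mono (q', q) (ltW qq) Bq').
Qed.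

Lemma measurable_cut_value i : measurable_fun setT (cut_value i).
Proof.
apply: (measurability _ (RGenInftyO.measurableE R)) => _ [_ [c ->] <-].
(* A value below [c] is witnessed by a rational of the cut below [c], so the preimage is a countable
   union. *)
rewrite setTI (_ : _ @^-1` _ =
  (proper_cut `&` [set u | exists q : rat, ratr q < c /\ B i q u]) `|`
  (~` proper_cut `&` [set u | 0 < c])); last first.
  apply/seteqP; split => u /=; rewrite in_itv/=.
    have [Gu|Gu] := pselect (proper_cut u); last first.
      by rewrite /cut_value memNset// => c0; right.
    move=> Vc; left; split => //.
    have [q] := rat_in_itvoo Vc; rewrite in_itv/= => /andP[Vq qc].
    exists q; split=> //.
    by apply: contraT => /(cut_value_ge Gu); rewrite leNgt Vq.
  move=> [[Gu [q [qc Bq]]]|[Gu c0]].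
    exact: le_lt_trans (cut_value_le Gu Bq) qc.
  by rewrite /cut_value memNset.
have mG := measurable_proper_cut.
apply: measurableU; apply: measurableI => //.
- apply: (measurable_exists_countable (I := rat)) => q.
  have [qc|qc] := boolP (ratr q < c).
    rewrite [X in measurable X](_ : _ = [set u | B i q u])//.
    by apply/seteqP; split => u /= => [[]|].
  by rewrite [X in measurable X](_ : _ = set0)//; apply/seteqP; split => u //= [].
- exact: measurableC.
- have [c0|c0] := boolP (0 < c).
    by rewrite [X in measurable X](_ : _ = setT)//; apply/seteqP; split.
  by rewrite [X in measurable X](_ : _ = set0)//; apply/seteqP; split.
Qed.

Lemma mean_cut_bits (N : nat) (Q : seq bool -> R) :
  \int[nu]_u Q (mkseq (bit L below ^~ u) N) = L (fun x => Q (mkseq (below ^~ x) N)).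
Proof. exact: mean_bits. Qed.

(** Monotonicity at two given rationals concerns finitely many bits and therefore transfers from
    [L]. That a cut is neither empty nor full concerns infinitely many and does not transfer: this
    is how mass escapes. *)
Lemma ae_cut_monotone : {ae nu, forall u, forall iqq : 'I_K * (rat * rat),
  iqq.2.1 <= iqq.2.2 -> B iqq.1 iqq.2.1 u -> B iqq.1 iqq.2.2 u}.
Proof.
apply: ae_forall_countable => -[i [q q']] /=.
have [qq|qq] := boolP (q <= q'); last exact: aeW.
pose l := pickle (i, q); pose l' := pickle (i, q').
have mA : measurable [set u | B i q u && ~~ B i q' u].
  rewrite [X in measurable X](_ : _ = [set u | B i q u] `\` [set u | B i q' u]).
    exact: measurableD (mB _ _) (mB _ _).
  by apply/seteqP; split => u /= => [/andP[? /negP]|[-> /negP]].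
have A0 : nu [set u | B i q u && ~~ B i q' u] = 0%E.
  pose N := (maxn l l').+1.
  have := mean_cut_bits N (fun s => (nth false s l && ~~ nth false s l')%:R).
  have -> : (fun x => (nth false (mkseq (below ^~ x) N) l &&
      ~~ nth false (mkseq (below ^~ x) N) l')%:R) = (fun=> 0 : R).
    apply/funext => x; rewrite !nth_mkseq ?ltnS ?leq_maxl ?leq_maxr//.
    rewrite /below !pickleK/=.
    by case: ltP => //= xq; rewrite (lt_le_trans xq)// ler_rat.
  rewrite (is_mean_cst LP) => I0.
  rewrite -[LHS]fineK ?fin_num_measure// -mean_indic//.
  congr EFin; rewrite -[RHS]I0; apply: eq_Rintegral => u _.
  rewrite !nth_mkseq ?ltnS ?leq_maxl ?leq_maxr// indicE.
  by congr ((nat_of_bool _)%:R); apply/idP/idP; rewrite inE.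
have := null_set_ae_not mA A0; apply: filterS => u /= /negP.
by rewrite negb_and negbK => /orP[/negbTE->|->].
Qed.

Variables (H : ('I_K -> R) -> R) (M C : R) (r : nat).
Hypothesis H_bound : forall v, `|H v| <= M.
Hypothesis H_lip : forall v v' (e : R), (forall i, `|v i - v' i| <= e) ->
  `|H v - H v'| <= C * e.
Hypothesis H_supp : forall v i, r%:R <= `|v i| -> H v = 0.
Hypothesis mH : measurable_fun setT (fun u => H (cut_value ^~ u)).


Let H_quantize (N : nat) (v : 'I_K -> R) (beta : 'I_K -> rat -> bool) :
  (forall i q, beta i q -> v i <= ratr q) ->
  (forall i q, ~~ beta i q -> ratr q <= v i) ->
  `|H (fun i => quantize R r N (beta i)) - H v| <= C * N.+1%:R^-1.
Proof.
move=> h1 h2.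
have C0 : 0 <= C.
  have h (i : 'I_K) : `|(fun=> 0 : R) i - (fun=> 0) i| <= 1 by rewrite subrr normr0.
  by have := H_lip h; rewrite subrr normr0 mulr1.
have [[i [ri rv]]|far] := pselect (exists i,
    r%:R <= `|quantize R r N (beta i)| /\ r%:R <= `|v i|).
  have H0 : H (fun i => quantize R r N (beta i)) = 0.
    exact: (@H_supp (fun i => quantize R r N (beta i)) i).
  rewrite (H_supp rv) H0 subrr normr0.
  by rewrite mulr_ge0// invr_ge0.
apply: H_lip => i.
by have [//|ri] := quantizeP r N (h1 i) (h2 i); case: far; exists i.
Qed.

(** After quantization [H] depends on finitely many bits, for which [mean_bits] gives equality; the
    quantization error is uniform since [H] is Lipschitz. An improper cut is read as a point outside
    the support of [H], which explains the indicator. *)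
Lemma mean_vague_limit :
  \int[nu]_u (\1_proper_cut u * H (cut_value ^~ u)) = L (fun x => H (xi ^~ x)).
Proof.
apply/eqP; rewrite -subr_eq0 -normr_le0; apply/ler_addgt0Pr => e e0.
rewrite add0r; pose N := Num.bound (2 * C / e).
have CN : C * N.+1%:R^-1 <= e / 2.
  have [C0|C0] := leP C 0.
    by rewrite (@le_trans _ _ 0) ?divr_ge0 ?(ltW e0)// mulr_le0_ge0// invr_ge0.
  rewrite ler_pdivrMr// -ler_pdivrMl ?divr_gt0// invf_div.
  have h : 0 <= 2 * C / e by rewrite divr_ge0 ?mulr_ge0 ?ltW.
  have := archi_boundP h; rewrite -/N => /ltW hN.
  by rewrite mulrAC (le_trans hN)// ler_nat leqnSn.
pose code (i : 'I_K) (j : nat) := pickle (i, grid_point r N j).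
pose J := (2 * r * N.+1)%N.
(* Enough bits to contain every comparison that the quantization makes. *)
pose top := (\max_(i < K) \max_(j < J.+1) code i j).+1.
pose Q (s : seq bool) := H (fun i => quantize R r N (fun q => nth false s (pickle (i, q)))).
have QE (f : nat -> bool) : Q (mkseq f top) =
    H (fun i => quantize R r N (fun q => f (pickle (i, q)))).
  congr H; apply/funext => i; rewrite /quantize; congr (_%:R / _ - _).
  apply: eq_in_find => j; rewrite mem_iota add0n leq0n /= => jJ.
  rewrite nth_mkseq// ltnS.
  by rewrite (leq_trans _ (leq_bigmax i))// (leq_trans _ (leq_bigmax (Ordinal jJ))).
have bits : \int[nu]_u H (fun i => quantize R r N (B i ^~ u)) =
    L (fun x => H (fun i => quantize R r N (fun q => below (pickle (i, q)) x))).
  transitivity (\int[nu]_u Q (mkseq (bit L below ^~ u) top)).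
    by apply: eq_Rintegral => u _; rewrite QE.
  by rewrite mean_cut_bits; congr L; apply/funext => x; rewrite QE.
have approx_X : `|L (fun x => H (fun i => quantize R r N (fun q => below (pickle (i, q)) x))) -
    L (fun x => H (xi ^~ x))| <= e / 2.
  apply: (is_mean_dist LP (M := M)) => // x; apply: le_trans CN.
  apply: H_quantize => i q; rewrite /below pickleK/=; first exact: ltW.
  by rewrite -leNgt.
have approx_u : `|\int[nu]_u H (fun i => quantize R r N (B i ^~ u)) -
    \int[nu]_u (\1_proper_cut u * H (cut_value ^~ u))| <= e / 2.
  have bH : bounded_measurable (fun u => \1_proper_cut u * H (cut_value ^~ u)).
    apply: bounded_measurableM; last by split => //; exists M.
    by apply: bounded_measurable_indic; exact: measurable_proper_cut.
  have bQ : bounded_measurable (fun u => H (fun i => quantize R r N (B i ^~ u))).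
    rewrite (_ : (fun u => _) = (fun u => Q (mkseq (bit L below ^~ u) top))).
      exact: bounded_measurable_bits.
    by apply/funext => u; rewrite QE.
  apply: mean_dist_le_ae => //; first by rewrite divr_ge0// ltW.
  have := ae_cut_monotone; apply: filterS => u mono.
  have [Gu|Gu] := pselect (proper_cut u).
    rewrite indicE mem_set// mul1r; apply: le_trans CN.
    apply: H_quantize => i q; [exact: cut_value_le|exact: cut_value_ge].
  rewrite indicE memNset// mul0r subr0.
  (* As all cuts are monotone here, an improper one is empty or full. *)
  have [i [c ic]] : exists i c, forall q, B i q u = c.
    apply: contrapT => nc; apply: Gu => i; split.
    - apply: contrapT => nB; apply: nc; exists i, false => q.
      by apply/negP => Bq; apply: nB; exists q.
    - apply: contrapT => nB; apply: nc; exists i, true => q.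
      by apply: contrapT => /negP Bq; apply: nB; exists q.
    - by move=> qq; exact: (mono (i, qq)).
  rewrite (H_supp (i := i)) ?normr0 ?divr_ge0 ?(ltW e0)//.
  exact: quantize_cst ic.
rewrite distrC in approx_u.
rewrite -bits in approx_X.
by rewrite (splitr e) (le_trans (ler_distD _ _ _) (lerD approx_u approx_X)).
Qed.

End VagueLimit.

(** * Existence of an optimal strategy *)

Section SmoothSum.
Context (R : realType) (K : nat) (p : 'I_K.+1 -> R).
Hypothesis p_gt0 : forall i, 0 < p i.
Context (J : finType) (y : J -> 'rV[R]_K.+1) (e : R).
Hypothesis e_gt0 : 0 < e.
Implicit Types (x : 'rV[R]_K.+1) (z : 'I_K.+1 -> R).

Definition smooth_sum x z : R :=
  \sum_j clip e (max_time p x z - max_time p (y j) z).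

Lemma smooth_sum_norm x z : `|smooth_sum x z| <= #|J|%:R.
Proof.
rewrite (le_trans (ler_norm_sum _ _ _))// -sum1_card natr_sum.
by apply: ler_sum => j _; exact: clip_norm.
Qed.

(** The noise moves both maximum times and the allocation only one of them, whence [s + 2 * t]. *)
Lemma smooth_sum_dist x x' z z' (s t : R) :
  (forall i, `|x ord0 i - x' ord0 i| / p i <= s) ->
  (forall i, `|z i - z' i| / Num.sqrt (p i) <= t) ->
  `|smooth_sum x z - smooth_sum x' z'| <= #|J|%:R * ((s + 2 * t) / e).
Proof.
move=> xs zt; rewrite /smooth_sum -sumrB (le_trans (ler_norm_sum _ _ _))//.
rewrite mulr_natl -sumr_const; apply: ler_sum => j _.
rewrite (le_trans (clip_lipschitz _ _ _))// ler_pM2r ?invr_gt0//.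
have sq i : 0 < Num.sqrt (p i) by rewrite sqrtr_gt0.
have h1 : `|max_time p x z - max_time p x' z'| <= s + t.
  apply: max_time_dist => i; rewrite /coord_time opprD addrACA -!mulrBl.
  rewrite (le_trans (ler_normD _ _))// !normrM.
  rewrite (ger0_norm (_ : 0 <= (p i)^-1)) ?(ger0_norm (_ : 0 <= (Num.sqrt (p i))^-1)).
  - by rewrite lerD.
  - by rewrite invr_ge0 ltW.
  - by rewrite invr_ge0 ltW.
have h2 : `|max_time p (y j) z - max_time p (y j) z'| <= t.
  apply: max_time_dist => i; rewrite /coord_time opprD addrACA subrr add0r -mulrBl.
  by rewrite normrM (ger0_norm (_ : 0 <= (Num.sqrt (p i))^-1)) // invr_ge0 ltW.
rewrite (_ : _ - _ - _ = (max_time p x z - max_time p x' z') -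
  (max_time p (y j) z - max_time p (y j) z')); last by ring.
rewrite (le_trans (ler_normB _ _))// (le_trans (lerD h1 h2))//.
by rewrite mulr_natl mulr2n addrA.
Qed.

Lemma measurable_clip : measurable_fun setT (clip e).
Proof.
apply: measurable_maxr => //; apply: measurable_minr => //.
exact: measurable_funM.
Qed.

Lemma bounded_measurable_smooth_sum d (U : measurableType d)
    (X : U -> 'rV[R]_K.+1) (W : U -> 'I_K.+1 -> R) :
  (forall i, measurable_fun setT (fun u => X u ord0 i)) ->
  (forall i, measurable_fun setT (fun u => W u i)) ->
  bounded_measurable (fun u => smooth_sum (X u) (W u)).
Proof.
move=> mX mW; apply: bounded_measurable_sum => j.
split; last by exists 1 => u; exact: clip_norm.
apply: (measurableT_comp measurable_clip); apply: measurable_funB.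
  exact: measurable_max_time.
exact: (@measurable_max_time _ _ p _ _ (fun=> y j)).
Qed.

Context d (Om : measurableType d) (P : probability Om R).
Variable Z : 'I_K.+1 -> {RV P >-> R}.

Definition smooth_payoff x : R := 2^-1 * \int[P]_w smooth_sum x (Z ^~ w).

Lemma bounded_measurable_smooth_payoff d' (U : measurableType d')
    (X : U -> 'rV[R]_K.+1) :
  (forall i, measurable_fun setT (fun u => X u ord0 i)) ->
  bounded_measurable (fun u => smooth_payoff (X u)).
Proof.
move=> mX; apply: bounded_measurableZl.
apply: (@bounded_measurable_mean _ _ _ _ _ (fun u w => smooth_sum (X u) (Z ^~ w))).
apply: (@bounded_measurable_smooth_sum _ (U * Om)%type (X \o fst) (fun uw => Z ^~ uw.2)) => i.
- exact: (measurableT_comp (mX i)).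
- exact: (measurableT_comp (f := Z i)).
Qed.

Let bS x : bounded_measurable (fun w => smooth_sum x (Z ^~ w)).
Proof. exact: (@bounded_measurable_smooth_sum _ Om (fun=> x) (fun w => Z ^~ w)). Qed.

Lemma smooth_payoff_dist x x' (s : R) :
  (forall i, `|x ord0 i - x' ord0 i| / p i <= s) ->
  `|smooth_payoff x - smooth_payoff x'| <= #|J|%:R * (s / e).
Proof.
move=> xs; rewrite -mulrBr normrM ger0_norm//.
rewrite (@le_trans _ _ (2^-1 * (#|J|%:R * (s / e))))//.
  rewrite ler_pM2l ?invr_gt0//; apply: mean_dist_le => // w.
  rewrite -[s]addr0 -[0 in X in _ <= X](mulr0 2); apply: smooth_sum_dist => // i.
  by rewrite subrr normr0 mul0r.
rewrite ler_piMl// ?invf_le1 ?ler1n// mulr_ge0// divr_ge0 ?(ltW e_gt0)//.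
by apply: le_trans (xs ord0); rewrite divr_ge0 ?normr_ge0 ?(ltW (p_gt0 _)).
Qed.

Lemma smooth_payoff_norm x : `|smooth_payoff x| <= 2^-1 * #|J|%:R.
Proof.
rewrite normrM ger0_norm// ler_pM2l ?invr_gt0//; apply: mean_norm_le => // w.
exact: smooth_sum_norm.
Qed.

End SmoothSum.

Section SmoothSumApprox.
Context (R : realType) (K : nat) (p : 'I_K.+1 -> R).
Hypothesis p_gt0 : forall i, 0 < p i.
Context d (Om : measurableType d) (P : probability Om R).
Variable Z : 'I_K.+1 -> {RV P >-> R}.

Lemma smooth_payoff_approx (J : finType) (y : J -> 'rV[R]_K.+1) (e : R) :
  0 < e ->
  (forall (a : J -> R) (c : R) z,
    (forall j, `|a j - (c - max_time p (y j) z)| <= e) ->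
    `|\sum_j Num.sg (a j) - \sum_j clip e (c - max_time p (y j) z)|
      <= 2 * K.+1%:R) ->
  forall x, `|\sum_j cont_payoff p Z (y j) x - smooth_payoff p y e Z x| <= K.+1%:R.
Proof.
move=> e0 approx x.
pose G j w := Num.sg (max_time p x (Z ^~ w) - max_time p (y j) (Z ^~ w)).
have bG j : bounded_measurable (G j).
  exact: (@bounded_measurable_max_time_sgr _ _ p _ _ (fun=> y j) (fun=> x) (fun w => Z ^~ w)).
under eq_bigr do rewrite cont_payoffE.
rewrite -mulr_sumr -(mean_sum P _ bG) -mulrBr normrM ger0_norm//.
rewrite -(@ler_pM2l _ 2)// mulrA divff ?mul1r//.
apply: mean_dist_le => [||w].
- exact: bounded_measurable_sum.
- exact: (@bounded_measurable_smooth_sum _ _ p _ _ _ _ Om (fun=> x) (fun w => Z ^~ w)).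
- by apply: approx => j; rewrite subrr normr0 ltW.
Qed.

End SmoothSumApprox.

Section AllocationOf.
Context (R : realType) (K : nat).
Implicit Types v : 'I_K -> R.

(** Parametrizes the hyperplane of allocations by [K] free coordinates. The limit is taken in these,
    one at a time, and the result is an allocation by construction. *)
Definition allocation_of v : 'rV[R]_K.+1 :=
  \row_i (if unlift ord0 i is Some j then v j else - \sum_j v j).

Lemma allocation_of_lift v j : allocation_of v ord0 (lift ord0 j) = v j.
Proof. by rewrite mxE liftK. Qed.

Lemma allocation_of0 v : allocation_of v ord0 ord0 = - \sum_j v j.
Proof. by rewrite mxE unlift_none. Qed.

Lemma sum_allocation_of v : \sum_i allocation_of v ord0 i = 0.
Proof.
rewrite big_ord_recl allocation_of0.
rewrite [X in _ + X](_ : _ = \sum_j v j) ?addNr//.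
by apply: eq_bigr => j _; exact: allocation_of_lift.
Qed.

Lemma allocation_ofK (x : 'rV[R]_K.+1) : \sum_i x ord0 i = 0 ->
  allocation_of (fun j => x ord0 (lift ord0 j)) = x.
Proof.
move=> x0; apply/rowP => i; case: (unliftP ord0 i) => [j|] ->.
  by rewrite allocation_of_lift.
rewrite allocation_of0; move: x0; rewrite big_ord_recl => /eqP.
by rewrite addr_eq0 => /eqP ->.
Qed.

Lemma measurable_allocation_of d (U : measurableType d) (V : 'I_K -> U -> R) :
  (forall j, measurable_fun setT (V j)) ->
  forall i, measurable_fun setT (fun u => allocation_of (V ^~ u) ord0 i).
Proof.
move=> mV i; case: (unliftP ord0 i) => [j|] ->.
  by under eq_fun do rewrite allocation_of_lift; exact: mV.
under eq_fun do rewrite allocation_of0.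
apply: (measurableT_comp (@oppr_measurable R setT)).
elim: (index_enum _) => [|j s IH].
  under eq_fun do rewrite big_nil.
  exact: measurable_cst.
by under eq_fun do rewrite big_cons; exact: measurable_funD.
Qed.

Lemma allocation_of_dist v v' (e : R) : 0 <= e -> (forall j, `|v j - v' j| <= e) ->
  forall i, `|allocation_of v ord0 i - allocation_of v' ord0 i| <= K.+1%:R * e.
Proof.
move=> e0 vv' i; case: (unliftP ord0 i) => [j|] ->.
  rewrite !allocation_of_lift (le_trans (vv' j))// ler_peMl// ler1n//.
rewrite !allocation_of0 opprK addrC -sumrB (le_trans (ler_norm_sum _ _ _))//.
apply: (@le_trans _ _ (\sum_(j < K) e)).
  by apply: ler_sum => j _; rewrite distrC.
by rewrite sumr_const card_ord mulr_natl mulrS lerDr.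
Qed.

Lemma allocation_of_large v : exists i,
  \sum_j `|v j| <= 2 * K.+1%:R * allocation_of v ord0 i.
Proof.
set x := allocation_of v.
have [i0 _ xmax] := @Order.TotalTheory.arg_maxP _ _ _ (ord0 : 'I_K.+1) predT (fun i => x ord0 i) isT.
exists i0; have le_x i : x ord0 i <= x ord0 i0 by exact: xmax.
have x_ge0 : 0 <= x ord0 i0.
  have : 0 <= \sum_(i < K.+1) x ord0 i0.
    by rewrite -[leLHS](sum_allocation_of v); apply: ler_sum.
  by rewrite sumr_const card_ord pmulrn_lge0.
apply: (@le_trans _ _ (\sum_i `|x ord0 i|)).
  rewrite [leRHS]big_ord_recl.
  rewrite [X in _ <= _ + X](_ : _ = \sum_j `|v j|) ?lerDr//.
  by apply: eq_bigr => j _; rewrite /x allocation_of_lift.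
(* For the largest coordinate [m >= 0] one has [|x_i| <= 2 * m - x_i], and the [x_i] sum to 0. *)
apply: (@le_trans _ _ (\sum_i (2 * x ord0 i0 - x ord0 i))).
  apply: ler_sum => i _; have := le_x i.
  by rewrite ler_norml => xi; apply/andP; split; lra.
rewrite sumrB sum_allocation_of subr0 sumr_const card_ord.
by rewrite -[leLHS]mulr_natr mulrAC.
Qed.

End AllocationOf.

Section UltraMean.
Context (R : realType) (w : nat -> nat -> R).
Hypothesis w_ge0 : forall n i, 0 <= w n i.
Hypothesis w_sum : forall n, \sum_(i < n.+1) w n i = 1.

Definition weighted_sum (n : nat) (f : nat -> R) := \sum_(i < n.+1) w n i * f i.

Definition ultra_mean (f : nat -> R) : R :=
  lim (weighted_sum n f @[n --> ultra_nat]).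

Lemma weighted_sum_norm n f (M : R) : (forall l, `|f l| <= M) ->
  `|weighted_sum n f| <= M.
Proof.
move=> fM; rewrite (le_trans (ler_norm_sum _ _ _))//.
rewrite -[leRHS]mul1r -(w_sum n) mulr_suml; apply: ler_sum => i _.
by rewrite normrM (ger0_norm (w_ge0 n i)) ler_wpM2l.
Qed.

Lemma cvg_weighted_sum f (M : R) : (forall l, `|f l| <= M) ->
  weighted_sum n f @[n --> ultra_nat] --> ultra_mean f.
Proof.
by move=> fM; apply: (@cvg_ultra_nat _ _ M) => n; exact: weighted_sum_norm.
Qed.

#[local] Existing Instance ultra_nat_ultra.

Lemma ultra_mean_le f (M c : R) : (forall l, `|f l| <= M) ->
  (\forall n \near \oo, weighted_sum n f <= c + n.+1%:R^-1) -> ultra_mean f <= c.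
Proof.
move=> fM fc.
have h : c + n.+1%:R^-1 @[n --> ultra_nat] --> c.
  rewrite -[X in _ --> X]addr0; apply: cvgD; first exact: cvg_cst.
  exact: (cvg_trans (cvg_app _ ultra_nat_eventually) (@cvg_harmonic R)).
rewrite -[leRHS](cvg_lim _ h)//; apply: ler_lim.
- by apply/cvg_ex; exists (ultra_mean f); exact: (cvg_weighted_sum fM).
- by apply/cvg_ex; exists c; exact: h.
- exact: ultra_nat_eventually fc.
Qed.

Lemma is_mean_ultra_mean : is_mean ultra_mean.
Proof.
split.
- move=> f g M fM gM; apply/cvg_lim => //.
  rewrite (_ : (fun n => _) = (fun n => weighted_sum n f + weighted_sum n g)).
    by apply: cvgD; [exact: (cvg_weighted_sum fM)|exact: (cvg_weighted_sum gM)].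
  apply/funext => n; rewrite /weighted_sum -big_split/=.
  by apply: eq_bigr => i _; rewrite mulrDr.
- move=> c f M fM; apply/cvg_lim => //.
  rewrite (_ : (fun n => _) = (fun n => c * weighted_sum n f)).
    by apply: cvgMr; exact: (cvg_weighted_sum fM).
  apply/funext => n; rewrite /weighted_sum mulr_sumr.
  by apply: eq_bigr => i _; rewrite mulrCA.
- move=> f g M fM gM fg; apply: ler_lim.
  + by apply/cvg_ex; exists (ultra_mean f); exact: (cvg_weighted_sum fM).
  + by apply/cvg_ex; exists (ultra_mean g); exact: (cvg_weighted_sum gM).
  + by apply: nearW => n; apply: ler_sum => i _; rewrite ler_wpM2l.
- move=> c; apply/cvg_lim => //.
  rewrite (_ : (fun n => _) = (fun n => c)); first exact: cvg_cst.
  by apply/funext => n; rewrite /weighted_sum -mulr_suml w_sum mul1r.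
Qed.

End UltraMean.

Section RationalAllocations.
Context (R : realType) (K : nat).

(** Orthogonal projection of a rational vector onto the hyperplane of allocations; the images are
    countable and dense. *)
Definition rational_allocation (q : {ffun 'I_K.+1 -> rat}) : 'rV[R]_K.+1 :=
  \row_i (ratr (q i) - (\sum_j ratr (q j)) / K.+1%:R).

Lemma sum_rational_allocation q : \sum_i rational_allocation q ord0 i = 0.
Proof.
under eq_bigr do rewrite mxE.
rewrite sumrB sumr_const card_ord -[X in _ - X]mulr_natr divfK ?subrr//.
Qed.

Definition nth_allocation (n : nat) : 'rV[R]_K.+1 :=
  if unpickle n is Some q then rational_allocation q else 0.

Lemma sum_nth_allocation n : \sum_i nth_allocation n ord0 i = 0.
Proof.
rewrite /nth_allocation; case: unpickle => [q|]; first exact: sum_rational_allocation.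
by rewrite big1// => i _; rewrite mxE.
Qed.

Lemma nth_allocation_dense (y : 'rV[R]_K.+1) : \sum_i y ord0 i = 0 ->
  forall e : R, 0 < e ->
  exists2 x, range nth_allocation x & forall i, `|x ord0 i - y ord0 i| < e.
Proof.
move=> sum_y e e0.
have /choice[q qP] : forall i, exists q : rat, `|ratr q - y ord0 i| < e / 2.
  move=> i; have [|q] := @rat_in_itvoo R (y ord0 i - e / 2) (y ord0 i + e / 2).
    by lra.
  by rewrite in_itv/= => hq; exists q; rewrite ltr_distl.
exists (rational_allocation (finfun q)).
  by exists (pickle (finfun q)) => //; rewrite /nth_allocation pickleK.
move=> i; rewrite mxE ffunE; under eq_bigr do rewrite ffunE.
have -> : \sum_j ratr (q j) = \sum_j (ratr (q j) - y ord0 j) :> R.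
  by rewrite sumrB sum_y subr0.
rewrite addrAC (le_lt_trans (ler_normB _ _))// [ltRHS]splitr ltr_leD//.
rewrite normrM normfV normr_nat ler_pdivrMr//.
rewrite (le_trans (ler_norm_sum _ _ _))// mulr_natr.
by rewrite -[K.+1 in leRHS]card_ord -sumr_const ler_sum// => j _; exact/ltW/qP.
Qed.

End RationalAllocations.

Section Cutoff.
Context (R : realType) (K : nat).

Definition cutoff (r : nat) (v : 'I_K -> R) : R :=
  Num.max 0 (Num.min 1 (r%:R - \sum_j `|v j|)).

Lemma cutoff_itv r v : 0 <= cutoff r v <= 1.
Proof. by rewrite /cutoff le_max lexx/= ge_max ler01 ge_min lexx. Qed.

Lemma cutoff_dist r v v' (t : R) : (forall j, `|v j - v' j| <= t) ->
  `|cutoff r v - cutoff r v'| <= K%:R * t.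
Proof.
move=> vv'; apply: (@le_trans _ _ `|\sum_j `|v j| - \sum_j `|v' j| |).
  rewrite /cutoff /Num.max /Num.min; set a := \sum_j _; set b := \sum_j _.
  rewrite ler_normr !ler_norml.
  by repeat case: ifPn; rewrite -?leNgt => *; lra.
rewrite -sumrB (le_trans (ler_norm_sum _ _ _))// mulr_natl.
rewrite -[K in leRHS]card_ord -sumr_const; apply: ler_sum => j _.
by rewrite (le_trans (ler_dist_dist _ _)).
Qed.

Lemma cutoff_supp r v j : r%:R <= `|v j| -> cutoff r v = 0.
Proof.
move=> rv; rewrite /cutoff max_l// ge_min subr_le0 (le_trans rv) ?orbT//.
by rewrite (bigD1 j)//= lerDl sumr_ge0.
Qed.

Lemma cutoff1 r v : \sum_j `|v j| <= r%:R - 1 -> cutoff r v = 1.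
Proof. by move=> h; rewrite /cutoff min_l ?max_r//; lra. Qed.

End Cutoff.

Section Infinity.
Context (R : realType) (K : nat) (p : 'I_K.+1 -> R).
Hypotheses (p_gt0 : forall i, 0 < p i) (sum_p : \sum_i p i = 1).
Context d (Om : measurableType d) (P : probability Om R).
Variable Z : 'I_K.+1 -> {RV P >-> R}.

Let p_le1 i : p i <= 1.
Proof.
by rewrite -sum_p (bigD1 i)//= lerDl sumr_ge0// => j _; exact: ltW.
Qed.

Let noise w : R := \sum_i `|Z i w| / Num.sqrt (p i).

Let noise_ge i w : `|Z i w / Num.sqrt (p i)| <= noise w.
Proof.
rewrite /noise (bigD1 i)//= normrM [`|_^-1|]ger0_norm ?invr_ge0// lerDl.
by apply: sumr_ge0 => j _; rewrite divr_ge0.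
Qed.

Let measurable_noise : measurable_fun setT noise.
Proof.
rewrite /noise; elim: (index_enum _) => [|i s IH].
  under eq_fun do rewrite big_nil.
  exact: measurable_cst.
under eq_fun do rewrite big_cons.
apply: measurable_funD => //; apply: measurable_funM => //.
exact: measurableT_comp.
Qed.

Let bounded_tail (n : nat) :
  bounded_measurable (fun w => (n%:R <= noise w)%R%:R : R).
Proof.
rewrite (_ : (fun w => _) = \1_[set w | n%:R <= noise w]); last first.
  by apply/funext => w; rewrite indicE mem_setE.
apply: bounded_measurable_indic.
rewrite (_ : [set _ | _] = noise @^-1` `[n%:R, +oo[%classic); last first.
  by apply/seteqP; split => w /=; rewrite in_itv/= andbT.
by rewrite -[X in measurable X]setTI; exact: measurable_noise.
Qed.

Let noise_tail (e : R) : 0 < e -> exists n : nat,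
  \int[P]_w (n%:R <= noise w)%R%:R <= e.
Proof.
move=> e0.
have : \int[P]_w (n%:R <= noise w)%R%:R @[n --> \oo] --> \int[P]_w (0 : R).
  apply: (mean_dominated_cvg (M := 1)).
  - by move=> n; exact: (bounded_tail n).1.
  - exact: measurable_cst.
  - by move=> n w; case: (n%:R <= noise w)%R; rewrite ?normr0 ?normr1.
  - apply: aeW => w; apply: cvg_near_cst; near=> n.
    suff -> : (n%:R <= noise w) = false by [].
    by apply/negbTE; rewrite -ltNge; near: n; exact: nbhs_infty_gtr.
rewrite mean_cst => /cvgrPdist_le /(_ e e0) [n _ /(_ n (leqnn n))] /= h.
exists n; move: h; rewrite sub0r normrN => h.
by rewrite (le_trans (ler_norm _)).
Unshelve. all: by end_near. Qed.

(* A huge allocation has a huge positive coordinate, since its coordinates sum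
   to 0; hence it takes a huge time. *)
Lemma smooth_payoff_at_infinity (J : finType) (y : J -> 'rV[R]_K.+1) (e eta : R) :
  0 < e -> 0 < eta -> exists r : nat, forall v : 'I_K -> R,
    r%:R <= \sum_j `|v j| ->
    2^-1 * #|J|%:R - smooth_payoff p y e Z (allocation_of v) <= eta.
Proof.
move=> e0 eta0.
have [n nP] := noise_tail (divr_gt0 eta0 (ltr0Sn R #|J|)).
pose b : R := \sum_j \sum_i `|y j ord0 i| / p i.
(* When the noise is below [n], every [y j] finishes by [b + n], while a coordinate of at least
   [2 * n + b + e] finishes no earlier than [n + b + e]: the clip equals 1. The factor in front is
   that of [allocation_of_large]. *)
pose r := Num.bound (2 * K.+1%:R * (2 * n%:R + b + e)).
have b0 : 0 <= b.
  by apply: sumr_ge0 => j _; apply: sumr_ge0 => i _; rewrite divr_ge0// ltW.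
have r_large : 2 * K.+1%:R * (2 * n%:R + b + e) <= r%:R.
  apply/ltW/archi_boundP; by rewrite mulr_ge0// addr_ge0 ?(ltW e0)// addr_ge0// mulr_ge0.
exists r => v rv; set x := allocation_of v.
have [i xi] := allocation_of_large v; rewrite -/x in xi.
have xi_large : 2 * n%:R + b + e <= x ord0 i.
  rewrite -(@ler_pM2l _ (2 * K.+1%:R)) ?mulr_gt0//.
  exact: le_trans r_large (le_trans rv xi).
have far w : noise w < n%:R -> smooth_sum p y e x (Z ^~ w) = #|J|%:R.
  move=> wn; rewrite /smooth_sum -sum1_card natr_sum; apply: eq_bigr => j _.
  suff h : e <= max_time p x (Z ^~ w) - max_time p (y j) (Z ^~ w).
    have h' : 1 <= (max_time p x (Z ^~ w) - max_time p (y j) (Z ^~ w)) / e.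
      by rewrite ler_pdivlMr// mul1r.
    by rewrite /clip min_l// max_r// lerN10.
  have h1 : x ord0 i - noise w <= max_time p x (Z ^~ w).
    apply: le_trans (coord_time_le_max p x (Z ^~ w) i); rewrite /coord_time.
    apply: lerD.
      rewrite ler_peMr ?invf_ge1// (le_trans _ xi_large)// !addr_ge0 ?mulr_ge0//.
      exact: ltW.
    by have := noise_ge i w; rewrite ler_norml => /andP[].
  have h2 : max_time p (y j) (Z ^~ w) <= b + noise w.
    apply: max_time_le => l; apply: lerD.
      rewrite (le_trans (ler_norm _))// normrM [`|_^-1|]gtr0_norm ?invr_gt0//.
      rewrite /b (bigD1 j)//= (bigD1 l)//= -!addrA lerDl addr_ge0//.
        by apply: sumr_ge0 => i' _; rewrite divr_ge0// ltW.
      apply: sumr_ge0 => j' _; apply: sumr_ge0 => i' _.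
      by rewrite divr_ge0// ltW.
    exact: le_trans (ler_norm _) (noise_ge l w).
  by lra.
have bS : bounded_measurable (fun w => smooth_sum p y e x (Z ^~ w)).
  exact: (@bounded_measurable_smooth_sum _ _ p _ _ _ _ Om (fun=> x) (fun w => Z ^~ w)).
have bI := bounded_tail n.
rewrite /smooth_payoff -mulrBr -(mean_cst P #|J|%:R) -meanB//; last first.
  exact: bounded_measurable_cst.
rewrite -(@ler_pM2l _ 2)// mulrA divff ?mul1r//.
(* The deficit is 0 unless the noise is large, and never exceeds [2 * #|J|]. *)
apply: (@le_trans _ _ (\int[P]_w (2 * #|J|%:R * (n%:R <= noise w)%R%:R))).
  apply: mean_le.
  - by apply: bounded_measurableB => //; exact: bounded_measurable_cst.
  - exact: bounded_measurableZl.
  - move=> w; have [wn|wn] := leP n%:R (noise w); last first.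
      by rewrite far// subrr mulr0.
    have := smooth_sum_norm p y e x (Z ^~ w); rewrite ler_norml mulr1 => /andP[h _].
    by rewrite mulr_natl mulr2n lerD2l lerNl.
rewrite meanZl// -mulrA ler_pM2l//.
apply: (@le_trans _ _ (#|J|%:R * (eta / #|J|.+1%:R))).
  by rewrite ler_wpM2l.
rewrite mulrCA ler_piMr ?(ltW eta0)// ler_pdivrMr// mul1r ler_nat//.
Qed.

End Infinity.

Lemma bounded_measurable_cutoff (R : realType) (K r : nat) d (U : measurableType d)
    (v : 'I_K -> U -> R) : (forall j, measurable_fun setT (v j)) ->
  bounded_measurable (fun u => cutoff r (v ^~ u)).
Proof.
move=> mv; split; last first.
  by exists 1 => u; have /andP[c0 c1] := cutoff_itv r (v ^~ u); rewrite ger0_norm.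
apply: measurable_maxr => //; apply: measurable_minr => //; apply: measurable_funB => //.
elim: (index_enum _) => [|i s IH].
  under eq_fun do rewrite big_nil.
  exact: measurable_cst.
under eq_fun do rewrite big_cons.
apply: measurable_funD => //; exact: measurableT_comp.
Qed.

Section EscapingMass.
Context (R : realType) (K : nat) (p : 'I_K.+1 -> R).
Hypotheses (p_gt0 : forall i, 0 < p i) (sum_p : \sum_i p i = 1).
Hypothesis K_gt0 : (0 < K)%N.
Context d (Om : measurableType d) (P : probability Om R).
Variable Z : 'I_K.+1 -> {RV P >-> R}.
Variable L : (nat -> R) -> R.
Hypothesis LP : is_mean L.
Let pts := @nth_allocation R K.
Hypothesis L_payoff : forall l, L (fun l' => cont_payoff p Z (pts l) (pts l')) <= 0.

Let xi (j : 'I_K) (l : nat) := pts l ord0 (lift ord0 j).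

Let xiE l : allocation_of (xi ^~ l) = pts l.
Proof. by apply: allocation_ofK; exact: sum_nth_allocation. Qed.

Let G := proper_cut L xi.
Let V u := allocation_of (cut_value L xi ^~ u).
Let rho : R -> R := \1_G.
Let nu : probability R R := unit_law R.
Let m := \int[nu]_u rho u.

Let mG : measurable G.
Proof. exact: measurable_proper_cut. Qed.

Let mV i : measurable_fun setT (fun u => V u ord0 i).
Proof. by apply: measurable_allocation_of => j; exact: measurable_cut_value. Qed.

Let brho : bounded_measurable rho.
Proof. exact: bounded_measurable_indic. Qed.

Lemma mean_smooth_payoff_points (J : finType) (y : J -> 'rV[R]_K.+1) (e : R) :
  0 < e -> (forall j, range pts (y j)) ->
  (forall x, `|\sum_j cont_payoff p Z (y j) x - smooth_payoff p y e Z x| <= K.+1%:R) ->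
  L (fun l => smooth_payoff p y e Z (pts l)) <= K.+1%:R.
Proof.
move=> e0 Dy near.
have h1 : L (fun l => \sum_j cont_payoff p Z (y j) (pts l)) <= 0.
  rewrite (@is_mean_sum _ _ _ LP _ _ _ 2^-1); last first.
    by move=> j l; exact: cont_payoff_norm.
  by apply: sumr_le0 => j _; have [l _ <-] := Dy j; exact: L_payoff.
have B l : `|smooth_payoff p y e Z (pts l)| <= #|J|%:R + K.+1%:R.
  rewrite (le_trans (smooth_payoff_norm _ _ _ _ _))// ler_wpDr// ler_piMl//.
  by rewrite invf_le1// ler1n.
have B' l : `|\sum_j cont_payoff p Z (y j) (pts l)| <= #|J|%:R + K.+1%:R.
  rewrite (le_trans (ler_norm_sum _ _ _))// ler_wpDr//.
  rewrite -sum1_card natr_sum; apply: ler_sum => j _.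
  by rewrite (le_trans (cont_payoff_norm _ _ _ _))// invf_le1// ler1n.
have := @is_mean_dist _ _ _ LP _ _ _ K.+1%:R B' B (fun l => near (pts l)).
by rewrite ler_norml => /andP[h2 _]; lra.
Qed.

(** At infinity [smooth_payoff] tends to its upper bound [2^-1 * #|J|] and not to 0. So the vague
    limit is applied to the deficit from this bound, and the escaped mass [1 - m] is thereby
    credited with the full bound. *)
Lemma mean_smooth_payoff_cut (J : finType) (y : J -> 'rV[R]_K.+1) (e : R) :
  0 < e -> (forall j, range pts (y j)) ->
  (forall x, `|\sum_j cont_payoff p Z (y j) x - smooth_payoff p y e Z x| <= K.+1%:R) ->
  \int[nu]_u (rho u * smooth_payoff p y e Z (V u)) + (1 - m) * (2^-1 * #|J|%:R)
    <= K.+1%:R.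
Proof.
move=> e0 Dy near; have L_le := mean_smooth_payoff_points e0 Dy near.
pose Psi := smooth_payoff p y e Z; rewrite -/Psi in L_le near *.
pose N : R := #|J|%:R; rewrite -/N.
have N0 : 0 <= N by exact: ler0n.
have Psi_le x : - (2^-1 * N) <= Psi x <= 2^-1 * N.
  by rewrite -ler_norml; exact: smooth_payoff_norm.
have bPsi : bounded_measurable (fun u => rho u * Psi (V u)).
  by apply: bounded_measurableM => //; exact: bounded_measurable_smooth_payoff.
apply/ler_addgt0Pr => eta eta0.
have [r rP] := smooth_payoff_at_infinity p_gt0 sum_p Z y e0 eta0.
pose h v := 2^-1 * N - Psi (allocation_of v).
have h0 v : 0 <= h v by have := Psi_le (allocation_of v); rewrite /h; lra.
have hN v : h v <= N by have := Psi_le (allocation_of v); rewrite /h; lra.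
(* [mean_vague_limit] asks for compact support; the cutoff costs at most [eta], as the deficit [h]
   is no larger than that beyond radius [r]. *)
pose H v := h v * cutoff r.+1 v.
have H_le v : 0 <= H v <= h v.
  have /andP[c0 c1] := cutoff_itv r.+1 v.
  by rewrite mulr_ge0//= ler_piMr.
have H_ge v : h v - eta <= H v.
  have [rv|rv] := leP r%:R (\sum_j `|v j|).
    have := rP v rv; rewrite -/N -/(h v) => hh.
    by have /andP[H0 _] := H_le v; lra.
  by rewrite /H cutoff1 ?mulr1 ?gerBl ?(ltW eta0)// -natr1 addrK ltW.
have mh : bounded_measurable (fun u => h (cut_value L xi ^~ u)).
  apply: bounded_measurableB; first exact: bounded_measurable_cst.
  exact: bounded_measurable_smooth_payoff.
have bH : bounded_measurable (fun u => H (cut_value L xi ^~ u)).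
  apply: bounded_measurableM => //; apply: bounded_measurable_cutoff => j.
  exact: measurable_cut_value.
pose S := \sum_i (p i)^-1.
pose C := N * (K.+1%:R * S / e) + N * K%:R.
have H_lip v v' t : (forall i, `|v i - v' i| <= t) -> `|H v - H v'| <= C * t.
  move=> vv'.
  have t0 : 0 <= t := le_trans (normr_ge0 _) (vv' (Ordinal K_gt0)).
  have -> : H v - H v' = (h v - h v') * cutoff r.+1 v + h v' * (cutoff r.+1 v - cutoff r.+1 v').
    by rewrite /H; ring.
  rewrite (le_trans (ler_normD _ _))// !normrM /C mulrDl; apply: lerD.
    have /andP[c0 c1] := cutoff_itv r.+1 v.
    rewrite [`|cutoff _ _|]ger0_norm// (@le_trans _ _ `|h v - h v'|) ?ler_piMr//.
    have -> : h v - h v' = - (Psi (allocation_of v) - Psi (allocation_of v')).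
      by rewrite /h; ring.
    rewrite normrN (_ : N * _ * t = N * ((K.+1%:R * t * S) / e)); last by ring.
    apply: smooth_payoff_dist => // i.
    have hi := allocation_of_dist t0 vv' i.
    apply: ler_pM => //; first by rewrite invr_ge0 ltW.
    by rewrite /S (bigD1 i)//= lerDl sumr_ge0// => j _; rewrite invr_ge0 ltW.
  rewrite -mulrA; apply: ler_pM => //; last exact: cutoff_dist.
  by rewrite ger0_norm.
have H_supp v i : r.+1%:R <= `|v i| -> H v = 0.
  by move=> rv; rewrite /H (cutoff_supp rv) mulr0.
have H_bd v : `|H v| <= N.
  by have /andP[H0 H1] := H_le v; rewrite ger0_norm// (le_trans H1).
have lim := mean_vague_limit LP H_bd H_lip H_supp (bH.1).
have L_ge : 2^-1 * N - K.+1%:R - eta <= L (fun l => H (xi ^~ l)).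
  have PN l : `|Psi (pts l)| <= N + N.
    by rewrite ler_norml; have := Psi_le (pts l) => /andP[? ?]; apply/andP; split; lra.
  have HN l : `|H (xi ^~ l)| <= N + N by rewrite (le_trans (H_bd _))// lerDl.
  have hE l : h (xi ^~ l) + Psi (pts l) = 2^-1 * N by rewrite /h xiE subrK.
  have hd l : `|H (xi ^~ l) + Psi (pts l) - 2^-1 * N| <= eta.
    rewrite -(hE l) ler_norml.
    have := H_le (xi ^~ l); have := H_ge (xi ^~ l) => a /andP[b c].
    by apply/andP; split; lra.
  have sN l : `|H (xi ^~ l) + Psi (pts l)| <= (N + N) + (N + N).
    by rewrite (le_trans (ler_normD _ _))// lerD.
  have cN (l : nat) : `|2^-1 * N| <= (N + N) + (N + N).
    by rewrite ger0_norm ?mulr_ge0//; lra.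
  have := is_mean_dist LP sN cN hd.
  rewrite (is_meanD LP HN PN) (is_mean_cst LP) ler_norml => /andP[lower _].
  by clear cN; lra.
have int_ge : \int[nu]_u (rho u * H (cut_value L xi ^~ u)) <=
    m * (2^-1 * N) - \int[nu]_u (rho u * Psi (V u)).
  rewrite /m [m * _]mulrC -meanZl// -meanB//; last exact: bounded_measurableZl.
  apply: mean_le.
  - exact: bounded_measurableM.
  - by apply: bounded_measurableB => //; exact: bounded_measurableZl.
  - move=> u; rewrite [_ * rho u]mulrC -mulrBr ler_wpM2l//.
    by have /andP[] := H_le (cut_value L xi ^~ u).
have aux (a b c s n : R) : b - c - s <= a -> a <= m * b - n ->
  n + (1 - m) * b <= c + s by lra.
by apply: aux L_ge _; rewrite -lim.
Qed.

End EscapingMass.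

(** Every open set is the union of the countably many rational boxes that it contains. *)
Lemma measurable_borel_rV (R : realType) (k : nat) d (U : measurableType d)
    (V : U -> 'rV[R]_k) :
  (forall i, measurable_fun setT (fun u => V u ord0 i)) ->
  measurable_fun setT (V : U -> borel_rV R k).
Proof.
move=> mV; apply: (@measurability _ _ U (borel_rV R k) setT V (@open 'rV[R]_k)) => //.
move=> _ [B oB <-]; rewrite setTI.
pose box (a : {ffun 'I_k -> rat} * nat) : set 'rV[R]_k :=
  [set x | forall i, `|x ord0 i - ratr (a.1 i)| < a.2.+1%:R^-1].
rewrite (_ : V @^-1` B = [set u | exists a, (box a `<=` B) /\ box a (V u)]).
  apply: measurable_exists_countable => a.
  have [aB|aB] := pselect (box a `<=` B); last first.
    by rewrite [X in measurable X](_ : _ = set0)//; apply/seteqP; split => u // [].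
  rewrite [X in measurable X](_ : _ =
      [set u | forall i, `|V u ord0 i - ratr (a.1 i)| < a.2.+1%:R^-1]); last first.
    by apply/seteqP; split => u //= [].
  apply: measurable_forall_countable => i.
  have mf : measurable_fun setT (fun u => `|V u ord0 i - ratr (a.1 i)|).
    by apply: (measurableT_comp (@normr_measurable R setT)); exact: measurable_funB.
  rewrite [X in measurable X](_ : _ =
      (fun u => `|V u ord0 i - ratr (a.1 i)|) @^-1` `]-oo, a.2.+1%:R^-1[%classic).
    by rewrite -[X in measurable X]setTI; exact: mf.
  by apply/seteqP; split => u /=; rewrite in_itv.
apply/seteqP; split=> [u Bu|u [a [aB Va]]]; last exact: aB.
have [e e0 eB] : exists2 e : R, 0 < e & ball (V u) e `<=` B.
  have := open_nbhs_nbhs (conj oB Bu : open_nbhs (V u) B).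
  by rewrite -nbhs_ballE => -[e e0 eB]; exists e.
pose n := Num.bound (2 / e).
have ne : n.+1%:R^-1 <= e / 2 :> R.
  rewrite -[leRHS]invf_div lef_pV2 ?posrE ?divr_gt0//.
  rewrite (le_trans (ltW (archi_boundP _))) ?divr_ge0 ?(ltW e0)//.
  by rewrite ler_nat.
have n0 : 0 < n.+1%:R^-1 :> R by [].
have /choice[q qP] : forall i, exists q : rat, `|V u ord0 i - ratr q| < n.+1%:R^-1.
  move=> i; have [|q] := @rat_in_itvoo R (V u ord0 i - n.+1%:R^-1) (V u ord0 i + n.+1%:R^-1).
    by apply: (@lt_trans _ _ (V u ord0 i)); [rewrite gtrBl|rewrite ltrDl].
  by rewrite in_itv/= => hq; exists q; rewrite distrC ltr_distl.
exists (finfun q, n) => /=; split; last by move=> i; rewrite ffunE.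
move=> x xb; apply: eB; split => // i j; rewrite (ord1 i).
have := xb j; rewrite /= ffunE => xq; have := qP j => hq.
rewrite /ball/= (_ : _ - _ = (V u ord0 j - ratr (q j)) - (x ord0 j - ratr (q j))); last by ring.
rewrite (le_lt_trans (ler_normB _ _))// [ltRHS]splitr.
by apply: ltr_leD; rewrite ?(lt_le_trans hq) // ltW ?(lt_le_trans xq).
Qed.

Section Existence.
Context (R : realType) (K : nat) (p : 'I_K.+1 -> R).
Hypotheses (p_gt0 : forall i, 0 < p i) (sum_p : \sum_i p i = 1).
Hypothesis K_gt0 : (0 < K)%N.
Context d (Om : measurableType d) (P : probability Om R).
Variable Z : 'I_K.+1 -> {RV P >-> R}.
Hypothesis iid_Z : iid_standard_normal Z.
Let pts := @nth_allocation R K.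

(** For [n >= l] the strategy of the game on the first points concedes at most [1 / (n + 1)] to
    [pts l]; in the ultralimit this becomes 0 for every [l]. *)
Lemma optimal_mean_exists : exists2 L : (nat -> R) -> R, is_mean L &
  forall l, L (fun l' => cont_payoff p Z (pts l) (pts l')) <= 0.
Proof.
pose A n (i j : 'I_n.+1) := cont_payoff p Z (pts i) (pts j).
have A_anti n i j : A n i j = - A n j i by exact: cont_payoffN.
have A_le1 n i j : `|A n i j| <= 1.
  by rewrite (le_trans (cont_payoff_norm _ _ _ _))// invf_le1// ler1n.
have /choice[w wP] : forall n, exists w : nat -> R, [/\ forall i, 0 <= w i,
    \sum_(i < n.+1) w i = 1 & forall i : 'I_n.+1,
    \sum_(j < n.+1) cont_payoff p Z (pts i) (pts j) * w j <= n.+1%:R^-1].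
  move=> n; have e0 : 0 < n.+1%:R^-1 :> R by [].
  have [w [w0 w1 wA]] := finite_symmetric_game (@A_anti n) (@A_le1 n) e0.
  (* [inord] extends weights on ['I_n.+1] to all of [nat], as [ultra_mean] expects. *)
  exists (fun i => w (inord i)); split=> [i //||i].
    by rewrite -[RHS]w1; apply: eq_bigr => i _; rewrite inord_val.
  by apply: le_trans (wA i); apply: ler_sum => j _; rewrite inord_val.
have w_ge0 n i : 0 <= w n i by have [] := wP n.
have w_sum n : \sum_(i < n.+1) w n i = 1 by have [] := wP n.
exists (ultra_mean w) => [|l]; first exact: is_mean_ultra_mean.
apply: (@ultra_mean_le _ _ w_ge0 w_sum _ 2^-1) => [l'|]; first exact: cont_payoff_norm.
near=> n; rewrite add0r; have [_ _ wA] := wP n.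
have ln : (l < n.+1)%N by rewrite ltnS; near: n; exact: nbhs_infty_ge.
apply: le_trans (wA (Ordinal ln)); apply: ler_sum => j _.
by rewrite mulrC.
Unshelve. all: by end_near. Qed.

Lemma cont_optimal_exists : exists alpha, cont_optimal p Z alpha.
Proof.
have [L LP L_payoff] := optimal_mean_exists.
pose xi (j : 'I_K) (l : nat) := pts l ord0 (lift ord0 j).
pose V u := allocation_of (cut_value L xi ^~ u).
have mV i : measurable_fun setT (fun u => V u ord0 i).
  by apply: measurable_allocation_of => j; exact: measurable_cut_value.
pose rho : R -> R := \1_(proper_cut L xi).
have brho : bounded_measurable rho.
  by apply: bounded_measurable_indic; exact: measurable_proper_cut.
pose nu : probability R R := unit_law R.
pose m := \int[nu]_u rho u.
have bK y : bounded_measurable (fun u => cont_payoff p Z y (V u)).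
  exact: (@bounded_measurable_cont_payoff _ _ p _ _ _ _ _ _ (fun=> y)).
have brK y : bounded_measurable (fun u => rho u * cont_payoff p Z y (V u)).
  exact: bounded_measurableM.
(* The term [(1 - m) / 2] is the payoff of [y] against the escaped mass, which always loses. *)
have crit (y : 'rV[R]_K.+1) : \sum_i y ord0 i = 0 ->
    \int[nu]_u (rho u * cont_payoff p Z y (V u)) + (1 - m) / 2 <= 0.
  move: y; apply: (@cont_payoff_criterion _ _ _ p_gt0 _ _ _ _ iid_Z K_gt0 _ _
    nu V rho mV brho (range pts) (@nth_allocation_dense R K) _ (2 * K.+1%:R)).
  move=> J y Dy y_inj.
  have [e e0 approx] := sum_sgr_clip p_gt0 y_inj.
  have near := smooth_payoff_approx Z e0 approx.
  have bPsi : bounded_measurable (fun u => rho u * smooth_payoff p y e Z (V u)).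
    by apply: bounded_measurableM => //; exact: bounded_measurable_smooth_payoff.
  have cut_le := mean_smooth_payoff_cut p_gt0 sum_p K_gt0 LP L_payoff e0 Dy near.
  apply: (@le_trans _ _ (\int[nu]_u (rho u * smooth_payoff p y e Z (V u) + K.+1%:R) +
     #|J|%:R * ((1 - m) / 2))).
    rewrite lerD2r -mean_sum//; apply: mean_le.
    - exact: bounded_measurable_sum.
    - by apply: bounded_measurableD => //; exact: bounded_measurable_cst.
    - move=> u; rewrite -mulr_sumr; have := near (V u); rewrite ler_norml => /andP[_ h].
      have r0 : 0 <= rho u by rewrite /rho indicE.
      have r1 : rho u <= 1 by rewrite /rho indicE; case: (_ \in _).
      rewrite -lerBlDl -mulrBr (le_trans (ler_wpM2l r0 h))// ler_piMl//.
  rewrite meanD//; last exact: bounded_measurable_cst.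
  rewrite mean_cst; have aux (a b c s : R) : a + (1 - m) * (2^-1 * s) <= c ->
    a + c + s * ((1 - m) / 2) <= 2 * c by lra.
  exact: aux cut_le.
have mVb := measurable_borel_rV mV.
pose V' : {RV nu >-> borel_rV R K.+1} := mfun_of mVb.
exists (distribution nu V'); apply: cont_optimal_intro.
  rewrite /cont_mixed/= /distribution/= /pushforward (_ : _ @^-1` _ = setT) ?probability_setT//.
  by apply/seteqP; split => // u _ /=; exact: sum_allocation_of.
move=> y sum_y; rewrite mean_pushforward; last first.
  apply: (@bounded_measurable_cont_payoff _ _ p _ _ _ _ _ (borel_rV R K.+1) (fun=> y)) => // i.
  exact: measurable_coord.
apply: le_trans (crit y sum_y).
(* Where the cut is improper, [V] is the zero allocation; it concedes at most 1/2, no more than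
   [crit] charges for escaped mass. *)
apply: (@le_trans _ _ (\int[nu]_u (rho u * cont_payoff p Z y (V u) + 2^-1 * (1 - rho u)))).
  apply: mean_le => //.
    apply: bounded_measurableD => //; apply: bounded_measurableZl.
    by apply: bounded_measurableB => //; exact: bounded_measurable_cst.
  move=> u; have := cont_payoff_norm p Z y (V u); rewrite ler_norml => /andP[_ h].
  by rewrite /rho indicE; case: (_ \in _) => /=; lra.
have b1 : bounded_measurable (fun u => 1 - rho u).
  by apply: bounded_measurableB => //; exact: bounded_measurable_cst.
rewrite meanD//; last exact: bounded_measurableZl.
rewrite meanZl// meanB//; last exact: bounded_measurable_cst.
by rewrite mean_cst mulrC.
Qed.

End Existence.

(** * The Poisson central limit theorem *)

Section Poisson.
Context (R : realType) d (Om : measurableType d) (P : probability Om R).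
Variables (X : Om -> nat) (lambda : R).
Hypotheses (mX : measurable_fun setT X) (lambda_gt0 : 0 < lambda).
Hypothesis X_law : forall j, P [set w | X w = j] = (poisson_pmf lambda j)%:E.

Lemma measurable_nat_comp (f : nat -> R) : measurable_fun setT (f \o X).
Proof. exact: (measurableT_comp (f := f)). Qed.

Lemma poisson_pmfS j : j.+1%:R * poisson_pmf lambda j.+1 = lambda * poisson_pmf lambda j.
Proof.
rewrite /poisson_pmf lambda_gt0 exprS factS natrM invfM.
have j0 : j.+1%:R != 0 :> R by [].
have j1 : j`!%:R != 0 :> R by rewrite pnatr_eq0 -lt0n fact_gt0.
have aux (a b l t e : R) : a != 0 -> b != 0 ->
  a * (l * t * (a^-1 / b) * e) = l * (t / b * e).
  by move=> ? ?; field; apply/andP.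
exact: aux.
Qed.

Lemma mean_finite_support (f : nat -> R) N : (forall j, (N < j)%N -> f j = 0) ->
  \int[P]_w f (X w) = \sum_(j < N.+1) f j * poisson_pmf lambda j.
Proof.
move=> f0.
have mXj j : measurable [set w | X w = j].
  rewrite (_ : [set w | _] = X @^-1` [set j]); last by apply/seteqP; split.
  by rewrite -[X in measurable X]setTI; exact: mX.
transitivity (\int[P]_w \sum_(j < N.+1) f j * \1_[set w | X w = j] w).
  apply: eq_Rintegral => w _; have [XN|NX] := leqP (X w) N.
    rewrite (bigD1 (inord (X w)))//= inordK// indicE mem_set//= mulr1.
    rewrite big1 ?addr0// => j /eqP jX; rewrite indicE memNset ?mulr0//= => e.
    by apply: jX; apply/val_inj; rewrite /= inordK// e.
  rewrite f0// big1// => j _; rewrite indicE memNset ?mulr0//= => e.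
  by have := ltn_ord j; rewrite -e ltnS leqNgt NX.
rewrite mean_sum; last by move=> j; exact/bounded_measurableZl/bounded_measurable_indic.
apply: eq_bigr => j _; rewrite meanZl; last exact: bounded_measurable_indic.
by rewrite mean_indic// X_law.
Qed.

(** The Stein-Chen identity, obtained by shifting the index with [poisson_pmfS]. Finite support
    keeps all sums finite. *)
Lemma poisson_Stein (g : nat -> R) N : (forall j, (N < j)%N -> g j = 0) ->
  \int[P]_w ((X w)%:R * g (X w)) = lambda * \int[P]_w g (X w).+1.
Proof.
move=> g0; rewrite (@mean_finite_support (fun j => j%:R * g j) N); last first.
  by move=> j /g0 ->; rewrite mulr0.
rewrite (@mean_finite_support (fun j => g j.+1) N); last by move=> j jN; exact/g0/ltnW.
rewrite big_ord_recl/= mul0r mul0r add0r big_ord_recr/= g0// mul0r addr0 mulr_sumr.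
by apply: eq_bigr => j _; rewrite mulrAC poisson_pmfS mulrA mulrAC -mulrA [g _ * _]mulrC mulrA.
Qed.

Lemma bounded_measurable_finite_support (f : nat -> R) N :
  (forall j, (N < j)%N -> f j = 0) -> bounded_measurable (fun w => f (X w)).
Proof.
move=> f0; split; first exact: measurable_nat_comp.
exists (\sum_(j < N.+1) `|f j|) => w; have [XN|NX] := leqP (X w) N; last first.
  by rewrite f0// normr0 sumr_ge0.
by rewrite (bigD1 (inord (X w)))//= inordK// lerDl sumr_ge0.
Qed.

Let bX := bounded_measurable_finite_support.

(** [poisson_Stein] for the truncated [j - lambda] turns the left side into [lambda] times a mean
    increment of [g]. Increments are at most 1, also at the truncation since [lambda <= N]. *)
Lemma poisson_truncated_variance N : lambda <= N%:R ->
  \int[P]_w ((X w <= N)%N%:R * ((X w)%:R - lambda) ^+ 2) <= lambda.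
Proof.
move=> lN; pose g j : R := (j <= N)%N%:R * (j%:R - lambda).
have g0 j : (N < j)%N -> g j = 0 by rewrite ltnNge /g => /negbTE ->; rewrite mul0r.
have g0' j : (N < j)%N -> g j.+1 = 0 by move=> h; apply: g0; exact: leqW.
rewrite (_ : (fun w => _) = (fun w => (X w)%:R * g (X w) - lambda * g (X w))); last first.
  by apply/funext => w; rewrite /g; ring.
rewrite meanB; first last.
- by apply: bounded_measurableZl; exact: (bX g0).
- by apply: (@bX (fun j => j%:R * g j) N) => j /g0 ->; rewrite mulr0.
rewrite meanZl; last exact: (bX g0).
rewrite (poisson_Stein g0) -mulrBr -meanB; [|exact: (bX g0')|exact: (bX g0)].
rewrite ler_piMr ?(ltW lambda_gt0)// -[leRHS](mean_cst P); apply: mean_le.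
- by apply: bounded_measurableB; [exact: (bX g0')|exact: (bX g0)].
- exact: bounded_measurable_cst.
move=> w; rewrite /g; have [XN|XN|XN] := ltngtP (X w) N.
- by rewrite -natr1 !mul1r; lra.
- by rewrite !mul0r subrr.
- by rewrite mul0r mul1r XN; lra.
Qed.

Lemma poisson_Chebyshev (a : R) : 0 < a ->
  \int[P]_w (a <= `|(X w)%:R - lambda|)%R%:R <= lambda / a ^+ 2.
Proof.
move=> a0; pose f j : R := (a <= `|j%:R - lambda|)%R%:R.
have h : \int[P]_w ((X w <= N)%N%:R * f (X w)) @[N --> \oo] --> \int[P]_w f (X w).
  apply: (mean_dominated_cvg (M := 1)).
  - by move=> N; exact: (measurable_nat_comp (fun j => (j <= N)%N%:R * f j)).
  - exact: (measurable_nat_comp f).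
  - by move=> N w; rewrite /f; case: (a <= _); case: (X w <= N)%N; rewrite ?(mulr0,mulr1,mul0r,normr0,normr1).
  - apply: aeW => w; apply: cvg_near_cst; near=> N.
    suff -> : (X w <= N)%N by rewrite mul1r.
    by near: N; exact: nbhs_infty_ge.
rewrite -[leLHS](cvg_lim _ h)//; apply: limr_le; first by apply/cvg_ex; exists (\int[P]_w f (X w)).
near=> N.
have lN : lambda <= N%:R by near: N; exact: nbhs_infty_ger.
have a2 : 0 < a ^+ 2 by rewrite exprn_gt0.
rewrite ler_pdivlMr// mulrC -meanZl; last first.
  apply: (@bX (fun j => (j <= N)%N%:R * f j) N) => j; rewrite ltnNge => /negbTE ->.
  by rewrite mul0r.
apply: le_trans (poisson_truncated_variance lN); apply: mean_le.
- apply: (@bX (fun j => a ^+ 2 * ((j <= N)%N%:R * f j)) N) => j; rewrite ltnNge => /negbTE ->.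
  by rewrite mul0r mulr0.
- apply: (@bX (fun j => (j <= N)%N%:R * (j%:R - lambda) ^+ 2) N) => j; rewrite ltnNge => /negbTE ->.
  by rewrite mul0r.
move=> w; rewrite mulrCA ler_wpM2l// /f.
have [aX|aX] := leP a `|(X w)%:R - lambda|; last by rewrite mulr0 sqr_ge0.
by rewrite mulr1 -(real_normK (num_real (_ - _))) ler_sqr ?nnegrE ?(ltW a0).
Unshelve. all: by end_near. Qed.

End Poisson.

(** The range is sliced into levels of width [e]. This carries identities from indicators to bounded
    measurable functions in [mean_normal], [mean_factor] and [mean_standard_normal]. *)
Lemma step_approximation d (T : measurableType d) (R : realType) (h : T -> R) (e : R) :
  bounded_measurable h -> 0 < e ->
  exists m (c : 'I_m -> R) (B : 'I_m -> set T), (forall l, measurable (B l)) /\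
    forall x, `|h x - \sum_l c l * \1_(B l) x| <= e.
Proof.
move=> [mh [M hM]] e0; pose m := Num.bound (2 * M / e).
pose c (l : 'I_m) : R := - M + l%:R * e.
pose B l := h @^-1` `[c l, c l + e[%classic.
exists m, c, B; split=> [l|x]; first by rewrite -[X in measurable X]setTI; exact: mh.
have /[!ler_norml]/andP[Mh hM'] := hM x.
have M0 : 0 <= M := le_trans (normr_ge0 _) (hM x).
have q0 : 0 <= (h x + M) / e by rewrite divr_ge0 ?(ltW e0)//; lra.
pose k := Num.truncn ((h x + M) / e).
have /andP[k1 k2] := truncn_itv q0; rewrite -/k in k1 k2.
have km : (k < m)%N.
  rewrite -(@ltr_nat R) (le_lt_trans k1)//.
  have h2 : 0 <= 2 * M / e by rewrite divr_ge0 ?mulr_ge0 ?(ltW e0).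
  rewrite (le_lt_trans _ (archi_boundP h2))// ler_pM2r ?invr_gt0//; lra.
move: k1 k2; rewrite ler_pdivlMr// ltr_pdivrMr// => k1 k2.
have kB : B (Ordinal km) x.
  rewrite /B/= in_itv/= /c/=; move: k2; rewrite -natr1 mulrDl mul1r => k2.
  by apply/andP; split; lra.
rewrite (bigD1 (Ordinal km))//= indicE mem_set// mulr1 big1 ?addr0; last first.
  move=> l lk; rewrite indicE memNset ?mulr0// /B/= in_itv/= => /andP[l1 l2].
  have lk1 : l%:R * e < k.+1%:R * e by rewrite /c in l1; lra.
  have lk2 : k%:R * e < l.+1%:R * e.
    by rewrite -natr1 mulrDl mul1r; rewrite /c in l2; lra.
  move: lk1 lk2; rewrite !ltr_pM2r// !ltr_nat !ltnS => lk1 lk2.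
  by move/eqP: lk; apply; apply/val_inj/eqP; rewrite eqn_leq/= lk1 lk2.
move: k2; rewrite -natr1 mulrDl mul1r => k2.
move: k1 k2; rewrite /c/= => k1 k2; apply/andP; split; lra.
Qed.

Section NormalMean.
Context (R : realType).
Let mu := @lebesgue_measure R.
Let q := @normal_pdf R 0 1.

Lemma integrable_normal_pdfM (h : R -> R) : bounded_measurable h ->
  mu.-integrable setT (EFin \o (fun t => h t * q t)).
Proof.
move=> [mh [M hM]].
have iq : mu.-integrable setT (EFin \o (fun t => M * q t)).
  have := @integrableZl _ _ _ mu setT measurableT M (EFin \o q) (integrable_normal_pdf 0 1).
  by apply: eq_integrable.
apply: (le_integrable _ _ _ iq) => //.
  by apply/measurable_EFinP/measurable_funM => //; exact: measurable_normal_pdf.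
move=> t _ /=; rewrite lee_fin !normrM ler_wpM2r//.
by rewrite (le_trans (hM t))// ler_norm.
Qed.

Let density_meanD (f g : R -> R) : bounded_measurable f -> bounded_measurable g ->
  \int[mu]_t ((f t + g t) * q t) = \int[mu]_t (f t * q t) + \int[mu]_t (g t * q t).
Proof.
move=> bf bg; rewrite -RintegralD//; [|exact: integrable_normal_pdfM..].
by apply: eq_Rintegral => t _; rewrite mulrDl.
Qed.

Let density_meanZl c (f : R -> R) : bounded_measurable f ->
  \int[mu]_t (c * f t * q t) = c * \int[mu]_t (f t * q t).
Proof.
move=> bf; rewrite -RintegralZl//; last exact: integrable_normal_pdfM.
by apply: eq_Rintegral => t _; rewrite mulrA.
Qed.

Lemma normal_density_norm_le (f : R -> R) M : bounded_measurable f ->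
  (forall t, `|f t| <= M) -> `|\int[mu]_t (f t * q t)| <= M.
Proof.
move=> bf fM; have iq := @integrable_normal_pdf R 0 1.
rewrite (le_trans (le_normr_Rintegral _ _))//; first exact: integrable_normal_pdfM.
apply: (@le_trans _ _ (\int[mu]_t (M * q t))).
  apply: le_Rintegral => //.
  - apply: eq_integrable (integrable_normal_pdfM (bounded_measurable_norm bf)) => //.
    by move=> t _ /=; rewrite normrM [`|q t|]ger0_norm// normal_pdf_ge0.
  - apply: (@integrable_normal_pdfM (fun=> M)); exact: bounded_measurable_cst.
  - move=> t _; rewrite normrM [`|q t|]ger0_norm ?normal_pdf_ge0//.
    by rewrite ler_wpM2r ?normal_pdf_ge0.
by rewrite RintegralZl// {1}/Rintegral integral_normal_pdf/= mulr1.
Qed.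

Lemma mean_normal (h : R -> R) : bounded_measurable h ->
  \int[normal_prob 0 1]_t h t = \int[mu]_t (h t * q t).
Proof.
move=> bh; apply/eqP; rewrite -subr_eq0 -normr_le0; apply/ler_addgt0Pr => e e0.
rewrite add0r.
have [m [c [B [mB hB]]]] := step_approximation bh (divr_gt0 e0 (ltr0Sn R 1)).
pose s t := \sum_l c l * \1_(B l) t.
have bB l : bounded_measurable (\1_(B l) : R -> R) by exact: bounded_measurable_indic.
have bs : bounded_measurable s.
  by apply: bounded_measurable_sum => l; exact: bounded_measurableZl.
have sE : \int[normal_prob 0 1]_t s t = \int[mu]_t (s t * q t).
  rewrite /s; elim: (index_enum _) => [|l r IH].
    under [in LHS]eq_Rintegral do rewrite big_nil.
    under [in RHS]eq_Rintegral do rewrite big_nil mul0r.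
    by rewrite mean_cst Rintegral_cst//= mul0r.
  under [in LHS]eq_Rintegral do rewrite big_cons.
  under [in RHS]eq_Rintegral do rewrite big_cons.
  have br : bounded_measurable (fun t => \sum_(j <- r) c j * \1_(B j) t).
    by apply: bounded_measurable_sum => j; exact: bounded_measurableZl.
  rewrite meanD//; last first.
    exact: (bounded_measurableZl (c l) (bB l)).
  rewrite density_meanD//; last exact: bounded_measurableZl.
  congr (_ + _); last exact: IH.
  rewrite meanZl; last exact: (bB l).
  transitivity (c l * \int[mu]_t (\1_(B l) t * q t)); last first.
    by symmetry; exact: density_meanZl.
  congr (_ * _).
  rewrite mean_indic; last exact: mB.
  transitivity (\int[mu]_(t in B l) q t) => //.
  rewrite Rintegral_mkcond; apply: eq_Rintegral => t _.
  by rewrite patchE indicE; case: ifP => _; rewrite ?mul1r ?mul0r.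
have bd : bounded_measurable (fun t => h t - s t) by exact: bounded_measurableB.
have h1 : `|\int[normal_prob 0 1]_t h t - \int[normal_prob 0 1]_t s t| <= e / 2.
  by apply: mean_dist_le.
have h2 : `|\int[mu]_t (h t * q t) - \int[mu]_t (s t * q t)| <= e / 2.
  rewrite [X in X - _](_ : _ = \int[mu]_t ((s t + (h t - s t)) * q t)); last first.
    by apply: eq_Rintegral => t _; rewrite addrC subrK.
  by rewrite density_meanD// addrAC subrr add0r; exact: normal_density_norm_le.
rewrite (_ : _ - _ = (\int[normal_prob 0 1]_t h t - \int[normal_prob 0 1]_t s t) -
   (\int[mu]_t (h t * q t) - \int[mu]_t (s t * q t))); last by rewrite sE; ring.
by rewrite (le_trans (ler_normB _ _))// [leRHS]splitr lerD.
Qed.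

End NormalMean.

(** * Stein's equation for the normal law *)

Section Stein.
Context (R : realType) (h : R -> R) (r A L : R).
Hypotheses (r_gt0 : 0 < r) (h_bound : forall t, `|h t| <= A).
Hypothesis h_supp : forall t, r <= `|t| -> h t = 0.
Hypothesis h_lip : forall s t, `|h s - h t| <= L * `|s - t|.
Hypothesis h_mean : \int[normal_prob 0 1]_t h t = 0.
Let mu := @lebesgue_measure R.
Let q := @normal_pdf R 0 1.

Lemma Lipschitz_continuous (g : R -> R) (C : R) :
  (forall s t, `|g s - g t| <= C * `|s - t|) -> continuous g.
Proof.
move=> gC t; apply/cvgrPdist_le => e e0.
have C0 : 0 < `|C| + 1 by rewrite ltr_pwDr.
near=> s; rewrite (le_trans (gC _ _))// (@le_trans _ _ ((`|C| + 1) * `|t - s|))//.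
  by rewrite ler_wpM2r// (le_trans (ler_norm C))// lerDl.
rewrite mulrC -ler_pdivlMr// ltW//; near: s.
by apply: cvgr_dist_lt => //; rewrite divr_gt0.
Unshelve. all: by end_near. Qed.

Let ch : continuous h.
Proof. exact: Lipschitz_continuous h_lip. Qed.

Let bh : bounded_measurable h.
Proof. by split; [exact: continuous_measurable_fun | exists A]. Qed.

Let A_ge0 : 0 <= A.
Proof. exact: le_trans (normr_ge0 _) (h_bound 0). Qed.

Let L_ge0 : 0 <= L.
Proof. by have := le_trans (normr_ge0 _) (h_lip 1 0); rewrite subr0 normr1 mulr1. Qed.

Let cq : continuous q.
Proof. by apply: continuous_normal_pdf; exact: oner_neq0. Qed.

Let f0 t := h t * q t.
Let F w := \int[mu]_(t in [set` Interval -oo%O (BRight w)]) f0 t.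

Let if0 : mu.-integrable setT (EFin \o f0).
Proof. exact: integrable_normal_pdfM. Qed.

Let dF (w : R) : is_derive w (1 : R) F (f0 w).
Proof.
have cf0 : {for w, continuous f0} by apply: cvgM; [exact: ch|exact: cq].
have [|||dF F'] := @continuous_FTC1 R f0 -oo%O w (w + 1) _ _ _ cf0.
- by rewrite ltrDl.
- exact: (integrableS _ _ _ if0).
- exact: ltNyr.
by apply: DeriveDef; rewrite -?derive1E.
Qed.

Let h_left (t : R) : t <= - r -> h t = 0.
Proof. by move=> tr; rewrite h_supp// ler_normr orbC lerNr tr. Qed.

Let h_right (t : R) : r <= t -> h t = 0.
Proof. by move=> tr; rewrite h_supp// ler_normr tr. Qed.

Let F_left w : w <= - r -> F w = 0.
Proof.
move=> wr; rewrite /F (@eq_Rintegral _ _ _ _ _ (fun=> 0)) ?Rintegral_cst ?mul0r//.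
move=> t; rewrite inE/= in_itv/= => tw.
by rewrite /f0 h_left ?mul0r// (le_trans tw).
Qed.

(** Here [h_mean] enters: to the right of its support, the integral of [h] is its whole normal mean.
    Thus the solution [f] has compact support too. *)
Let F_right w : r <= w -> F w = 0.
Proof.
move=> rw; rewrite -[RHS]h_mean mean_normal// [LHS]Rintegral_mkcond.
apply: eq_Rintegral => t _; rewrite patchE; case: ifPn => //.
rewrite notin_setE/= in_itv/= => /negP; rewrite -ltNge => wt.
by rewrite h_right ?mul0r// ltW// (le_lt_trans rw).
Qed.

Let F_norm w : `|F w| <= A.
Proof.
have bI : bounded_measurable (fun t : R => h t * \1_`]-oo, w] t).
  by apply: bounded_measurableM => //; exact: bounded_measurable_indic.
rewrite /F Rintegral_mkcond.
rewrite (_ : Rintegral _ _ _ = \int[mu]_t ((h t * \1_`]-oo, w] t) * q t)).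
  apply: normal_density_norm_le => // t; rewrite normrM (le_trans _ (h_bound t))//.
  by rewrite ler_piMr// indicE; case: (_ \in _); rewrite ?normr1 ?normr0.
apply: eq_Rintegral => t _; rewrite patchE indicE; case: ifPn => _.
  by rewrite mulr1.
by rewrite mulr0 mul0r.
Qed.

(** The reciprocal of the density [q], used as integrating factor. *)
Let E (w : R) : R := expR (w ^+ 2 / 2) / normal_peak 1.

Let E_ge0 w : 0 <= E w.
Proof. by rewrite divr_ge0 ?expR_ge0 ?normal_peak_ge0. Qed.

Let peak_gt0 : 0 < normal_peak 1 :> R.
Proof. by rewrite normal_peak_gt0// oner_neq0. Qed.

Let Eq w : E w * q w = 1.
Proof.
have pk : normal_peak 1 != 0 :> R by rewrite gt_eqF.
have ex : expR (w ^+ 2 / 2) != 0 by rewrite gt_eqF// expR_gt0.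
rewrite /q normal_pdfE ?oner_neq0// /E /normal_fun subr0 expr1n mulNr expRN.
by field; apply/andP.
Qed.

Let E_mono v w : `|v| <= `|w| -> E v <= E w.
Proof.
move=> vw; have i0 : 0 < (normal_peak 1)^-1 :> R by rewrite invr_gt0.
rewrite /E (ler_pM2r i0) ler_expR ler_pM2r ?invr_gt0//.
by rewrite -(real_normK (num_real v)) -(real_normK (num_real w)) ler_sqr ?nnegrE.
Qed.

Let dE (w : R) : is_derive w (1 : R) E (w * E w).
Proof.
have h1 : is_derive w (1 : R) (fun v : R => v ^+ 2 / 2) w.
  rewrite (_ : (fun v => _) = 2^-1 *: (id * id : R -> R)); last first.
    by apply/funext => v /=; rewrite expr2 mulrC.
  apply: is_derive_eq; rewrite /= -[_ *: _]/(_ * _) -![_ *: 1]/(_ * 1).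
  by field.
have h2 : is_derive w (1 : R) (expR \o (fun v : R => v ^+ 2 / 2)) (w * expR (w ^+ 2 / 2)).
  by apply: is_derive_eq; rewrite mulrC.
rewrite (_ : E = (normal_peak 1)^-1 *: (expR \o (fun v : R => v ^+ 2 / 2))); last first.
  by apply/funext => v /=; rewrite /E mulrC.
apply: is_derive_eq.
rewrite -[_ *: _]/(_ * _) -[(_ *: _) w]/(_ * _)/=; ring.
Qed.

Let f w := E w * F w.

Let df (w : R) : is_derive w (1 : R) f (w * f w + h w).
Proof.
have := is_deriveM (dE w) (dF w).
rewrite (_ : _ + _ = w * f w + h w) //.
rewrite /f /f0 -![_ *: _]/(_ * _).
transitivity ((E w * q w) * h w + w * (E w * F w)); last by rewrite Eq; ring.
by ring.
Qed.

Let f_supp w : r <= `|w| -> f w = 0.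
Proof.
rewrite ler_normr /f => /orP[rw|rw]; first by rewrite F_right ?mulr0.
by rewrite F_left ?mulr0//; lra.
Qed.

Let B0 := E r * A.

Let B00 : 0 <= B0.
Proof. exact: mulr_ge0. Qed.

Let f_norm w : `|f w| <= B0.
Proof.
have [rw|rw] := leP r `|w|; first by rewrite f_supp// normr0 mulr_ge0.
rewrite normrM ger0_norm// ler_pM// E_mono// (ger0_norm (ltW r_gt0)).
exact: ltW.
Qed.

Let B1 := r * B0 + A.

Let B10 : 0 <= B1.
Proof. by rewrite addr_ge0// mulr_ge0// ltW. Qed.

Let wf_norm w : `|w * f w| <= r * B0.
Proof.
have [rw|rw] := leP r `|w|.
  by rewrite f_supp// mulr0 normr0 mulr_ge0// ltW.
by rewrite normrM ler_pM// ltW.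
Qed.

Let f_increment (v w : R) : v <= w -> exists2 c, v <= c <= w &
  f w - f v = (c * f c + h c) * (w - v).
Proof.
move=> vw; have [||c + ->] := @MVT_segment R f (fun w => w * f w + h w) v w vw.
- by move=> x _; exact: df.
- apply: continuous_subspaceT => x.
  by apply: differentiable_continuous; apply/derivable1_diffP; have [] := df x.
by rewrite in_itv/= => cvw; exists c.
Qed.

Let f_lip v w : `|f w - f v| <= B1 * `|w - v|.
Proof.
wlog vw : v w / v <= w => [H|].
  by have [/H//|/ltW/H] := leP v w; rewrite distrC [in X in _ <= X]distrC.
have [c _ ->] := f_increment vw.
rewrite normrM ler_wpM2r// (le_trans (ler_normD _ _))// lerD//.
Qed.

Let wf_lip v w : `|v * f v - w * f w| <= (B0 + r * B1) * `|v - w|.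
Proof.
have aux (x y : R) : `|x| <= r -> `|x * f x - y * f y| <= (B0 + r * B1) * `|x - y|.
  move=> xr; rewrite (_ : _ - _ = (x - y) * f y + x * (f x - f y)); last by ring.
  rewrite (le_trans (ler_normD _ _))// [leRHS]mulrDl lerD// normrM.
    by rewrite mulrC ler_wpM2r.
  by rewrite -mulrA ler_pM// f_lip.
have [vr|vr] := leP `|v| r; first exact: aux.
have [wr|wr] := leP `|w| r; first by rewrite distrC [in X in _ <= X]distrC; exact: aux.
by rewrite !f_supp ?(ltW vr) ?(ltW wr)// !mulr0 subrr normr0 mulr_ge0// addr_ge0// mulr_ge0// ltW.
Qed.

(* [f] solves Stein's equation [f' - w f = h]; the bound is its integrated form,
   as [f'] is Lipschitz. *)
Lemma Stein_equation : exists2 f : R -> R, (forall w, r <= `|w| -> f w = 0) &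
  exists C, forall w dl, 0 <= dl ->
    `|f w - f (w - dl) - dl * (w * f w + h w)| <= C * dl ^+ 2.
Proof.
exists f => //; exists (B0 + r * B1 + L) => w dl dl0.
have wd : w - dl <= w by rewrite gerBl.
have [c /andP[c1 c2] ->] := f_increment wd.
rewrite (_ : _ - _ = dl * ((c * f c - w * f w) + (h c - h w))); last by ring.
rewrite normrM (ger0_norm dl0) expr2 [leRHS]mulrCA ler_wpM2l//.
have cw : `|c - w| <= dl by rewrite ler_norml; apply/andP; split; lra.
rewrite (le_trans (ler_normD _ _))// mulrDl lerD//.
  by rewrite (le_trans (wf_lip _ _))// ler_wpM2l// addr_ge0// mulr_ge0// ltW.
by rewrite (le_trans (h_lip _ _))// ler_wpM2l.
Qed.

End Stein.

Section TestFunction.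
Context (R : realType).

Definition test_function (h : R -> R) : Prop := exists r A L : R,
  [/\ 0 < r, forall t, `|h t| <= A, forall t, r <= `|t| -> h t = 0 &
      forall s t, `|h s - h t| <= L * `|s - t|].

Lemma test_functionB (f g : R -> R) : test_function f -> test_function g ->
  test_function (fun t => f t - g t).
Proof.
move=> [r [A [L [r0 fA fr fL]]]] [r' [A' [L' [r'0 gA gr gL]]]].
exists (Num.max r r'), (A + A'), (L + L'); split.
- by rewrite lt_max r0.
- by move=> t; rewrite (le_trans (ler_normB _ _))// lerD.
- by move=> t; rewrite ge_max => /andP[rt r't]; rewrite fr// gr// subrr.
- move=> s t; rewrite (_ : _ - _ = (f s - f t) - (g s - g t)); last by ring.
  by rewrite (le_trans (ler_normB _ _))// mulrDl lerD.
Qed.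

Lemma test_functionZl (c : R) (f : R -> R) : test_function f ->
  test_function (fun t => c * f t).
Proof.
move=> [r [A [L [r0 fA fr fL]]]]; exists r, (`|c| * A), (`|c| * L); split => //.
- by move=> t; rewrite normrM ler_wpM2l.
- by move=> t rt; rewrite fr// mulr0.
- by move=> s t; rewrite -mulrBr normrM -mulrA ler_wpM2l.
Qed.

Lemma bounded_measurable_test_function h : test_function h -> bounded_measurable h.
Proof.
move=> [r [A [L [_ hA _ hL]]]]; split; last by exists A.
by apply: continuous_measurable_fun; exact: Lipschitz_continuous hL.
Qed.

Definition plateau (r t : R) : R := Num.max 0 (Num.min 1 (r + 1 - `|t|)).

Lemma plateau_itv r t : 0 <= plateau r t <= 1.
Proof. by rewrite /plateau le_max lexx/= ge_max ler01 ge_min lexx. Qed.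

Lemma plateau1 r t : `|t| <= r -> plateau r t = 1.
Proof. by move=> tr; rewrite /plateau min_l ?max_r//; lra. Qed.

Lemma test_function_plateau r : 0 <= r -> test_function (plateau r).
Proof.
move=> r0; exists (r + 1), 1, 1; split.
- lra.
- by move=> t; have /andP[? ?] := plateau_itv r t; rewrite ger0_norm.
- move=> t rt; rewrite /plateau max_l// ge_min; apply/orP; right; lra.
- move=> s t; rewrite mul1r (@le_trans _ _ `| `|s| - `|t| |) ?ler_dist_dist//.
  rewrite /plateau /Num.max /Num.min ler_normr !ler_norml.
  by repeat case: ifPn; rewrite -?leNgt => *; lra.
Qed.

Lemma mean_plateau_tight (P : probability (measurableTypeR R) R) (e : R) : 0 < e ->
  \forall n \near \oo, 1 - e <= \int[P]_t plateau n%:R t.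
Proof.
move=> e0.
have : \int[P]_t plateau n%:R t @[n --> \oo] --> \int[P]_t (1 : R).
  apply: (mean_dominated_cvg (M := 1)).
  - by move=> n; have [] := bounded_measurable_test_function (test_function_plateau (ler0n R n)).
  - exact: measurable_cst.
  - by move=> n t; have /andP[? ?] := plateau_itv n%:R t; rewrite ger0_norm.
  - apply: aeW => t; apply: cvg_near_cst; near=> n.
    by rewrite plateau1//; near: n; exact: nbhs_infty_ger.
rewrite mean_cst => /cvgrPdist_le /(_ e e0); apply: filterS => n.
by rewrite ler_norml => /andP[_]; lra.
Unshelve. all: by end_near. Qed.

End TestFunction.

Section PoissonCLT.
Context (R : realType) d (Om : measurableType d) (P : probability Om R).

(* The sign makes the noise increase the clearance time. *)
Definition standardized (lambda : R) (X : Om -> nat) w : R :=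
  (lambda - (X w)%:R) / Num.sqrt lambda.

Lemma measurable_standardized lambda X : measurable_fun setT X ->
  measurable_fun setT (standardized lambda X).
Proof.
by move=> mX; exact: (measurable_nat_comp mX (fun j => (lambda - j%:R) / Num.sqrt lambda)).
Qed.

(** One more count moves [W] by [- 1 / s], so [poisson_Stein] equates the means of
    [f W - f (W - 1 / s)] and [W * f W / s]. Stein's equation says that the former is
    [(W * f W + h W) / s] up to [C / s^2]; hence the mean of [h W] is at most [C / s]. *)
Lemma standardized_Stein (h : R -> R) : test_function h ->
  \int[normal_prob 0 1]_t h t = 0 ->
  exists C, forall lambda X, measurable_fun setT X -> 0 < lambda ->
    (forall j, P [set w | X w = j] = (poisson_pmf lambda j)%:E) ->
    `|\int[P]_w h (standardized lambda X w)| <= C / Num.sqrt lambda.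
Proof.
move=> th h0; have [r [A [L [r0 hA hr hL]]]] := th.
have [f fr [C fC]] := Stein_equation r0 hA hr hL h0.
exists C => lambda X mX lambda_gt0 X_law; set s := Num.sqrt lambda.
have s0 : 0 < s by rewrite sqrtr_gt0.
have s2 : s ^+ 2 = lambda by rewrite sqr_sqrtr// ltW.
pose W := standardized lambda X; pose g j := f ((lambda - j%:R) / s).
pose N := Num.bound (lambda + r * s).
have rs0 : 0 <= lambda + r * s by rewrite addr_ge0 ?mulr_ge0 ?ltW.
have g0 j : (N < j)%N -> g j = 0.
  move=> Nj; apply: fr; rewrite ler_normr -mulNr; apply/orP; right.
  rewrite ler_pdivlMr// opprB lerBrDl ltW// (lt_trans (archi_boundP rs0))//.
  by rewrite ltr_nat.
have g0' j : (N < j)%N -> g j.+1 = 0 by move=> h'; apply: g0; exact: leqW.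
have g0'' j : (N < j)%N -> j%:R * g j = 0 by move=> /g0 ->; rewrite mulr0.
have bg := bounded_measurable_finite_support mX g0.
have bg' := bounded_measurable_finite_support mX g0'.
have bg'' := bounded_measurable_finite_support mX g0''.
have bh : bounded_measurable (fun w => h (W w)).
  apply: bounded_measurable_comp; first exact: measurable_standardized.
  exact: bounded_measurable_test_function.
have bWf : bounded_measurable (fun w => W w * g (X w)).
  rewrite (_ : (fun w => _) = (fun w => s^-1 * (lambda * g (X w) - (X w)%:R * g (X w)))).
    by apply/bounded_measurableZl/bounded_measurableB => //; exact: bounded_measurableZl.
  by apply/funext => w; rewrite /W /standardized -/s; ring.
have WfE : s^-1 * \int[P]_w (W w * g (X w)) = \int[P]_w g (X w) - \int[P]_w g (X w).+1.
  rewrite (_ : (fun w => _) = (fun w => s^-1 * (lambda * g (X w) - (X w)%:R * g (X w)))).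
    rewrite meanZl; last by apply: bounded_measurableB => //; exact: bounded_measurableZl.
    rewrite meanB//; last exact: bounded_measurableZl.
    rewrite meanZl// (poisson_Stein mX lambda_gt0 X_law g0) -mulrBr !mulrA -s2.
    by rewrite -invfM -expr2 mulVf ?mul1r// expf_neq0// gt_eqF.
  by apply/funext => w; rewrite /W /standardized -/s; ring.
have := @mean_dist_le _ _ _ P (fun w => g (X w) - g (X w).+1)
  (fun w => s^-1 * (W w * g (X w) + h (W w))) (C * s^-1 ^+ 2).
rewrite meanB// meanZl ?meanD//; last exact: bounded_measurableD.
rewrite mulrDr WfE opprD addrA subrr sub0r normrN normrM ger0_norm ?invr_ge0 ?(ltW s0)//.
rewrite expr2 mulrCA ler_pM2l ?invr_gt0//; apply.
- exact: bounded_measurableB.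
- by apply: bounded_measurableZl; exact: bounded_measurableD.
move=> w; have := fC (W w) s^-1; rewrite invr_ge0 (ltW s0) => /(_ isT).
rewrite (_ : W w - s^-1 = (lambda - (X w).+1%:R) / s).
  by rewrite expr2 mulrCA.
by rewrite /W /standardized -/s -natr1; ring.
Qed.

(** [standardized_Stein] requires normal mean 0, and subtracting a constant from [h] would destroy
    compact support. A multiple of a wide plateau is subtracted instead, whose mean is close to 1
    under both laws. *)
Lemma poisson_CLT (h : R -> R) (e : R) : test_function h -> 0 < e ->
  exists2 Lambda, 0 < Lambda &
  forall lambda X, measurable_fun setT X -> Lambda <= lambda ->
    (forall j, P [set w | X w = j] = (poisson_pmf lambda j)%:E) ->
    `|\int[P]_w h (standardized lambda X w) - \int[normal_prob 0 1]_t h t| <= e.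
Proof.
move=> th e0; set m := \int[normal_prob 0 1]_t h t.
(* The error left at the end is [|m| * |a / c - 1|] with [a] and [c] in [[1 - eta, 1]] and
   [c >= 1/2], hence at most [|m| * (4 * eta)]. *)
pose eta := Num.min 2^-1 (e / (8 * (`|m| + 1))).
have m0 : 0 < `|m| + 1 by rewrite ltr_pwDr.
have eta0 : 0 < eta by rewrite lt_min invr_gt0 ltr0n/= divr_gt0// mulr_gt0.
have eta_half : eta <= 2^-1 by rewrite ge_min lexx.
have eta_e : `|m| * (4 * eta) <= e / 2.
  have : eta <= e / (8 * (`|m| + 1)) by rewrite ge_min lexx orbT.
  rewrite ler_pdivlMr ?mulr_gt0// => h1.
  have h2 : eta * `|m| <= eta * (`|m| + 1) by rewrite ler_pM2l// lerDl.
  by lra.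
(* The width [n] serves both laws: the normal law by tightness, the Poisson law because Chebyshev at
   [n] standard deviations gives [1 / n^2 <= eta]. *)
have [n [n_tight n_large]] : exists n : nat,
    1 - eta <= \int[normal_prob 0 1]_t plateau n%:R t /\ eta^-1 < n%:R.
  have h1 : \forall n \near \oo, 1 - eta <= \int[normal_prob 0 1]_t plateau n%:R t.
    exact: mean_plateau_tight.
  have h2 : \forall n \near \oo, eta^-1 < n%:R :> R by exact: nbhs_infty_gtr.
  by have [n _ /(_ n (leqnn n))] := filterI h1 h2; exists n.
have tp : test_function (plateau n%:R : R -> R) by exact: test_function_plateau.
set c := \int[normal_prob 0 1]_t plateau n%:R t in n_tight.
have c_half : 2^-1 <= c by lra.
have c_le1 : c <= 1.
  rewrite (le_trans (ler_norm _))// mean_norm_le//.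
    exact: bounded_measurable_test_function.
  by move=> t; have /andP[? ?] := plateau_itv n%:R t; rewrite ger0_norm.
pose h0 t := h t - m / c * plateau n%:R t.
have th0 : test_function h0 by apply: test_functionB => //; exact: test_functionZl.
have h00 : \int[normal_prob 0 1]_t h0 t = 0.
  have bpl := bounded_measurable_test_function tp.
  have bhh := bounded_measurable_test_function th.
  transitivity (m - m / c * c); last by rewrite divfK ?subrr// gt_eqF//; lra.
  rewrite /h0 meanB; [|exact: bhh|exact: (bounded_measurableZl (m / c) bpl)].
  by congr (_ - _); apply: meanZl; exact: bpl.
have [C CP] := standardized_Stein th0 h00.
pose Lambda := 1 + (2 * `|C| / e) ^+ 2.
exists Lambda => [|lambda X mX Ll X_law]; first by rewrite ltr_pwDl// sqr_ge0.
have l0 : 0 < lambda by rewrite (lt_le_trans _ Ll)// ltr_pwDl// sqr_ge0.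
have s0 : 0 < Num.sqrt lambda by rewrite sqrtr_gt0.
have {}CP : `|\int[P]_w h0 (standardized lambda X w)| <= e / 2.
  apply: (le_trans (CP _ _ mX l0 X_law)); rewrite ler_pdivrMr//.
  have h1 : 2 * `|C| / e <= Num.sqrt lambda.
    rewrite -[leLHS]ger0_norm ?divr_ge0 ?mulr_ge0 ?(ltW e0)// -sqrtr_sqr ler_wsqrtr//.
    by apply: le_trans Ll; rewrite /Lambda lerDr.
  move: h1; rewrite ler_pdivrMr// => h1; have := ler_norm C; lra.
pose a := \int[P]_w plateau n%:R (standardized lambda X w).
have mW := measurable_standardized lambda mX.
have bp : bounded_measurable (fun w => plateau n%:R (standardized lambda X w)).
  by apply: (bounded_measurable_comp mW); exact: bounded_measurable_test_function.
have bh : bounded_measurable (fun w => h (standardized lambda X w)).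
  by apply: (bounded_measurable_comp mW); exact: bounded_measurable_test_function.
have a_le1 : a <= 1.
  rewrite -[leRHS](mean_cst P); apply: mean_le => //; first exact: bounded_measurable_cst.
  by move=> w; have /andP[] := plateau_itv n%:R (standardized lambda X w).
have a_ge : 1 - eta <= a.
  have n0 : 0 < n%:R :> R by rewrite (lt_trans _ n_large)// invr_gt0.
  have ns0 : 0 < n%:R * Num.sqrt lambda by rewrite mulr_gt0.
  have tail := poisson_Chebyshev mX l0 X_law ns0.
  have bt : bounded_measurable
      (fun w => (n%:R * Num.sqrt lambda <= `|(X w)%:R - lambda|)%R%:R : R).
    split; last by exists 1 => w; rewrite normr_nat (ler_nat _ _ 1) leq_b1.
    exact: (measurable_nat_comp mX (fun j => (n%:R * Num.sqrt lambda <= `|j%:R - lambda|)%R%:R)).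
  have t_le : \int[P]_w (n%:R * Num.sqrt lambda <= `|(X w)%:R - lambda|)%R%:R <= eta.
    apply: le_trans tail _; rewrite exprMn sqr_sqrtr ?(ltW l0)// invfM mulrCA divff ?gt_eqF//.
    rewrite mulr1 (@le_trans _ _ n%:R^-1)//.
      rewrite lef_pV2 ?posrE ?exprn_gt0// expr2 ler_peMl ?(ltW n0)//.
      by rewrite ler1n -(@ltr0n R).
    by rewrite -[eta]invrK lef_pV2 ?posrE ?invr_gt0// ltW.
  apply: (@le_trans _ _ (\int[P]_w (1 - (n%:R * Num.sqrt lambda <= `|(X w)%:R - lambda|)%R%:R))).
    by rewrite meanB ?mean_cst ?lerD2l ?lerN2//; exact: bounded_measurable_cst.
  apply: mean_le => //; first by apply: bounded_measurableB => //; exact: bounded_measurable_cst.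
  move=> w; have [h1|h1] := leP (n%:R * Num.sqrt lambda) `|(X w)%:R - lambda|.
    by rewrite subrr; have /andP[] := plateau_itv n%:R (standardized lambda X w).
  rewrite subr0 plateau1// /standardized normrM normfV [`|Num.sqrt _|]gtr0_norm//.
  by rewrite ler_pdivrMr// distrC ltW.
have -> : \int[P]_w h (standardized lambda X w) - m =
    \int[P]_w h0 (standardized lambda X w) + m * (a / c - 1).
  rewrite /h0 meanB//; last exact: bounded_measurableZl.
  by rewrite meanZl// -/a; ring.
rewrite (le_trans (ler_normD _ _))// [leRHS]splitr lerD// normrM.
apply: le_trans eta_e; rewrite ler_wpM2l//.
have c0 : 0 < c by lra.
rewrite ler_norml; apply/andP; split.
  rewrite lerBrDl ler_pdivlMr//; nra.
rewrite lerBlDl ler_pdivrMr//; nra.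
Qed.

End PoissonCLT.

(** * Convergence of independent vectors *)

Section Factorization.
Context (R : realType) d (Om : measurableType d) (P : probability Om R).

Lemma mean_factor d' (T : measurableType d') (V : Om -> T) (G : Om -> R) (c : R) :
  measurable_fun setT V -> bounded_measurable G ->
  (forall B, measurable B ->
     \int[P]_w (\1_B (V w) * G w) = \int[P]_w \1_B (V w) * c) ->
  forall h, bounded_measurable h ->
    \int[P]_w (h (V w) * G w) = \int[P]_w h (V w) * c.
Proof.
move=> mV bG VG h bh; apply/eqP; rewrite -subr_eq0 -normr_le0; apply/ler_addgt0Pr => e e0.
rewrite add0r; have [mG [M GM]] := bG.
have M0 : 0 <= M := le_trans (normr_ge0 _) (GM point).
have Mc : 0 < M + `|c| + 1 by rewrite ltr_wpDl// addr_ge0.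
have [m [a [B [mB hB]]]] := step_approximation bh (divr_gt0 e0 Mc).
pose s t := \sum_l a l * \1_(B l) t.
have bB l : bounded_measurable (fun w => \1_(B l) (V w) : R).
  by apply: (bounded_measurable_comp mV); exact: bounded_measurable_indic.
have bs : bounded_measurable (fun w => s (V w)).
  by apply: bounded_measurable_sum => l; exact: bounded_measurableZl.
have bhV : bounded_measurable (fun w => h (V w)) by exact: bounded_measurable_comp.
have sE : \int[P]_w (s (V w) * G w) = \int[P]_w s (V w) * c.
  transitivity (\int[P]_w \sum_l a l * (\1_(B l) (V w) * G w)).
    by apply: eq_Rintegral => w _; rewrite mulr_suml; apply: eq_bigr => l _; rewrite mulrA.
  rewrite mean_sum; last by move=> l; exact/bounded_measurableZl/bounded_measurableM.
  rewrite mean_sum; last by move=> l; exact: bounded_measurableZl.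
  rewrite mulr_suml; apply: eq_bigr => l _.
  by rewrite !meanZl//; [rewrite VG// mulrA | exact: bounded_measurableM].
have h1 : `|\int[P]_w (h (V w) * G w) - \int[P]_w (s (V w) * G w)| <= e / (M + `|c| + 1) * M.
  apply: mean_dist_le; [exact: bounded_measurableM..|] => w.
  by rewrite -mulrBl normrM ler_pM.
have h2 : `|\int[P]_w h (V w) - \int[P]_w s (V w)| <= e / (M + `|c| + 1).
  exact: mean_dist_le.
rewrite (_ : _ - _ = (\int[P]_w (h (V w) * G w) - \int[P]_w (s (V w) * G w)) -
  (\int[P]_w h (V w) - \int[P]_w s (V w)) * c); last by rewrite sE; ring.
rewrite (le_trans (ler_normB _ _))// normrM.
apply: (@le_trans _ _ (e / (M + `|c| + 1) * (M + `|c|))).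
  by rewrite mulrDr lerD// ler_wpM2r.
by rewrite mulrAC ler_pdivrMr// ler_pM2l// lerDl.
Qed.

Lemma mean_prod (I : finType) (W : I -> Om -> R) (h : I -> R -> R) :
  (forall i, measurable_fun setT (W i)) -> product_rule P W ->
  (forall i, bounded_measurable (h i)) ->
  \int[P]_w \prod_i h i (W i w) = \prod_i \int[P]_w h i (W i w).
Proof.
move=> mW PW.
(* Induction on the list of indices whose functions are arbitrary, all others being indicators:
   [mean_factor] frees one index at a time, and the empty list is the product rule. *)
suff H (s : seq I) : forall g : I -> R -> R,
    (forall i, bounded_measurable (g i)) ->
    (forall i, i \notin s -> exists2 B, measurable B & g i = \1_B) ->
    \int[P]_w \prod_i g i (W i w) = \prod_i \int[P]_w g i (W i w).
  by move=> bh; apply: (H (enum I)) => // i; rewrite mem_enum.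
elim: s => [|i s IH] g bg gs.
  have /choice[B BP] : forall i, exists B : set R, measurable B /\ g i = \1_B.
    by move=> i; have [//|B ? ?] := gs i; exists B.
  have mWB i : measurable (W i @^-1` B i).
    by rewrite -[X in measurable X]setTI; apply: mW => //; have [] := BP i.
  transitivity (\int[P]_w \1_[set w | forall i, B i (W i w)] w).
    apply: eq_Rintegral => w _; under eq_bigr do rewrite (BP _).2 indicE.
    have [allB|notB] := pselect (forall i, B i (W i w)).
      rewrite indicE mem_set// big1// => i _; rewrite mem_set//.
    rewrite indicE memNset//; move/existsNP: notB => [i Bi].
    by rewrite (bigD1 i)//= memNset// mul0r.
  rewrite mean_indic; last first.
    by apply: measurable_forall_countable => i; exact: mWB.
  rewrite PW => [|i]; last by have [] := BP i.
  rewrite (_ : (\prod_i _)%E = (\prod_i \int[P]_w g i (W i w))%:E)//.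
  rewrite (big_morph EFin EFinM erefl); apply: eq_bigr => i _.
  rewrite -[LHS]fineK ?fin_num_measure// -mean_indic//; congr EFin.
  by apply: eq_Rintegral => w _; rewrite (BP i).2 !indicE.
pose g' B j := if j == i then \1_B else g j.
pose G w := \prod_(j | j != i) g j (W j w).
have bgW j : bounded_measurable (fun w => g j (W j w)).
  exact: bounded_measurable_comp.
have bG : bounded_measurable G.
  rewrite /G; under eq_fun do rewrite big_mkcond.
  apply: bounded_measurable_prod => j; case: (j != i) => //.
  exact: bounded_measurable_cst.
transitivity (\int[P]_w (g i (W i w) * G w)).
  by apply: eq_Rintegral => w _; rewrite (bigD1 i).
rewrite [RHS](bigD1 i)//=; apply: mean_factor => // B mB.
transitivity (\int[P]_w \prod_j g' B j (W j w)).
  apply: eq_Rintegral => w _; rewrite [RHS](bigD1 i)//= /g' eqxx; congr (_ * _).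
  by apply: eq_bigr => j ji; rewrite (negbTE ji).
rewrite IH => [|j|j js].
- rewrite (bigD1 i)//= /g' eqxx; congr (_ * _).
  by apply: eq_bigr => j ji; rewrite (negbTE ji).
- by rewrite /g'; case: eqP => // _; exact: bounded_measurable_indic.
- rewrite /g'; case: eqP => [_|/eqP ji]; first by exists B.
  by apply: gs; rewrite inE negb_or ji.
Qed.

End Factorization.

Section Tent.
Context (R : realType).

Definition ramp (t : R) : R := Num.max 0 (Num.min 1 t).

Lemma ramp_le0 t : t <= 0 -> ramp t = 0.
Proof. by move=> t0; rewrite /ramp max_l// ge_min t0 orbT. Qed.

Lemma ramp_ge1 t : 1 <= t -> ramp t = 1.
Proof. by move=> t1; rewrite /ramp min_l// max_r. Qed.

Lemma ramp_itv t : 0 <= ramp t <= 1.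
Proof. by rewrite /ramp le_max lexx/= ge_max ler01 ge_min lexx. Qed.

Lemma ramp_dist s t : `|ramp s - ramp t| <= `|s - t|.
Proof.
rewrite /ramp /Num.max /Num.min ler_normr !ler_norml.
by repeat case: ifPn; rewrite -?leNgt => *; lra.
Qed.

Lemma ramp_mono s t : s <= t -> ramp s <= ramp t.
Proof.
move=> st; rewrite /ramp /Num.max /Num.min.
by repeat case: ifPn; rewrite -?leNgt => *; lra.
Qed.

(* [tent N r j] is supported in the two meshes around [node N r j]; the
   tents form a partition of unity because their sum telescopes. *)
Definition tent (N r j : nat) (z : R) : R :=
  ramp (N%:R * (z + r%:R) - j%:R) - ramp (N%:R * (z + r%:R) - j.+1%:R).

Definition node (N r j : nat) : R := j.+1%:R / N%:R - r%:R.

Lemma tent_itv N r j z : 0 <= tent N r j z <= 1.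
Proof.
rewrite /tent; set a := _ * _.
have := @ramp_mono (a - j.+1%:R) (a - j%:R); rewrite lerB ?ler_nat// => /(_ isT).
have /andP[? ?] := ramp_itv (a - j%:R); have /andP[? ?] := ramp_itv (a - j.+1%:R).
by move=> ?; apply/andP; split; lra.
Qed.

Lemma tent_supp N r j z : (0 < N)%N -> tent N r j z != 0 ->
  `|z - node N r j| <= N%:R^-1.
Proof.
move=> N0 T0; have N0' : 0 < N%:R :> R by rewrite ltr0n.
rewrite (_ : z - node N r j = (N%:R * (z + r%:R) - j.+1%:R) / N%:R); last first.
  by rewrite /node; field; rewrite gt_eqF.
rewrite normrM [`|_^-1|]ger0_norm ?invr_ge0// ler_piMl ?invr_ge0//; move: T0; rewrite /tent.
set a := _ * _; apply: contraR; rewrite -ltNge ltr_normr => /orP[a1|a1].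
  rewrite !ramp_ge1 ?subrr//; move: a1; rewrite -natr1; lra.
rewrite !ramp_le0 ?subrr//; move: a1; rewrite -natr1; lra.
Qed.

Lemma sum_tent N r m z : \sum_(j < m) tent N r j z =
  ramp (N%:R * (z + r%:R)) - ramp (N%:R * (z + r%:R) - m%:R).
Proof.
elim: m => [|m IH]; first by rewrite big_ord0 subr0 subrr.
by rewrite big_ord_recr/= IH /tent addrA subrK.
Qed.

Lemma sum_tent_itv N r m z : 0 <= \sum_(j < m) tent N r j z <= 1.
Proof.
rewrite sum_tent; set a := _ * _.
have := @ramp_mono (a - m%:R) a; rewrite gerBl ler0n => /(_ isT).
have /andP[? ?] := ramp_itv (a - m%:R); have /andP[? ?] := ramp_itv a.
by move=> ?; apply/andP; split; lra.
Qed.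

Lemma sum_tent1 N r z : (0 < N)%N -> `|z| <= r%:R - 1 ->
  \sum_(j < 2 * r * N) tent N r j z = 1.
Proof.
move=> N0; rewrite ler_norml => /andP[z1 z2]; have N1 : 1 <= N%:R :> R by rewrite ler1n.
rewrite sum_tent ramp_ge1; last by rewrite mulr_ege1//; lra.
rewrite ramp_le0 ?subr0// subr_le0 !natrM mulrC ler_wpM2r//; lra.
Qed.

Lemma test_function_tent N r j : test_function (tent N r j).
Proof.
exists (j.+3%:R + r%:R), 1, (2 * N%:R); split.
- by rewrite ltr_pwDl.
- by move=> t; have /andP[? ?] := tent_itv N r j t; rewrite ger0_norm.
- move=> t; case: N => [|N].
    by rewrite /tent mul0r !sub0r !ramp_le0 ?subrr// oppr_le0.
  move=> tr; apply/eqP; apply: contraT => /tent_supp => /(_ isT) tn.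
  have h1 : N.+1%:R^-1 <= 1 :> R by rewrite invf_le1 ?ler1n.
  have h2 : `|node N.+1 r j| <= j.+1%:R + r%:R.
    rewrite (le_trans (ler_normB _ _))// [`|r%:R|]normr_nat lerD2r.
    by rewrite ger0_norm ?divr_ge0// ler_piMr.
  have h3 := ler_normD (t - node N.+1 r j) (node N.+1 r j); rewrite subrK in h3.
  suff : `|t| < j.+3%:R + r%:R by rewrite ltNge tr.
  rewrite (le_lt_trans h3)// (le_lt_trans (lerD (le_trans tn h1) h2))//.
  by rewrite addrA ltrD2r addrC natr1 ltr_nat.
- move=> s t; rewrite /tent; set a := _ * _; set b := _ * (t + _).
  have h1 := ramp_dist (a - j%:R) (b - j%:R).
  have h2 := ramp_dist (a - j.+1%:R) (b - j.+1%:R).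
  rewrite (_ : _ - _ = (ramp (a - j%:R) - ramp (b - j%:R)) -
    (ramp (a - j.+1%:R) - ramp (b - j.+1%:R))); last by ring.
  rewrite (le_trans (ler_normB _ _))// (le_trans (lerD h1 h2))//.
  rewrite (_ : a - j%:R - _ = N%:R * (s - t)); last by rewrite /a /b; ring.
  rewrite (_ : a - j.+1%:R - _ = N%:R * (s - t)); last by rewrite /a /b; ring.
  by rewrite normrM normr_nat -mulrA mulr_natl mulr2n.
Qed.

End Tent.

Lemma cvg_finite_prod (R : realType) (I : Type) (s : seq I) (a : nat -> I -> R) (l : I -> R) :
  (forall i, a n i @[n --> \oo] --> l i) ->
  \prod_(i <- s) a n i @[n --> \oo] --> \prod_(i <- s) l i.
Proof.
move=> al; elim: s => [|i s IH].
  by rewrite big_nil; under eq_fun do rewrite big_nil; exact: cvg_cst.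
by rewrite big_cons; under eq_fun do rewrite big_cons; exact: cvgM.
Qed.

Section ProductConvergence.
Context (R : realType) (I : finType).
Context d (Om : measurableType d) (P : probability Om R).
Context d' (Om' : measurableType d') (P' : probability Om' R).
Variables (Z : I -> Om -> R) (W : nat -> I -> Om' -> R).
Hypotheses (mZ : forall i, measurable_fun setT (Z i))
  (mW : forall n i, measurable_fun setT (W n i)).
Hypotheses (PZ : product_rule P Z) (PW : forall n, product_rule P' (W n)).
Hypothesis WZ : forall i h, test_function h ->
  \int[P']_w h (W n i w) @[n --> \oo] --> \int[P]_w h (Z i w).

Section Grid.
Variables (N r : nat).
Let m := (2 * r * N)%N.

Definition multi_tent (a : {ffun I -> 'I_m}) (z : I -> R) : R := \prod_i tent N r (a i) (z i).

Definition grid_mass (z : I -> R) := \sum_(a : {ffun I -> 'I_m}) multi_tent a z.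

Lemma multi_tent_ge0 a z : 0 <= multi_tent a z.
Proof. by apply: prodr_ge0 => i _; have /andP[] := tent_itv N r (a i) (z i). Qed.

Lemma grid_massE z : grid_mass z = \prod_i \sum_(j < m) tent N r j (z i).
Proof. by rewrite bigA_distr_bigA. Qed.

Lemma grid_mass_itv z : 0 <= grid_mass z <= 1.
Proof.
rewrite grid_massE; apply/andP; split.
  by apply: prodr_ge0 => i _; have /andP[] := sum_tent_itv N r m (z i).
apply: prodr_ile1 => i _; exact: sum_tent_itv.
Qed.

(** A tent product that is nonzero at [z] has its node within [1 / N] of [z]; the mass missing from
    the partition of unity costs at most [B] per unit. *)
Lemma grid_approximation (F : (I -> R) -> R) (B L : R) z : (0 < N)%N -> 0 <= L ->
  (forall z, `|F z| <= B) ->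
  (forall z z' t, (forall i, `|z i - z' i| <= t) -> `|F z - F z'| <= L * t) ->
  `|F z - \sum_(a : {ffun I -> 'I_m}) F (fun i => node R N r (a i)) * multi_tent a z|
    <= L / N%:R + B * (1 - grid_mass z).
Proof.
move=> N0 L0 FB FL; have /andP[g0 g1] := grid_mass_itv z.
rewrite (_ : _ - _ = \sum_(a : {ffun I -> 'I_m})
    (F z - F (fun i => node R N r (a i))) * multi_tent a z + F z * (1 - grid_mass z)); last first.
  under [in RHS]eq_bigr do rewrite mulrBl.
  by rewrite sumrB -mulr_sumr -/(grid_mass z); ring.
rewrite (le_trans (ler_normD _ _))// lerD//; last first.
  by rewrite normrM [`|1 - _|]ger0_norm ?subr_ge0// ler_wpM2r// subr_ge0.
rewrite (le_trans (ler_norm_sum _ _ _))//.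
apply: (@le_trans _ _ (\sum_(a : {ffun I -> 'I_m}) L / N%:R * multi_tent a z)); last first.
  by rewrite -mulr_sumr ler_piMr// divr_ge0.
apply: ler_sum => a _; rewrite normrM [`|multi_tent _ _|]ger0_norm ?multi_tent_ge0//.
have [->|T0] := eqVneq (multi_tent a z) 0; first by rewrite !mulr0.
rewrite ler_wpM2r ?multi_tent_ge0//; apply: FL => i.
apply: tent_supp => //; move/prodf_neq0: T0; exact.
Qed.

Lemma bounded_measurable_multi_tent d0 (U : measurableType d0)
    (X : I -> U -> R) a : (forall i, measurable_fun setT (X i)) ->
  bounded_measurable (fun u => multi_tent a (X ^~ u)).
Proof.
move=> mX; apply: bounded_measurable_prod => i.
by apply: (bounded_measurable_comp (mX i)); exact/bounded_measurable_test_function/test_function_tent.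
Qed.

Lemma cvg_mean_multi_tent a :
  \int[P']_w multi_tent a (W n ^~ w) @[n --> \oo] --> \int[P]_w multi_tent a (Z ^~ w).
Proof.
rewrite /multi_tent (mean_prod (h := fun i => tent N r (a i)))//; last first.
  by move=> i; exact/bounded_measurable_test_function/test_function_tent.
rewrite (_ : (fun n => _) = (fun n => \prod_i \int[P']_w tent N r (a i) (W n i w))).
  by apply: cvg_finite_prod => i; exact/WZ/test_function_tent.
apply/funext => n; rewrite (mean_prod (h := fun i => tent N r (a i)))// => i.
exact/bounded_measurable_test_function/test_function_tent.
Qed.

Lemma grid_mass1 z : (0 < N)%N -> (forall i, `|z i| <= r%:R - 1) -> grid_mass z = 1.
Proof. by move=> N0 zr; rewrite grid_massE big1// => i _; exact: sum_tent1. Qed.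

End Grid.

Lemma bounded_measurable_grid_mass N r d0 (U : measurableType d0) (X : I -> U -> R) :
  (forall i, measurable_fun setT (X i)) ->
  bounded_measurable (fun u => grid_mass N r (X ^~ u)).
Proof.
by move=> mX; apply: bounded_measurable_sum => a; exact: bounded_measurable_multi_tent.
Qed.

Lemma mean_grid_mass N (e : R) : (0 < N)%N -> 0 < e ->
  exists r, 1 - e <= \int[P]_w grid_mass N r (Z ^~ w).
Proof.
move=> N0 e0.
have : \int[P]_w grid_mass N r (Z ^~ w) @[r --> \oo] --> \int[P]_w (1 : R).
  apply: (mean_dominated_cvg (M := 1)).
  - by move=> r; have [] := bounded_measurable_grid_mass N r mZ.
  - exact: measurable_cst.
  - by move=> r w; have /andP[? ?] := grid_mass_itv N r (Z ^~ w); rewrite ger0_norm.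
  - apply: aeW => w; apply: cvg_near_cst; near=> r.
    apply: grid_mass1 => // i; apply: (@le_trans _ _ (\sum_j `|Z j w|)).
      by rewrite (bigD1 i)//= lerDl sumr_ge0.
    by rewrite lerBrDr; near: r; exact: nbhs_infty_ger.
rewrite mean_cst => /cvgrPdist_le /(_ e e0) [r _ /(_ r (leqnn r))] /=.
by rewrite ler_norml => /andP[_ h]; exists r; lra.
Unshelve. all: by end_near. Qed.

(** The threshold for [n] depends only on finitely many tent products and not on [F]. This
    uniformity is essential: later [F] ranges over smooth sums for all allocations [x]. *)
Lemma mean_cvg_uniform (B L e : R) : 0 <= B -> 0 <= L -> 0 < e ->
  \forall n \near \oo, forall F : (I -> R) -> R, (forall z, `|F z| <= B) ->
    (forall z z' t, (forall i, `|z i - z' i| <= t) -> `|F z - F z'| <= L * t) ->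
    measurable_fun setT (fun w => F (W n ^~ w)) ->
    measurable_fun setT (fun w => F (Z ^~ w)) ->
    `|\int[P']_w F (W n ^~ w) - \int[P]_w F (Z ^~ w)| <= e.
Proof.
move=> B0 L0 e0; pose N := (Num.bound (8 * L / e)).+1.
have N0 : (0 < N)%N by [].
have LN : L / N%:R <= e / 8.
  have h : 0 <= 8 * L / e by rewrite divr_ge0 ?mulr_ge0 ?(ltW e0).
  have := archi_boundP h; rewrite ltr_pdivrMr// => hb.
  rewrite ler_pdivrMr ?ltr0n//.
  have : (Num.bound (8 * L / e))%:R * e <= N%:R * e by rewrite ler_pM2r// ler_nat leqnSn.
  by lra.
have B1 : 0 < B + 1 by rewrite ltr_wpDl.
(* The tolerance is [e / (8 * (B + 1))], which after multiplication by [B] costs at most [e / 8]. *)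
have [r rP] := mean_grid_mass N0 (divr_gt0 e0 (mulr_gt0 (ltr0Sn R 7) B1)).
pose D n := \sum_(a : {ffun I -> 'I_(2 * r * N)})
  `|\int[P']_w multi_tent a (W n ^~ w) - \int[P]_w multi_tent a (Z ^~ w)|.
have D0 : D n @[n --> \oo] --> (0 : R).
  rewrite [X in _ --> X](_ : 0 = \sum_(a : {ffun I -> 'I_(2 * r * N)}) 0); last by rewrite big1.
  apply: cvg_finite_sum => a; rewrite -(normr0 R) -(subrr (\int[P]_w multi_tent a (Z ^~ w))).
  apply: cvg_norm; apply: cvgB; last exact: cvg_cst.
  exact: cvg_mean_multi_tent.
have := D0 => /cvgrPdist_le /(_ _ (divr_gt0 e0 (mulr_gt0 (ltr0Sn R 7) B1))); apply: filterS => n.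
rewrite sub0r normrN ger0_norm; last by apply: sumr_ge0.
move=> Dn F FB FL mFW mFZ.
pose Phi z := \sum_(a : {ffun I -> 'I_(2 * r * N)}) F (fun i => node R N r (a i)) * multi_tent a z.
have bFW : bounded_measurable (fun w => F (W n ^~ w)) by split => //; exists B => w.
have bFZ : bounded_measurable (fun w => F (Z ^~ w)) by split => //; exists B => w.
have bT d0 (U : measurableType d0) (X : I -> U -> R) a : (forall i, measurable_fun setT (X i)) ->
    bounded_measurable (fun u => multi_tent (N := N) (r := r) a (X ^~ u)).
  exact: bounded_measurable_multi_tent.
have bPhi d0 (U : measurableType d0) (X : I -> U -> R) : (forall i, measurable_fun setT (X i)) ->
    bounded_measurable (fun u => Phi (X ^~ u)).
  by move=> mX; apply: bounded_measurable_sum => a; exact/bounded_measurableZl/bT.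
have approx d0 (U : measurableType d0) (Q : probability U R) (X : I -> U -> R) :
    (forall i, measurable_fun setT (X i)) -> measurable_fun setT (fun u => F (X ^~ u)) ->
    `|\int[Q]_u F (X ^~ u) - \int[Q]_u Phi (X ^~ u)| <=
      L / N%:R + B * (1 - \int[Q]_u grid_mass N r (X ^~ u)).
  move=> mX mF; have bS := bounded_measurable_grid_mass N r mX.
  have bF : bounded_measurable (fun u => F (X ^~ u)) by split => //; exists B => w.
  have b1 : bounded_measurable (fun u => 1 - grid_mass N r (X ^~ u)).
    by apply: bounded_measurableB => //; exact: bounded_measurable_cst.
  have bd : bounded_measurable (fun u => F (X ^~ u) - Phi (X ^~ u)).
    by apply: bounded_measurableB => //; exact: bPhi.
  rewrite -meanB//; last exact: bPhi.
  apply: (@le_trans _ _ (\int[Q]_u (L / N%:R + B * (1 - grid_mass N r (X ^~ u))))).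
    rewrite (@le_trans _ _ (\int[Q]_u `|F (X ^~ u) - Phi (X ^~ u)|))//.
      by apply: le_normr_Rintegral => //; exact: bounded_measurable_integrable.
    apply: mean_le => [||u].
    - exact: bounded_measurable_norm.
    - by apply: bounded_measurableD; [exact: bounded_measurable_cst|exact: bounded_measurableZl].
    - exact: grid_approximation.
  rewrite meanD; [|exact: bounded_measurable_cst|exact: bounded_measurableZl].
  rewrite mean_cst meanZl// meanB//; last exact: bounded_measurable_cst.
  by rewrite mean_cst.
have mass_le : `|\int[P']_w grid_mass N r (W n ^~ w) - \int[P]_w grid_mass N r (Z ^~ w)| <= D n.
  rewrite mean_sum; last by move=> a; exact: bT.
  rewrite mean_sum; last by move=> a; exact: bT.
  by rewrite -sumrB ler_norm_sum.
have Phi_le : `|\int[P']_w Phi (W n ^~ w) - \int[P]_w Phi (Z ^~ w)| <= B * D n.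
  rewrite mean_sum; last by move=> a; exact/bounded_measurableZl/bT.
  rewrite mean_sum; last by move=> a; exact/bounded_measurableZl/bT.
  rewrite -sumrB mulr_sumr (le_trans (ler_norm_sum _ _ _))//; apply: ler_sum => a _.
  by rewrite !meanZl; [|exact: bT..]; rewrite -mulrBr normrM ler_wpM2r.
have aW := approx _ _ P' (W n) (mW n) mFW; have aZ := approx _ _ P Z mZ mFZ.
move: rP Dn mass_le; set SW := \int[P']_w grid_mass _ _ _; set SZ := \int[P]_w grid_mass _ _ _.
set x := e / _ => rP Dn mass_le.
have Bx : B * x <= e / 8.
  rewrite (_ : B * x = e / 8 * (B / (B + 1))); last by rewrite /x invfM; ring.
  rewrite ler_piMr ?divr_ge0 ?(ltW e0)//.
  by rewrite ler_pdivrMr// mul1r lerDl.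
have h1 : B * (1 - SZ) <= e / 8 by apply: le_trans Bx; rewrite ler_wpM2l//; lra.
(* Tightness of the [W n] is inherited: their grid mass is close to that of [Z]. *)
have h2 : B * (1 - SW) <= e / 4.
  rewrite (@le_trans _ _ (B * (x + x)))//; last by lra.
  rewrite ler_wpM2l//; move: mass_le; rewrite ler_norml => /andP[]; lra.
have h3 : B * D n <= e / 8 by apply: le_trans Bx; rewrite ler_wpM2l.
rewrite (_ : _ - _ = (\int[P']_w F (W n ^~ w) - \int[P']_w Phi (W n ^~ w)) -
  (\int[P]_w F (Z ^~ w) - \int[P]_w Phi (Z ^~ w)) +
  (\int[P']_w Phi (W n ^~ w) - \int[P]_w Phi (Z ^~ w))); last by ring.
rewrite (le_trans (ler_normD _ _))// (le_trans (lerD (ler_normB _ _) Phi_le))//.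
apply: le_trans (lerD (lerD aW aZ) h3) _; rewrite -/SW -/SZ.
have aux (a b c : R) : a <= e / 8 -> b <= e / 8 -> c <= e / 4 ->
  a + c + (a + b) + e / 8 <= e by lra.
exact: aux.
Unshelve. all: by end_near. Qed.

End ProductConvergence.

(** * Concentration of clearance times *)

Lemma measurable_nat_comp2 d (T : measurableType d) (f : nat -> nat -> nat) (X Y : T -> nat) :
  measurable_fun setT X -> measurable_fun setT Y ->
  measurable_fun setT (fun w => f (X w) (Y w)).
Proof.
move=> mX mY _ B _; rewrite setTI.
rewrite (_ : _ @^-1` B = [set w | exists ab : nat * nat,
    [/\ B (f ab.1 ab.2), X w = ab.1 & Y w = ab.2]]); last first.
  by apply/seteqP; split=> [w Bw|w [ab [] + Xw Yw]] /=; [exists (X w, Y w)|rewrite Xw Yw].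
apply: measurable_exists_countable => -[a b] /=.
have [Bab|Bab] := pselect (B (f a b)); last first.
  by rewrite [X in measurable X](_ : _ = set0)//; apply/seteqP; split => w // [].
rewrite [X in measurable X](_ : _ = X @^-1` [set a] `&` Y @^-1` [set b]); last first.
  by apply/seteqP; split=> [w []|w []].
apply: measurableI; rewrite -[X in measurable X]setTI; [exact: mX|exact: mY].
Qed.

Section PoissonProcess.
Context (R : realType) d (Om : measurableType d) (P : probability Om R).

Section OneProcess.
Variables (p : R) (Y : R -> {RV P >-> nat}).
Hypotheses (p_gt0 : 0 < p) (YP : poisson_process p Y).

Lemma poisson_process_law t : 0 < t -> forall j,
  P [set w | Y t w = j] = (poisson_pmf (p * t) j)%:E.
Proof.
move=> t0 j; have := poisson_process_increment_law YP (lexx 0) t0 j.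
rewrite subr0 => <-; congr (P _); apply/seteqP.
by split => w /=; rewrite (poisson_process_start YP) subn0.
Qed.

(** Stated for both orders of [s] and [t], since it is applied at times on both sides of [n]. *)
Lemma increment_tail (s t a : R) : 0 <= s -> 0 <= t -> 0 < a ->
  \int[P]_w (a <= `|(Y t w)%:R - (Y s w)%:R - p * (t - s)|)%R%:R <=
    p * `|t - s| / a ^+ 2.
Proof.
wlog st : s t / s <= t => [H s0 t0 a0|].
  have [st|/ltW ts] := leP s t; first exact: H.
  rewrite distrC; apply: le_trans (H t s ts t0 s0 a0).
  rewrite le_eqVlt; apply/orP; left; apply/eqP; apply: eq_Rintegral => w _.
  by rewrite -normrN; do 4 congr (_ _); ring.
move=> s0 t0 a0; move: st; rewrite le_eqVlt => /predU1P[->|st].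
  rewrite [leLHS](_ : _ = 0); first by rewrite mulr_ge0// ?invr_ge0 ?sqr_ge0// mulr_ge0// ltW.
  rewrite -[RHS](mean_cst P); apply: eq_Rintegral => w _.
  by rewrite !subrr mulr0 subrr normr0 leNgt a0.
rewrite [`|t - s|]gtr0_norm ?subr_gt0//.
have mX : measurable_fun setT (fun w => Y t w - Y s w)%N.
  exact: (measurable_nat_comp2 subn (measurable_funPT (Y t)) (measurable_funPT (Y s))).
have l0 : 0 < p * (t - s) by rewrite mulr_gt0// subr_gt0.
have := poisson_Chebyshev mX l0 (poisson_process_increment_law YP s0 st) a0.
apply: le_trans; rewrite le_eqVlt; apply/orP; left; apply/eqP; apply: eq_Rintegral => w _.
by rewrite natrB// (poisson_process_nondecreasing YP)// ltW.
Qed.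

Lemma bounded_measurable_increment (s t a b : R) :
  bounded_measurable (fun w => (a <= `|(Y t w)%:R - (Y s w)%:R - b|)%R%:R : R).
Proof.
split; last by exists 1 => w; rewrite normr_nat (ler_nat _ _ 1) leq_b1.
have mY u : measurable_fun setT (fun w => (Y u w)%:R : R).
  exact: (measurable_nat_comp (measurable_funPT (Y u))).
have mf : measurable_fun setT (fun w => `|(Y t w)%:R - (Y s w)%:R - b| : R).
  apply: (measurableT_comp (@normr_measurable R setT)).
  by do 2 apply: measurable_funB => //.
rewrite (_ : (fun w => _) = \1_[set w | a <= `|(Y t w)%:R - (Y s w)%:R - b|]); last first.
  by apply/funext => w; rewrite indicE mem_setE.
apply: measurable_indic.
rewrite (_ : [set w | _] = (fun w => `|(Y t w)%:R - (Y s w)%:R - b| : R) @^-1` `[a, +oo[%classic).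
  by rewrite -[X in measurable X]setTI; exact: mf.
by apply/seteqP; split => w /=; rewrite in_itv/= andbT.
Qed.

Definition hitting_time (xi : nat) (w : Om) : \bar R :=
  ereal_inf [set t%:E | t in [set t : R | (0 <= t)%R /\ (xi <= Y t w)%N]].

Lemma hitting_time_le xi t w : 0 <= t -> (xi <= Y t w)%N -> (hitting_time xi w <= t%:E)%E.
Proof. by move=> t0 xit; apply: ereal_inf_lbound; exists t. Qed.

Lemma hitting_time_ge xi t w : 0 <= t -> (Y t w < xi)%N -> (t%:E <= hitting_time xi w)%E.
Proof.
move=> t0 xit; apply: le_ereal_inf_tmp => _ [s [s0 xis] <-]; rewrite lee_fin leNgt.
apply/negP => /ltW st; have := poisson_process_nondecreasing YP w s0 st.
by rewrite leqNgt (leq_trans xit).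
Qed.

(** Counts are nondecreasing, so a level hit before [r] is already reached at some rational time
    before [r]. *)
Lemma measurable_hitting_time xi : measurable_fun setT (hitting_time xi).
Proof.
apply: (measurability _ (ErealGenInftyO.measurableE R)) => _ [_ [r ->] <-].
rewrite setTI (_ : _ @^-1` _ = [set w | exists q : rat,
    [/\ 0 <= ratr q :> R, ratr q < r & (xi <= Y (ratr q) w)%N]]).
  apply: measurable_exists_countable => q.
  have [q0|q0] := boolP (0 <= (ratr q : R) < r); last first.
    rewrite [X in measurable X](_ : _ = set0)//; apply/seteqP; split => w // [q1 q2 _].
    by move: q0; rewrite q1 q2.
  rewrite [X in measurable X](_ : _ = Y (ratr q) @^-1` [set j | (xi <= j)%N]).
    by rewrite -[X in measurable X]setTI; exact: (measurable_funPT (Y (ratr q))).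
  by apply/seteqP; split=> [w []//|w /= h]; have /andP[? ?] := q0; split.
apply/seteqP; split=> [w|w [q [q0 qr xiq]]] /=; rewrite in_itv/=; last first.
  by rewrite (le_lt_trans (hitting_time_le q0 xiq))// lte_fin.
move=> /ereal_inf_lt[_ [t [t0 xit] <-]]; rewrite lte_fin => tr.
have [q] := rat_in_itvoo tr; rewrite in_itv/= => /andP[tq qr].
exists q; split => //; first by rewrite (le_trans t0)// ltW.
by rewrite (leq_trans xit)// (poisson_process_nondecreasing YP)// ltW.
Qed.

End OneProcess.

End PoissonProcess.

Lemma mean_standard_normal (R : realType) d (Om : measurableType d) (P : probability Om R)
    (X : {RV P >-> R}) (h : R -> R) :
  (forall B : set R, measurable B -> P (X @^-1` B) = normal_prob 0 1 B) ->
  bounded_measurable h -> \int[P]_w h (X w) = \int[normal_prob 0 1]_t h t.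
Proof.
move=> X_law bh; apply/eqP; rewrite -subr_eq0 -normr_le0; apply/ler_addgt0Pr => e e0.
rewrite add0r; have [m [c [B [mB hB]]]] := step_approximation bh (divr_gt0 e0 (ltr0Sn R 1)).
pose s t := \sum_l c l * \1_(B l) t.
have bB l : bounded_measurable (\1_(B l) : R -> R) by exact: bounded_measurable_indic.
have bs : bounded_measurable s.
  by apply: bounded_measurable_sum => l; exact: bounded_measurableZl.
have mX := measurable_funPT X.
have bX f : bounded_measurable f -> bounded_measurable (fun w => f (X w)).
  exact: bounded_measurable_comp.
have sE : \int[P]_w s (X w) = \int[normal_prob 0 1]_t s t.
  rewrite /s mean_sum => [|l]; last exact/bounded_measurableZl/bX.
  rewrite mean_sum => [|l]; last exact: (bounded_measurableZl (c l) (bB l)).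
  apply: eq_bigr => l _; rewrite meanZl; last exact: bX.
  rewrite meanZl; last exact: (bB l).
  congr (_ * _); rewrite [RHS]mean_indic; last exact: mB.
  transitivity (fine (P (X @^-1` B l))); last by rewrite X_law; [|exact: mB].
  rewrite -mean_indic; first by apply: eq_Rintegral => w _; rewrite !indicE.
  by rewrite -[X in measurable X]setTI; exact: mX.
rewrite (_ : _ - _ = (\int[P]_w h (X w) - \int[P]_w s (X w)) -
   (\int[normal_prob 0 1]_t h t - \int[normal_prob 0 1]_t s t)); last by rewrite sE; ring.
rewrite (le_trans (ler_normB _ _))// [leRHS]splitr lerD//.
  by apply: mean_dist_le; [exact: bX..|].
by apply: mean_dist_le.
Qed.

Section Clearance.
Context (R : realType) (K : nat) (p : 'I_K.+1 -> R).
Hypothesis p_gt0 : forall i, 0 < p i.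
Context d (Om : measurableType d) (P : probability Om R).
Variable Y : 'I_K.+1 -> R -> {RV P >-> nat}.
Hypothesis YP : independent_poisson_processes p Y.

Definition noise (n : nat) (i : 'I_K.+1) : Om -> R := standardized (p i * n%:R) (Y i n%:R).

Lemma measurable_noise n i : measurable_fun setT (noise n i).
Proof. exact: (measurable_standardized (p i * n%:R) (measurable_funPT (Y i n%:R))). Qed.

Lemma product_rule_noise n : product_rule P (noise n).
Proof.
move=> B mB; have := YP.2 [set: 'I_K.+1]%SET (fun i => noise n i @^-1` B i).
rewrite (_ : (\bigcap_(i in [set` [set: 'I_K.+1]%SET]) (noise n i @^-1` B i)) =
  [set w | forall i, B i (noise n i w)]); last first.
  apply/seteqP; split => w /= h i => [|_]; [by apply: h; rewrite /= inE|exact: h].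
under eq_bigl do rewrite inE.
apply => i _; apply: sub_sigma_algebra; exists n%:R => //=.
exists [set j : nat | B i ((p i * n%:R - j%:R) / Num.sqrt (p i * n%:R))] => //.
by rewrite setTI.
Qed.

Lemma noise_cvg i (h : R -> R) : test_function h ->
  \int[P]_w h (noise n i w) @[n --> \oo] --> \int[normal_prob 0 1]_t h t.
Proof.
move=> th; apply/cvgrPdist_le => e e0.
have [L L0 LP] := poisson_CLT P th e0.
near=> n; rewrite distrC; apply: LP.
- exact: (measurable_funPT (Y i n%:R)).
- rewrite mulrC -ler_pdivrMr//; near: n; exact: nbhs_infty_ger.
- apply: (poisson_process_law (YP.1 i)); rewrite ltr0n; near: n; exact: nbhs_infty_gt.
Unshelve. all: by end_near. Qed.

Lemma measurable_clearance_time xi : measurable_fun setT (clearance_time Y xi).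
Proof.
rewrite /clearance_time; elim: (index_enum _) => [|i s IH].
  by under eq_fun do rewrite big_nil; exact: measurable_cst.
under eq_fun do rewrite big_cons.
apply: measurable_maxe => //; exact: measurable_hitting_time (YP.1 i) (xi i).
Qed.

Lemma clearance_timeP xi w (a b : R) : a <= b ->
  (exists i, (a%:E <= hitting_time (Y i) (xi i) w)%E) ->
  (forall i, (hitting_time (Y i) (xi i) w <= b%:E)%E) ->
  exists2 c : R, clearance_time Y xi w = c%:E & a <= c <= b.
Proof.
move=> ab [i ai] hb.
have h1 : (a%:E <= clearance_time Y xi w)%E.
  by apply: le_trans ai _; rewrite /clearance_time; exact: (le_bigmax _ (fun i => hitting_time (Y i) (xi i) w) i).
have h2 : (clearance_time Y xi w <= b%:E)%E.
  by apply: bigmax_le => [|j _]; [exact: leNye|exact: hb].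
have ct : clearance_time Y xi w \is a fin_num.
  by rewrite fin_numE gt_eqF ?lt_eqF//; [rewrite (le_lt_trans h2)// ltry|rewrite (lt_le_trans _ h1)// ltNyr].
exists (fine (clearance_time Y xi w)); first by rewrite fineK.
by rewrite -!lee_fin fineK// h1 h2.
Qed.

(** A grid of mesh [dl / 2] over [[- S, S]] has about [4 * S / dl] points; the one chosen is the
    next above [c]. *)
Lemma grid_step (S dl c : R) : 0 < dl -> `|c| <= S ->
  exists2 l : 'I_(Num.bound (4 * S / dl)).+2, c <= - S + l%:R * (dl / 2) &
    - S + l%:R * (dl / 2) <= c + dl / 2.
Proof.
move=> dl0; rewrite ler_norml => /andP[c1 c2].
have S0 : 0 <= S by lra.
have dl2 : 0 < dl / 2 by rewrite divr_gt0.
have q0 : 0 <= (c + S) / (dl / 2) by rewrite divr_ge0 ?(ltW dl2)//; lra.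
pose l := (Num.truncn ((c + S) / (dl / 2))).+1.
have /andP[k1 k2] := truncn_itv q0; rewrite -/l in k2.
have B0 : 0 <= 4 * S / dl by rewrite divr_ge0 ?mulr_ge0 ?(ltW dl0).
have lB : (l < (Num.bound (4 * S / dl)).+2)%N.
  rewrite /l ltnS -(@ltr_nat R) (le_lt_trans k1)//.
  rewrite (le_lt_trans _ (lt_trans (archi_boundP B0) _)) ?ltr_nat//.
  rewrite (_ : 4 * S / dl = 2 * S / (dl / 2)); last by field; rewrite gt_eqF.
  by rewrite ler_pM2r ?invr_gt0//; lra.
exists (Ordinal lB) => /=.
  by move: k2; rewrite ltr_pdivrMr// => ?; lra.
move: k1; rewrite ler_pdivlMr// => k1; rewrite /l -natr1; lra.
Qed.

Section Deviation.
Variables (S dl M : R) (n : nat).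
Hypotheses (dl_gt0 : 0 < dl) (M_gt0 : 0 < M) (n_gt0 : (0 < n)%N).
Hypothesis S_n : Num.sqrt n%:R * S <= n%:R.
Let s : R := Num.sqrt n%:R.
Let m := (Num.bound (4 * S / dl)).+2.
Let g (l : nat) : R := - S + l%:R * (dl / 2).

Definition deviation_at i (t a : R) w : R :=
  (a <= `|(Y i t w)%:R - (Y i n%:R w)%:R - p i * (t - n%:R)|)%R%:R.

(* A count of bad events, so that [deviation w < 1] means that there is none. *)
Definition deviation w : R :=
  \sum_i \sum_(l < m) deviation_at i (n%:R + s * g l) (p i * dl / 4 * s) w +
  \sum_i (M * Num.sqrt (p i * n%:R) <=
    `|(Y i n%:R w)%:R - (Y i 0 w)%:R - p i * (n%:R - 0)|)%R%:R.

Let s_gt0 : 0 < s. Proof. by rewrite sqrtr_gt0 ltr0n. Qed.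
Let s2 : s ^+ 2 = n%:R. Proof. by rewrite sqr_sqrtr. Qed.

(** On the scale of [sqrt n] the counts near time [n] are linear with slope [p i], so side [i]
    reaches its level near time [n + s * coord_time]. As counts are monotone, control on a finite
    grid of times suffices. *)
Lemma clearance_time_near xi w : deviation w < 1 ->
  (forall i, `|coord_time p (normalize p n xi) (noise n ^~ w) i| + dl <= S) ->
  exists2 a : R, clearance_time Y xi w = a%:E &
    `|a - (n%:R + s * max_time p (normalize p n xi) (noise n ^~ w))| <= s * dl.
Proof.
move=> dev cS; set z := noise n ^~ w; set x := normalize p n xi.
have dev0 (b : bool) (r : R) : 0 <= r -> b%:R + r < 1 -> b = false.
  by case: b => //= r0; rewrite ltNge lerDl r0.
have good i (l : 'I_m) : `|(Y i (n%:R + s * g l) w)%:R - (Y i n%:R w)%:R - p i * (s * g l)|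
    < p i * dl / 4 * s.
  move: dev; rewrite /deviation (bigD1 i)//= (bigD1 l)//= -!(addrA (deviation_at _ _ _ _)) => /dev0 h.
  have tE : s * g l = n%:R + s * g l - n%:R by rewrite addrAC subrr add0r.
  rewrite {2}tE ltNge h//.
  by rewrite !addr_ge0//; apply: sumr_ge0 => // j _; apply: sumr_ge0.
have YE i : (Y i n%:R w)%:R = p i * n%:R - Num.sqrt (p i) * s * z i.
  rewrite /z /noise /standardized sqrtrM ?(ltW (p_gt0 i))// -/s.
  have ps0 : Num.sqrt (p i) != 0 by rewrite gt_eqF// sqrtr_gt0.
  by field; rewrite ps0 gt_eqF.
have xiE i : (xi i)%:R = p i * n%:R + s * x ord0 i.
  by rewrite /x mxE -/s; field; rewrite gt_eqF.
have cE i : p i * coord_time p x z i = x ord0 i + Num.sqrt (p i) * z i.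
  rewrite /coord_time mulrDr mulrCA divff ?gt_eqF// mulr1; congr (_ + _).
  have ps0 : Num.sqrt (p i) != 0 by rewrite gt_eqF// sqrtr_gt0.
  rewrite -[X in X * _](sqr_sqrtr (ltW (p_gt0 i))) expr2 mulrACA divff//; ring.
(* The surplus of the count over its target is a fluctuation plus a drift proportional to the
   distance of [g l] from the coordinate time. *)
have gap i l : (Y i (n%:R + s * g l) w)%:R - (xi i)%:R =
    ((Y i (n%:R + s * g l) w)%:R - (Y i n%:R w)%:R - p i * (s * g l)) +
    s * (p i * (g l - coord_time p x z i)).
  by rewrite mulrBr cE YE xiE; ring.
have pos c l : `|c| <= S -> c <= g l -> 0 <= n%:R + s * g l.
  rewrite ler_norml => /andP[c1 _] cg; have : s * - S <= s * g l.
    by rewrite ler_pM2l// (le_trans c1).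
  by move: S_n; rewrite -/s; lra.
have spd i : 0 < s * (p i * dl) by rewrite !mulr_gt0.
(* A grid point between [coord_time + dl / 2] and [coord_time + dl] has drift at least
   [s * p i * dl / 2], twice the largest fluctuation. For [lower] the grid point is between
   [coord_time - dl] and [coord_time - dl / 2]. *)
have upper i : (hitting_time (Y i) (xi i) w <= (n%:R + s * (coord_time p x z i + dl))%:E)%E.
  have cdS : `|coord_time p x z i + dl / 2| <= S.
    have := cS i; rewrite -/x -/z => h; rewrite (le_trans (ler_normD _ _))//.
    apply: le_trans h; rewrite lerD2l [`|dl / 2|]gtr0_norm ?divr_gt0//.
    by rewrite ler_pdivrMr// ler_peMr ?ler1n// ltW.
  have [l l1 l2] := grid_step dl_gt0 cdS; rewrite -/(g l) in l1 l2.
  have t0 := pos _ _ cdS l1.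
  apply: le_trans (hitting_time_le t0 _) _.
    rewrite -(@ler_nat R) -subr_ge0 gap.
    have := good i l; rewrite ltr_norml => /andP[h _].
    have : s * (p i * (dl / 2)) <= s * (p i * (g l - coord_time p x z i)).
      by rewrite ler_pM2l// ler_pM2l//; lra.
    have := spd i; lra.
  by rewrite lee_fin lerD2l ler_pM2l//; lra.
have lower i : ((n%:R + s * (coord_time p x z i - dl))%:E <= hitting_time (Y i) (xi i) w)%E.
  have cdS : `|coord_time p x z i - dl| <= S.
    have := cS i; rewrite -/x -/z => h; rewrite (le_trans (ler_normB _ _))//.
    by rewrite [`|dl|]gtr0_norm.
  have [l l1 l2] := grid_step dl_gt0 cdS; rewrite -/(g l) in l1 l2.
  have t0 := pos _ _ cdS l1.
  apply: le_trans (hitting_time_ge (YP.1 i) t0 _).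
    by rewrite lee_fin lerD2l ler_pM2l.
  rewrite -(@ltr_nat R) -subr_lt0 gap.
  have := good i l; rewrite ltr_norml => /andP[_ h].
  have : s * (p i * (g l - coord_time p x z i)) <= s * (p i * (- (dl / 2))).
    by rewrite ler_pM2l// ler_pM2l//; lra.
  have := spd i; lra.
have [i0 i0E] := max_time_attained p x z.
have [||i|a -> /andP[a1 a2]] := @clearance_timeP xi w
  (n%:R + s * (max_time p x z - dl)) (n%:R + s * (max_time p x z + dl)).
- rewrite lerD2l ler_pM2l// (@le_trans _ _ (max_time p x z))//.
    by rewrite gerBl ltW.
  by rewrite lerDl ltW.
- by exists i0; rewrite i0E.
- apply: le_trans (upper i) _; rewrite lee_fin lerD2l ler_pM2l// lerD2r.
  exact: coord_time_le_max.
by exists a => //; rewrite ler_distl; move: a1 a2; rewrite mulrBr mulrDr !addrA => -> ->.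
Qed.

Lemma noise_le w i : deviation w < 1 -> `|noise n i w| <= M.
Proof.
have pn0 : 0 < Num.sqrt (p i * n%:R) by rewrite sqrtr_gt0 mulr_gt0// ltr0n.
rewrite /deviation addrC (bigD1 i)//=; have r0 : 0 <= \sum_(j | j != i) (M * Num.sqrt (p j * n%:R) <=
      `|(Y j n%:R w)%:R - (Y j 0 w)%:R - p j * (n%:R - 0)|)%R%:R +
    \sum_j \sum_(l < m) deviation_at j (n%:R + s * g l) (p j * dl / 4 * s) w.
  by rewrite addr_ge0//; apply: sumr_ge0 => // j _; apply: sumr_ge0.
rewrite -addrA.
have [h|h _] := leP (M * Num.sqrt (p i * n%:R)) `|(Y i n%:R w)%:R - (Y i 0 w)%:R - p i * (n%:R - 0)|.
  by rewrite ltNge lerDl r0.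
rewrite /noise /standardized normrM normfV [`|Num.sqrt _|]gtr0_norm// ler_pdivrMr//.
by move: h; rewrite (poisson_process_start (YP.1 i)) !subr0 distrC => /ltW.
Qed.

Lemma deviation_ge0 w : 0 <= deviation w.
Proof.
by rewrite addr_ge0//; apply: sumr_ge0 => // j _; apply: sumr_ge0.
Qed.

Let bounded_measurable_deviation_at i t a : bounded_measurable (deviation_at i t a).
Proof. exact: bounded_measurable_increment. Qed.

Lemma bounded_measurable_deviation : bounded_measurable deviation.
Proof.
apply: bounded_measurableD; apply: bounded_measurable_sum => i.
  by apply: bounded_measurable_sum => l.
exact: bounded_measurable_increment.
Qed.

(** Over times of order [sqrt n] the counts have variance of order [sqrt n], against squared
    thresholds of order [n]: hence the factor [1 / s]. The second sum is Chebyshev at [M] standard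
    deviations. *)
Lemma mean_deviation :
  \int[P]_w deviation w <=
    (\sum_i \sum_(l < m) p i * `|g l| / (p i * dl / 4) ^+ 2) / s + K.+1%:R / M ^+ 2.
Proof.
rewrite /deviation meanD; first last.
- by apply: bounded_measurable_sum => i; exact: bounded_measurable_increment.
- by apply: bounded_measurable_sum => i; apply: bounded_measurable_sum => l.
apply: lerD.
  rewrite mean_sum => [|i]; last by apply: bounded_measurable_sum => l.
  rewrite mulr_suml; apply: ler_sum => i _.
  rewrite mean_sum// mulr_suml; apply: ler_sum => l _.
  have a0 : 0 < p i * dl / 4 * s by rewrite !mulr_gt0.
  have t0 : 0 <= n%:R + s * g l.
    rewrite (@le_trans _ _ (n%:R + s * - S))//; first by rewrite mulrN subr_ge0.
    by rewrite lerD2l ler_pM2l// lerDl mulr_ge0// divr_ge0// ltW.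
  apply: le_trans (increment_tail (p_gt0 i) (YP.1 i) (ler0n R n) t0 a0) _.
  rewrite addrAC subrr add0r normrM gtr0_norm// exprMn.
  by rewrite le_eqVlt; apply/orP; left; apply/eqP; field; rewrite !gt_eqF.
rewrite mean_sum => [|i]; last exact: bounded_measurable_increment.
rewrite (_ : K.+1%:R / M ^+ 2 = \sum_(i < K.+1) (M ^+ 2)^-1); last first.
  by rewrite sumr_const card_ord mulr_natl.
apply: ler_sum => i _; have pn0 : 0 < p i * n%:R by rewrite mulr_gt0// ltr0n.
have a0 : 0 < M * Num.sqrt (p i * n%:R) by rewrite mulr_gt0// sqrtr_gt0.
apply: le_trans (increment_tail (p_gt0 i) (YP.1 i) (lexx 0) (ler0n R n) a0) _.
rewrite subr0 normr_nat exprMn sqr_sqrtr ?(ltW pn0)//.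
rewrite le_eqVlt; apply/orP; left; apply/eqP; field.
by rewrite !gt_eqF// ltr0n.
Qed.

End Deviation.

(** The bound [B] on the exceptional event is chosen before [xi]: the grid of times covers all
    allocations of the box, so one [B] serves a strategy and all its opponents. *)
Lemma clearance_concentration (A dl eps : R) : 0 <= A -> 0 < dl -> 0 < eps ->
  \forall n \near \oo, exists B : Om -> R, [/\ bounded_measurable B,
    forall w, 0 <= B w, \int[P]_w B w <= eps & forall w, B w < 1 ->
    forall xi, (forall i, `|normalize p n xi ord0 i| <= A) ->
    exists2 a : R, clearance_time Y xi w = a%:E &
      `|a - (n%:R + Num.sqrt n%:R * max_time p (normalize p n xi) (noise n ^~ w))|
        <= Num.sqrt n%:R * dl].
Proof.
move=> A0 dl0 eps0; pose M := 1 + 2 * K.+1%:R / eps.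
have M1 : 1 <= M by rewrite lerDl divr_ge0 ?mulr_ge0 ?(ltW eps0).
have M0 : 0 < M by rewrite (lt_le_trans ltr01).
have M_eps : K.+1%:R / M ^+ 2 <= eps / 2.
  rewrite (@le_trans _ _ (K.+1%:R / M))//.
    by rewrite ler_pM2l// lef_pV2 ?posrE ?exprn_gt0// expr2 ler_peMr// ltW.
  rewrite ler_pdivrMr// /M mulrDr mulr1 (_ : eps / 2 * (2 * K.+1%:R / eps) = K.+1%:R).
    by rewrite lerDr divr_ge0// ltW.
  by field; rewrite gt_eqF.
(* Bounds every coordinate time, enlarged by [dl], when allocations are at most [A] and the noise at
   most [M]. *)
pose S := \sum_i (A / p i + M / Num.sqrt (p i)) + dl.
have S0 : 0 <= S.
  rewrite addr_ge0 ?(ltW dl0)//; apply: sumr_ge0 => i _.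
  by rewrite addr_ge0// divr_ge0 ?sqrtr_ge0 ?(ltW M0) ?(ltW (p_gt0 i)).
pose C := \sum_i \sum_(l < (Num.bound (4 * S / dl)).+2)
  p i * `|- S + l%:R * (dl / 2)| / (p i * dl / 4) ^+ 2.
have C0 : 0 <= C.
  apply: sumr_ge0 => i _; apply: sumr_ge0 => l _.
  by rewrite divr_ge0 ?sqr_ge0// mulr_ge0// ltW.
have sqrt_large (c : R) : 0 <= c -> \forall n \near \oo, c <= Num.sqrt n%:R.
  move=> c0; near=> n; rewrite -[c]ger0_norm// -sqrtr_sqr ler_wsqrtr//.
  by near: n; exact: nbhs_infty_ger.
near=> n.
have n0 : (0 < n)%N by near: n; exact: nbhs_infty_gt.
have s0 : 0 < Num.sqrt n%:R :> R by rewrite sqrtr_gt0 ltr0n.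
have Sn : Num.sqrt n%:R * S <= n%:R.
  rewrite -[leRHS](@sqr_sqrtr _ n%:R)// expr2 ler_pM2l//.
  by near: n; exact: sqrt_large.
exists (deviation S dl M n); split.
- exact: bounded_measurable_deviation.
- exact: deviation_ge0.
- apply: le_trans (mean_deviation _ _ _ _) _ => //.
  rewrite [leRHS]splitr lerD// ler_pdivrMr// -ler_pdivrMl ?divr_gt0//.
  by near: n; apply: sqrt_large; rewrite mulr_ge0// invr_ge0 divr_ge0// ltW.
move=> w dev xi xA; apply: (clearance_time_near _ _ _ dev) => // i.
rewrite lerD2r (bigD1 i)//= (le_trans (ler_normD _ _))// ler_wpDr//.
  apply: sumr_ge0 => j _.
  by rewrite addr_ge0// divr_ge0 ?sqrtr_ge0 ?(ltW M0) ?(ltW (p_gt0 j)).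
apply: lerD; rewrite normrM normfV.
  by rewrite [`|p i|]gtr0_norm// ler_pM2r ?invr_gt0.
rewrite [`|Num.sqrt _|]ger0_norm ?sqrtr_ge0// ler_pM2r ?invr_gt0 ?sqrtr_gt0//.
exact: noise_le dev.
Unshelve. all: by end_near. Qed.

End Clearance.

(** * Limits of token strategies *)

Lemma near_sqrt_ge (R : realType) (c : R) : \forall n \near \oo, c <= Num.sqrt n%:R.
Proof.
near=> n; rewrite (le_trans (ler_norm _))// -sqrtr_sqr ler_wsqrtr//.
by near: n; exact: nbhs_infty_ger.
Unshelve. all: by end_near. Qed.

Section TokenLimit.
Context (R : realType) (K : nat) (p : 'I_K.+1 -> R).
Hypotheses (p_gt0 : forall i, 0 < p i) (sum_p : \sum_i p i = 1).

(** Sides other than [ord0] are rounded down and [ord0] receives the remaining tokens. Each side is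
    off by at most [K + 1] tokens, that is by [(K + 1) / sqrt n] after normalization. *)
Lemma token_rounding (y : 'rV[R]_K.+1) (e : R) : \sum_i y ord0 i = 0 -> 0 < e ->
  \forall n \near \oo, exists2 xi : 'I_K.+1 -> nat, (\sum_i xi i)%N = n &
    forall i, `|normalize p n xi ord0 i - y ord0 i| <= e.
Proof.
move=> sum_y e0; near=> n.
have n0 : (0 < n)%N by near: n; exact: nbhs_infty_gt.
have : \sum_j `|y ord0 j| / p j <= Num.sqrt n%:R by near: n; exact: near_sqrt_ge.
have : K.+1%:R / e <= Num.sqrt n%:R by near: n; exact: near_sqrt_ge.
set s : R := Num.sqrt n%:R => sK ys.
have s0 : 0 < s by rewrite sqrtr_gt0 ltr0n.
have s2 : s ^+ 2 = n%:R by rewrite sqr_sqrtr.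
have Ks : K.+1%:R / s <= e by rewrite ler_pdivrMr// mulrC -ler_pdivrMr.
pose v i := p i * n%:R + s * y ord0 i.
have v0 i : 0 <= v i.
  have : `|y ord0 i| / p i <= s.
    apply: le_trans ys; rewrite (bigD1 i)//= lerDl sumr_ge0// => j _.
    by rewrite divr_ge0// ltW.
  rewrite ler_pdivrMr// ler_norml => /andP[h _].
  rewrite /v -s2 (_ : _ + _ = s * (s * p i + y ord0 i)); last by ring.
  by rewrite mulr_ge0 ?(ltW s0)// -lerBlDl sub0r.
have sum_v : \sum_i v i = n%:R.
  by rewrite big_split/= -mulr_suml -mulr_sumr sum_p sum_y mulr0 addr0 mul1r.
pose eta (j : 'I_K) := Num.truncn (v (lift ord0 j)).
have etaP j : 0 <= v (lift ord0 j) - (eta j)%:R <= 1.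
  have /andP[h1 h2] := truncn_itv (v0 (lift ord0 j)); rewrite -/(eta j) in h1 h2.
  by rewrite -natr1 in h2; apply/andP; split; lra.
have sum_eta : (\sum_j eta j <= n)%N.
  rewrite -(@ler_nat R) natr_sum -sum_v big_ord_recl/= (@le_trans _ _ (\sum_j v (lift ord0 j)))//.
    by apply: ler_sum => j _; have /andP[] := etaP j; rewrite subr_ge0.
  by rewrite lerDr.
pose xi i := if unlift ord0 i is Some j then eta j else (n - \sum_j eta j)%N.
have xi_lift j : xi (lift ord0 j) = eta j by rewrite /xi liftK.
have xi_0 : xi ord0 = (n - \sum_j eta j)%N by rewrite /xi unlift_none.
have dist i : normalize p n xi ord0 i - y ord0 i = ((xi i)%:R - v i) / s.
  by rewrite mxE -/s /v; field; rewrite gt_eqF.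
exists xi.
  rewrite big_ord_recl xi_0 [X in (_ + X)%N](_ : _ = \sum_j eta j)%N ?subnK//.
  by apply: eq_bigr => j _.
move=> i; rewrite dist normrM normfV (gtr0_norm s0) (le_trans _ Ks)// ler_pM2r ?invr_gt0//.
case: (unliftP ord0 i) => [j|] ->.
  rewrite xi_lift distrC; have /andP[h1 h2] := etaP j.
  by rewrite ger0_norm// (le_trans h2)// ler1n.
rewrite xi_0 natrB// natr_sum -sum_v big_ord_recl [X in X - _ - _]addrC -addrA -opprD.
rewrite [X in _ - X]addrC opprD addrA addrK -sumrB.
rewrite (le_trans (ler_norm_sum _ _ _))//.
apply: (@le_trans _ _ (\sum_(j < K) 1)).
  by apply: ler_sum => j _; have /andP[h1 h2] := etaP j; rewrite ger0_norm.
by rewrite sumr_const card_ord ler_nat.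
Unshelve. all: by end_near. Qed.

Context d (Om : measurableType d) (P : probability Om R) (Z : 'I_K.+1 -> {RV P >-> R}).
Hypothesis iid_Z : iid_standard_normal Z.
Context d' (Om' : measurableType d') (P' : probability Om' R).
Variable Y : 'I_K.+1 -> R -> {RV P' >-> nat}.
Hypothesis YP : independent_poisson_processes p Y.

Lemma token_payoffE n x y : token_payoff p Y n x y = 2^-1 *
  \int[P']_w finish_sign (clearance_time Y (tokens p n x) w) (clearance_time Y (tokens p n y) w).
Proof. by rewrite /token_payoff payoffE//; exact: measurable_clearance_time YP _. Qed.

Lemma token_payoff_norm n x y : `|token_payoff p Y n x y| <= 2^-1.
Proof. by apply: payoff_norm; exact: measurable_clearance_time YP _. Qed.

Lemma token_payoffN n x y : token_payoff p Y n x y = - token_payoff p Y n y x.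
Proof. by rewrite /token_payoff /payoff -mulrN opprB. Qed.

Section SmoothSums.
Variables (J : finType) (y : J -> 'rV[R]_K.+1) (e : R).
Hypotheses (e_gt0 : 0 < e) (sum_y : forall j, \sum_i y j ord0 i = 0).
Hypothesis approx : forall (a : J -> R) (c : R) z,
  (forall j, `|a j - (c - max_time p (y j) z)| <= e) ->
  `|\sum_j Num.sg (a j) - \sum_j clip e (c - max_time p (y j) z)| <= 2 * K.+1%:R.

(** Uniform in [x], because the bound and the Lipschitz constant of the smooth sum in the noise do
    not involve [x]. *)
Lemma smooth_sum_noise_cvg (eta : R) : 0 < eta ->
  \forall n \near \oo, forall x,
    `|\int[P']_w smooth_sum p y e x (noise p Y n ^~ w) -
      \int[P]_w smooth_sum p y e x (Z ^~ w)| <= eta.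
Proof.
move=> eta0; pose L := #|J|%:R * (2 * (\sum_i (Num.sqrt (p i))^-1) / e).
have S0 : 0 <= \sum_i (Num.sqrt (p i))^-1.
  by apply: sumr_ge0 => i _; rewrite invr_ge0 sqrtr_ge0.
have L0 : 0 <= L by rewrite mulr_ge0// divr_ge0 ?(ltW e_gt0)// mulr_ge0.
have WZ i (h : R -> R) : test_function h ->
    \int[P']_w h (noise p Y n i w) @[n --> \oo] --> \int[P]_w h (Z i w).
  move=> th; rewrite (mean_standard_normal (iid_Z.2 i)); first exact: noise_cvg.
  exact: bounded_measurable_test_function.
have := mean_cvg_uniform (fun i => measurable_funPT (Z i))
  (measurable_noise p Y) (iid_product_rule iid_Z) (product_rule_noise YP) WZ
  (ler0n R #|J|) L0 eta0.
apply: filterS => n h x; apply: h.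
- by move=> z; exact: smooth_sum_norm.
- move=> z z' t zz'.
  have -> : L * t = #|J|%:R * ((0 + 2 * ((\sum_i (Num.sqrt (p i))^-1) * t)) / e).
    by rewrite /L add0r; ring.
  apply: smooth_sum_dist => // i; first by rewrite subrr normr0 mul0r.
  have t0 : 0 <= t := le_trans (normr_ge0 _) (zz' i).
  rewrite mulrC; apply: ler_pM => //.
  rewrite (bigD1 i)//= lerDl; apply: sumr_ge0 => j _.
  by rewrite invr_ge0 sqrtr_ge0.
- have [] // := @bounded_measurable_smooth_sum R K p J y e _ Om' (fun=> x)
    (fun w => noise p Y n ^~ w).
  by move=> i; exact: measurable_noise.
- have [] // := @bounded_measurable_smooth_sum R K p J y e _ Om (fun=> x)
    (fun w => Z ^~ w).
Qed.

Lemma smooth_payoff_le_token (A eta : R) : (forall j i, `|y j ord0 i| + 1 <= A) ->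
  0 <= A -> 0 < eta ->
  \forall n \near \oo, exists2 yn : J -> 'rV[R]_K.+1,
    forall j, token_allocation p n (yn j) &
    forall x, token_allocation p n x -> (forall i, `|x ord0 i| <= A) ->
      smooth_payoff p y e Z x <= \sum_j token_payoff p Y n (yn j) x + K.+1%:R + eta.
Proof.
move=> yA A0 eta0.
pose eps := eta / (#|J|%:R + 1).
have J1 : 0 < #|J|%:R + 1 :> R by rewrite ltr_wpDl.
have eps0 : 0 < eps by rewrite divr_gt0.
have e3 : 0 < e / 3 by rewrite divr_gt0.
pose S := 1 + \sum_i (p i)^-1.
have S0 : 1 <= S by rewrite lerDl sumr_ge0// => i _; rewrite invr_ge0 ltW.
(* The 1 keeps the rounded opponents inside the box, by the margin in [yA]; the other term lets
   rounding move a maximum time by at most [e / 3]. *)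
pose r := Num.min 1 (e / 3 / S).
have r0 : 0 < r by rewrite lt_min ltr01 divr_gt0// (lt_le_trans _ S0).
have rP i : r / p i <= e / 3.
  have : r <= e / 3 / S by rewrite ge_min lexx orbT.
  rewrite ler_pdivlMr ?(lt_le_trans _ S0)//; apply: le_trans.
  rewrite ler_pM2l// /S (bigD1 i)//= addrCA lerDl addr_ge0// sumr_ge0// => j _.
  by rewrite invr_ge0 ltW.
have rounding : \forall n \near \oo, forall j, exists xi : 'I_K.+1 -> nat,
    (\sum_i xi i)%N = n /\ forall i, `|normalize p n xi ord0 i - y j ord0 i| <= r.
  apply: filter_forall => j; have := token_rounding (sum_y j) r0.
  by apply: filterS => n [xi ? ?]; exists xi.
near=> n.
have n0 : (0 < n)%N by near: n; exact: nbhs_infty_gt.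
have s0 : 0 < Num.sqrt n%:R :> R by rewrite sqrtr_gt0 ltr0n.
have /choice[xi xiP] : forall j, exists xi : 'I_K.+1 -> nat, (\sum_i xi i)%N = n /\
    forall i, `|normalize p n xi ord0 i - y j ord0 i| <= r.
  by near: n.
have yn_A j i : `|normalize p n (xi j) ord0 i| <= A.
  have [_ /(_ i) h] := xiP j; rewrite -[normalize _ _ _ _ _](subrK (y j ord0 i)).
  rewrite (le_trans (ler_normD _ _))// addrC (le_trans (lerD (lexx _) h))//.
  by rewrite (le_trans _ (yA j i))// lerD2l ge_min lexx.
exists (fun j => normalize p n (xi j)).
  by move=> j; exists (xi j) => //; have [] := xiP j.
move=> _ [xi0 sum_xi0 <-] xA.
have [B [bB B0 B_eps BP]] : exists B : Om' -> R, [/\ bounded_measurable B,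
    forall w, 0 <= B w, \int[P']_w B w <= eps & forall w, B w < 1 ->
    forall xi, (forall i, `|normalize p n xi ord0 i| <= A) ->
    exists2 a : R, clearance_time Y xi w = a%:E &
      `|a - (n%:R + Num.sqrt n%:R * max_time p (normalize p n xi) (noise p Y n ^~ w))|
        <= Num.sqrt n%:R * (e / 3)].
  by near: n; exact: clearance_concentration.
have noise_lim : forall x, `|\int[P']_w smooth_sum p y e x (noise p Y n ^~ w) -
    \int[P]_w smooth_sum p y e x (Z ^~ w)| <= eps.
  by near: n; exact: smooth_sum_noise_cvg.
pose F w := \sum_j finish_sign (clearance_time Y (xi j) w) (clearance_time Y xi0 w).
have bFj j : bounded_measurable
    (fun w => finish_sign (clearance_time Y (xi j) w) (clearance_time Y xi0 w) : R).
  by apply: bounded_measurable_finish_sign; exact: measurable_clearance_time YP _.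
have bF : bounded_measurable F by exact: bounded_measurable_sum.
have tokE : \sum_j token_payoff p Y n (normalize p n (xi j)) (normalize p n xi0) =
    2^-1 * \int[P']_w F w.
  rewrite mean_sum// mulr_sumr; apply: eq_bigr => j _.
  by rewrite token_payoffE !tokensK.
set x := normalize p n xi0 in noise_lim xA *.
have bS : bounded_measurable (fun w => smooth_sum p y e x (noise p Y n ^~ w)).
  apply: (@bounded_measurable_smooth_sum R K p J y e _ Om' (fun=> x)
    (fun w => noise p Y n ^~ w)) => // i; exact: measurable_noise.
(* On the exceptional event both sums are bounded by [#|J|], which [2 * #|J| * B] pays for.
   Elsewhere the two clearance times and the rounding of [y j] contribute [e / 3] each, the slack
   allowed by [approx]. *)
have pointwise w : smooth_sum p y e x (noise p Y n ^~ w) <=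
    F w + 2 * K.+1%:R + 2 * #|J|%:R * B w.
  have [B1|B1] := leP 1 (B w).
    have h1 := smooth_sum_norm p y e x (noise p Y n ^~ w).
    have h2 : `|F w| <= #|J|%:R.
      rewrite (le_trans (ler_norm_sum _ _ _))// -sum1_card natr_sum.
      by apply: ler_sum => j _; exact: finish_sign_norm.
    have h3 : #|J|%:R <= #|J|%:R * B w :> R by rewrite ler_peMr.
    move: h1 h2; rewrite !ler_norml => /andP[_ h1] /andP[h2 _].
    have := ler0n R K.+1; lra.
  have [a0 a0E a0P] := BP w B1 xi0 xA.
  have /choice[a aP] : forall j, exists a : R, clearance_time Y (xi j) w = a%:E /\
      `|a - (n%:R + Num.sqrt n%:R * max_time p (normalize p n (xi j)) (noise p Y n ^~ w))|
        <= Num.sqrt n%:R * (e / 3).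
    by move=> j; have [a ? ?] := BP w B1 (xi j) (yn_A j); exists a.
  have FE : F w = \sum_j Num.sg ((a0 - a j) / Num.sqrt n%:R).
    apply: eq_bigr => j _; rewrite (aP j).1 a0E finish_sign_EFin sgrM sgrV.
    by rewrite (gtr0_sg s0) mulr1.
  have close j : `|(a0 - a j) / Num.sqrt n%:R -
      (max_time p x (noise p Y n ^~ w) - max_time p (y j) (noise p Y n ^~ w))| <= e.
    set c := max_time p x _; set c' := max_time p (y j) _.
    have h1 : `|(a0 - (n%:R + Num.sqrt n%:R * c)) / Num.sqrt n%:R| <= e / 3.
      by rewrite normrM normfV (gtr0_norm s0) ler_pdivrMr// [leRHS]mulrC; exact: a0P.
    have h2 : `|(a j - (n%:R + Num.sqrt n%:R *
        max_time p (normalize p n (xi j)) (noise p Y n ^~ w))) / Num.sqrt n%:R| <= e / 3.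
      by rewrite normrM normfV (gtr0_norm s0) ler_pdivrMr// [leRHS]mulrC; exact: (aP j).2.
    have h3 : `|max_time p (normalize p n (xi j)) (noise p Y n ^~ w) - c'| <= e / 3.
      apply: max_time_dist => i; rewrite /coord_time opprD addrACA subrr addr0 -mulrBl.
      rewrite normrM normfV (gtr0_norm (p_gt0 i)) (le_trans _ (rP i))//.
      by rewrite ler_pM2r ?invr_gt0//; have [_ /(_ i)] := xiP j.
    move: h2 h3; set c3 := max_time p (normalize _ _ _) _ => h2 h3.
    rewrite (_ : _ - _ = (a0 - (n%:R + Num.sqrt n%:R * c)) / Num.sqrt n%:R -
      (a j - (n%:R + Num.sqrt n%:R * c3)) / Num.sqrt n%:R - (c3 - c')); last first.
      by field; rewrite gt_eqF.
    rewrite (le_trans (ler_normB _ _))// (le_trans (lerD (ler_normB _ _) h3))//.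
    by rewrite (le_trans (lerD (lerD h1 h2) (lexx _)))//; lra.
  have := approx close; rewrite -FE -/(smooth_sum p y e x (noise p Y n ^~ w)).
  rewrite ler_norml => /andP[h _].
  have h3 : 0 <= 2 * #|J|%:R * B w by rewrite mulr_ge0.
  by move: h h3; lra.
have mean_pointwise : \int[P']_w smooth_sum p y e x (noise p Y n ^~ w) <=
    \int[P']_w F w + 2 * K.+1%:R + 2 * #|J|%:R * eps.
  have b2 : bounded_measurable (fun w => F w + 2 * K.+1%:R).
    by apply: bounded_measurableD => //; exact: bounded_measurable_cst.
  have b3 : bounded_measurable (fun w => 2 * #|J|%:R * B w) by exact: bounded_measurableZl.
  apply: (@le_trans _ _ (\int[P']_w (F w + 2 * K.+1%:R + 2 * #|J|%:R * B w))).
    by apply: mean_le => //; exact: bounded_measurableD.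
  rewrite meanD// meanD//; last exact: bounded_measurable_cst.
  by rewrite mean_cst meanZl// lerD2l ler_wpM2l.
rewrite tokE /smooth_payoff.
have Jeps : #|J|%:R * eps + eps = eta.
  by rewrite /eps; field; rewrite gt_eqF.
have := noise_lim x; rewrite ler_distl => /andP[h _].
have := ltW eps0; move: h mean_pointwise Jeps.
set I1 := \int[P']_w smooth_sum _ _ _ _ _; set I2 := \int[P]_w _; set I3 := \int[P']_w F w.
rewrite -mulrA; set q := #|J|%:R * eps; lra.
Unshelve. all: by end_near. Qed.

End SmoothSums.

End TokenLimit.

Lemma measurable_truncn (R : realType) : measurable_fun setT (@Num.truncn R).
Proof.
move=> _ B _; rewrite setTI.
rewrite (_ : _ @^-1` B = [set t | exists m : nat, B m /\
    forall j : nat, (j < Num.truncn t)%N = (j < m)%N]); last first.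
  apply/seteqP; split=> [t Bt|t [m [Bm tm]]] /=; first by exists (Num.truncn t).
  move: (Num.truncn t) tm => k km; suff -> : k = m by [].
  by apply/anti_leq; rewrite leqNgt km ltnn leqNgt -km ltnn.
apply: measurable_exists_countable => m.
have [Bm|Bm] := pselect (B m); last first.
  by rewrite [X in measurable X](_ : _ = set0)//; apply/seteqP; split => t // [].
rewrite [X in measurable X](_ : _ =
    [set t : R | forall j : nat, (j < Num.truncn t)%N = (j < m)%N]); last first.
  by apply/seteqP; split=> [t []|t].
apply: measurable_forall_countable => j.
rewrite [X in measurable X](_ : _ =
    if (j < m)%N then `[j.+1%:R, +oo[%classic else `]-oo, j.+1%:R[%classic).
  by case: ifP => _; exact: measurable_itv.
apply/seteqP; split=> t /=; case: ifP => _; rewrite truncn_gt_nat /= in_itv/= ?andbT//.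
- by rewrite ltNge => ->.
- by move=> h; apply/negbTE; rewrite -ltNge.
Qed.

Lemma Lipschitz_continuous_rV (R : realType) (k : nat) (f : 'rV[R]_k -> R) (L : R) :
  (forall (x y : 'rV[R]_k) t, (forall i, `|x ord0 i - y ord0 i| <= t) ->
    `|f x - f y| <= L * t) ->
  continuous f.
Proof.
move=> fL x; apply/(@cvgrPdist_le _ _ _ _ (nbhs_filter x)) => e e0.
have L1 : 0 < `|L| + 1 by rewrite ltr_pwDr.
have r0 : 0 < e / (`|L| + 1) by rewrite divr_gt0.
near=> y.
have xy i : `|x ord0 i - y ord0 i| <= e / (`|L| + 1).
  have : ball x (e / (`|L| + 1)) y by near: y; exact: nbhsx_ballx.
  by move=> [_ /(_ ord0 i)]; rewrite /ball/= => /ltW.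
rewrite (le_trans (fL _ _ _ xy))// mulrCA ler_piMr ?(ltW e0)//.
by rewrite ler_pdivrMr// mul1r (le_trans (ler_norm L))// lerDl.
Unshelve. all: by end_near. Qed.

Lemma increasing_seq_near (phi : nat -> nat) (Q : nat -> Prop) : increasing_seq phi ->
  (\forall n \near \oo, Q n) -> \forall j \near \oo, Q (phi j).
Proof.
move=> phi_inc [N _ NQ].
have phi_ge j : (j <= phi j)%N.
  elim: j => // j IH; rewrite (leq_ltn_trans IH)// ltnNge.
  by have := phi_inc j.+1 j; rewrite ltnn leEnat => ->.
by exists N => // j /= Nj; apply: NQ; exact: leq_trans Nj (phi_ge j).
Qed.

Section TokenMeasurability.
Context (R : realType) (K : nat) (p : 'I_K.+1 -> R).

Lemma measurable_token_allocation n : measurable (@token_allocation R K.+1 p n).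
Proof.
rewrite (_ : token_allocation p n = [set x : borel_rV R K.+1 |
   exists xi : {ffun 'I_K.+1 -> nat}, (\sum_i xi i)%N = n /\
     forall i, x ord0 i = normalize p n xi ord0 i]); last first.
  apply/seteqP; split=> [_ [xi sum_xi <-]|x [xi [sum_xi xE]]] /=.
    exists (finfun xi); split; first by under eq_bigr do rewrite ffunE.
    by move=> i; rewrite !mxE ffunE.
  by exists xi => //; apply/rowP => i; rewrite xE.
apply: measurable_exists_countable => xi.
have [sum_xi|sum_xi] := pselect ((\sum_i xi i)%N = n); last first.
  by rewrite [X in measurable X](_ : _ = set0)//; apply/seteqP; split => x // [].
rewrite [X in measurable X](_ : _ =
    [set x : borel_rV R K.+1 | forall i, x ord0 i = normalize p n xi ord0 i]); last first.
  by apply/seteqP; split=> [x []|x].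
apply: measurable_forall_countable => i.
by apply: (@measurable_eqr _ (borel_rV R K.+1) R (fun x => x ord0 i)) => //; exact: measurable_coord.
Qed.

(** Token vectors form a countable set, so every [f] of them is measurable. *)
Lemma measurable_tokens_comp n (f : ('I_K.+1 -> nat) -> R) :
  measurable_fun setT (fun x : borel_rV R K.+1 => f (tokens p n x)).
Proof.
move=> _ B _; rewrite setTI.
rewrite (_ : _ @^-1` B = [set x : borel_rV R K.+1 |
   exists xi : {ffun 'I_K.+1 -> nat}, B (f xi) /\ forall i, tokens p n x i = xi i]); last first.
  apply/seteqP; split=> [x Bx|x [xi [Bxi xE]]] /=.
    exists (finfun (tokens p n x)); split; last by move=> i; rewrite ffunE.
    by rewrite (_ : _ (finfun _) = tokens p n x)//; apply/funext => i; rewrite ffunE.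
  by rewrite (_ : tokens p n x = xi)//; apply/funext.
apply: measurable_exists_countable => xi.
have [Bxi|Bxi] := pselect (B (f xi)); last first.
  by rewrite [X in measurable X](_ : _ = set0)//; apply/seteqP; split => x // [].
rewrite [X in measurable X](_ : _ =
    [set x : borel_rV R K.+1 | forall i, tokens p n x i = xi i]); last first.
  by apply/seteqP; split=> [x []|x].
apply: measurable_forall_countable => i.
have mt : measurable_fun setT (fun x : borel_rV R K.+1 => tokens p n x i).
  apply: (measurableT_comp (@measurable_truncn R)); apply: measurable_funD => //.
  by apply: measurable_funM => //; exact: measurable_coord.
rewrite [X in measurable X](_ : _ = (fun x => tokens p n x i) @^-1` [set xi i])//.
by rewrite -[X in measurable X]setTI; exact: mt.
Qed.

End TokenMeasurability.

Section Limit.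
Context (R : realType) (K : nat) (p : 'I_K.+1 -> R).
Hypotheses (p_gt0 : forall i, 0 < p i) (sum_p : \sum_i p i = 1).
Context d (Om : measurableType d) (P : probability Om R) (Z : 'I_K.+1 -> {RV P >-> R}).
Hypothesis iid_Z : iid_standard_normal Z.
Context d' (Om' : measurableType d') (P' : probability Om' R).
Variable Y : 'I_K.+1 -> R -> {RV P' >-> nat}.
Hypothesis YP : independent_poisson_processes p Y.
Variable alpha : nat -> probability (borel_rV R K.+1) R.
Hypothesis alpha_opt : asymptotically_optimal p Y alpha.
Variables (phi : nat -> nat) (mu : probability (borel_rV R K.+1) R).
Hypotheses (phi_inc : increasing_seq phi)
  (alpha_mu : weakly_converges (fun j => alpha (phi j)) mu).

Lemma token_allocation_sum n x : (0 < n)%N -> token_allocation p n x -> \sum_i x ord0 i = 0.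
Proof.
move=> n0 [xi sum_xi <-]; under eq_bigr do rewrite mxE.
by rewrite -mulr_suml sumrB -natr_sum sum_xi -mulr_suml sum_p mul1r subrr mul0r.
Qed.

(** The hyperplane is closed: the bounded continuous [f m] have mean 0 along the sequence, hence
    under [mu], and tend to the indicator of its complement. *)
Lemma cont_mixed_limit : cont_mixed mu.
Proof.
pose f (m : nat) (x : 'rV[R]_K.+1) : R := Num.min 1 (m%:R * `|\sum_i x ord0 i|).
have f_itv m x : 0 <= f m x <= 1.
  by rewrite /f le_min ler01 mulr_ge0//= ge_min lexx.
have f_cont m : continuous (f m).
  apply: (@Lipschitz_continuous_rV _ _ _ (m%:R * K.+1%:R)) => x y t xy.
  apply: (@le_trans _ _ (m%:R * `|\sum_i x ord0 i - \sum_i y ord0 i|)).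
    rewrite /f; set a := \sum_i _; set b := \sum_i _.
    apply: (@le_trans _ _ `|m%:R * `|a| - m%:R * `|b| |).
      rewrite /Num.min ler_normr !ler_norml.
      by repeat case: ifPn; rewrite -?leNgt => *; lra.
    by rewrite -mulrBr normrM normr_nat ler_wpM2l// ler_dist_dist.
  rewrite -mulrA ler_wpM2l// -sumrB (le_trans (ler_norm_sum _ _ _))//.
  apply: (@le_trans _ _ (\sum_(i < K.+1) t)); first exact: ler_sum.
  by rewrite sumr_const card_ord mulr_natl.
have bf m : @bounded_measurable _ (borel_rV R K.+1) R (f m).
  split; first exact: continuous_borel_rV.
  by exists 1 => x; have /andP[? ?] := f_itv m x; rewrite ger0_norm.
have f_mean m : \int[mu]_x f m x = 0.
  have h : \int[alpha (phi n)]_x f m x @[n --> \oo] --> \int[mu]_x f m x.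
    by apply: alpha_mu => //; have [_] := bf m.
  rewrite -(cvg_lim (@Rhausdorff R) h); apply/cvg_lim => //; apply: cvg_near_cst.
  (* [asymptotically_optimal] makes [alpha n] a token strategy for positive [n] only. *)
  have := increasing_seq_near (Q := fun n => (0 < n)%N) phi_inc (nbhs_infty_gt 0).
  apply: filterS => j phi0; rewrite -(mean_cst (alpha (phi j)) 0).
  apply: mean_eq_ae => //; first exact: bounded_measurable_cst.
  have := ae_full (@measurable_token_allocation R K p (phi j)) (alpha_opt.1 _ phi0).
  apply: filterS => x /(token_allocation_sum phi0) sum_x.
  by rewrite /f sum_x normr0 mulr0 min_r.
have mall := @measurable_allocation R K.+1.
have : \int[mu]_x f m x @[m --> \oo] --> \int[mu]_x \1_(~` @allocation R K.+1) x.
  apply: (mean_dominated_cvg (M := 1)).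
  - by move=> m; have [] := bf m.
  - by apply: measurable_indic; exact: measurableC.
  - by move=> m x; have /andP[? ?] := f_itv m x; rewrite ger0_norm.
  - apply: aeW => x; rewrite indicE; have [sum_x|sum_x] := eqVneq (\sum_i x ord0 i) 0.
      rewrite memNset; last by move=> /(_ sum_x).
      by apply: cvg_near_cst; near=> m; rewrite /f sum_x normr0 mulr0 min_r.
    rewrite mem_set; last exact/eqP.
    apply: cvg_near_cst; near=> m; rewrite /f min_l//.
    rewrite -ler_pdivrMr ?normr_gt0// div1r; near: m; exact: nbhs_infty_ger.
under eq_fun do rewrite f_mean.
move=> /(cvg_lim (@Rhausdorff R)); rewrite lim_cst//= => h.
have : mu (~` @allocation R K.+1) = 0%E.
  rewrite -[LHS]fineK ?fin_num_measure//; last exact: measurableC.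
  by rewrite -mean_indic; [rewrite -h|exact: measurableC].
rewrite probability_setC// => /eqP; rewrite sube_eq ?add0e//.
  by move=> /eqP.
Unshelve. all: by end_near. Qed.

Lemma bounded_measurable_token_payoff n y :
  @bounded_measurable _ (borel_rV R K.+1) R (fun x => token_payoff p Y n y x).
Proof.
split; last by exists 2^-1 => x; exact: token_payoff_norm YP _ _ _.
exact: (measurable_tokens_comp p n (fun xi =>
  payoff P' (clearance_time Y (tokens p n y)) (clearance_time Y xi))).
Qed.

Lemma mean_token_payoff_le (e : R) : 0 < e -> \forall n \near \oo,
  forall y, token_allocation p n y -> \int[alpha n]_x token_payoff p Y n y x <= e.
Proof.
move=> e0; have [mixed /fine_cvgP[inf_fin inf_cvg]] := alpha_opt.
move: inf_cvg => /cvgrPdist_le /(_ e e0) inf_near.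
move: inf_near inf_fin (nbhs_infty_gt 0); apply: filterS3 => n /=.
rewrite sub0r normrN ler_norml => /andP[Ie _] If n0 y ny.
have bt := bounded_measurable_token_payoff n y.
have mixedE : token_payoff_mixed p Y n (alpha n) y =
    \int[alpha n]_x (-1 * token_payoff p Y n y x).
  rewrite -(mean_full (@measurable_token_allocation R K p n) (mixed _ n0)).
    by apply: eq_Rintegral => x _; rewrite mulN1r -token_payoffN.
  exact: bounded_measurableZl.
have : - e <= token_payoff_mixed p Y n (alpha n) y.
  rewrite (le_trans Ie)// -lee_fin fineK//; apply: ereal_inf_lbound; by exists y.
by rewrite mixedE meanZl// mulN1r lerN2.
Qed.

Lemma bounded_measurable_ramp_sum (A : R) :
  @bounded_measurable _ (borel_rV R K.+1) R (fun x => \sum_i ramp (`|x ord0 i| - A)).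
Proof.
apply: bounded_measurable_sum => i; split; last first.
  by exists 1 => x; have /andP[? ?] := ramp_itv (`|x ord0 i| - A); rewrite ger0_norm.
have mr : measurable_fun setT (@ramp R).
  apply: continuous_measurable_fun; apply: (@Lipschitz_continuous R _ 1) => s t.
  by rewrite mul1r ramp_dist.
apply: (measurableT_comp mr); apply: measurable_funB => //.
by apply: (measurableT_comp (@normr_measurable R setT)); exact: measurable_coord.
Qed.

(** A weakly convergent sequence with a probability as limit is tight; ramps express the tails by
    continuous functions. *)
Lemma limit_tight (e : R) : 0 < e -> exists A : R, 0 <= A /\
  \forall j \near \oo, \int[alpha (phi j)]_x (\sum_i ramp (`|x ord0 i| - A)) <= e.
Proof.
move=> e0; pose f (A : nat) (x : 'rV[R]_K.+1) : R := \sum_i ramp (`|x ord0 i| - A%:R).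
have f_norm A x : `|f A x| <= K.+1%:R.
  rewrite (le_trans (ler_norm_sum _ _ _))// (@le_trans _ _ (\sum_(i < K.+1) 1))//.
    by apply: ler_sum => i _; have /andP[? ?] := ramp_itv (`|x ord0 i| - A%:R); rewrite ger0_norm.
  by rewrite sumr_const card_ord.
have f_cont A : continuous (f A).
  apply: (@Lipschitz_continuous_rV _ _ _ K.+1%:R) => x y t xy.
  rewrite -sumrB (le_trans (ler_norm_sum _ _ _))//.
  apply: (@le_trans _ _ (\sum_(i < K.+1) t)); last by rewrite sumr_const card_ord mulr_natl.
  apply: ler_sum => i _; rewrite (le_trans (ramp_dist _ _))// opprB addrA subrK.
  by rewrite (le_trans (ler_dist_dist _ _)).
have : \int[mu]_x f A x @[A --> \oo] --> \int[mu]_x (0 : R).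
  apply: (mean_dominated_cvg (M := K.+1%:R)) => //.
  - by move=> A; exact: continuous_borel_rV.
  - apply: aeW => x; apply: cvg_near_cst; near=> A.
    rewrite /f big1// => i _; apply: ramp_le0; rewrite subr_le0.
    apply: (@le_trans _ _ (\sum_i `|x ord0 i|)).
      by rewrite (bigD1 i)//= lerDl sumr_ge0.
    by near: A; exact: nbhs_infty_ger.
rewrite mean_cst => /cvgrPdist_le /(_ _ (divr_gt0 e0 (ltr0Sn R 1))) [A _ /(_ A (leqnn A))] /=.
rewrite sub0r normrN ler_norml => /andP[_ Ae]; exists A%:R; split => //.
have : \int[alpha (phi n)]_x f A x @[n --> \oo] --> \int[mu]_x f A x.
  by apply: alpha_mu => //; exists K.+1%:R.
move=> /cvgrPdist_le /(_ _ (divr_gt0 e0 (ltr0Sn R 1))); apply: filterS => j.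
by rewrite ler_norml => /andP[h _]; rewrite -/(f A _); lra.
Unshelve. all: by end_near. Qed.

(** What matters is that the bound does not depend on [J]. [K.+1] comes from clipping; the 4 covers
    the comparison with tokens, the imperfect optimality and the tails, each at most 1. *)
Lemma mean_smooth_payoff_limit (J : finType) (y : J -> 'rV[R]_K.+1) (e : R) :
  0 < e -> (forall j, \sum_i y j ord0 i = 0) ->
  (forall (a : J -> R) (c : R) z,
    (forall j, `|a j - (c - max_time p (y j) z)| <= e) ->
    `|\sum_j Num.sg (a j) - \sum_j clip e (c - max_time p (y j) z)| <= 2 * K.+1%:R) ->
  \int[mu]_x smooth_payoff p y e Z x <= K.+1%:R + 4.
Proof.
move=> e0 sum_y approx; set Psi := smooth_payoff p y e Z.
have Psi_norm x : `|Psi x| <= 2^-1 * #|J|%:R by exact: smooth_payoff_norm.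
have S0 : 0 <= \sum_i (p i)^-1 by apply: sumr_ge0 => i _; rewrite invr_ge0 ltW.
have Psi_cont : continuous Psi.
  apply: (@Lipschitz_continuous_rV _ _ _ (#|J|%:R * (\sum_i (p i)^-1) / e)) => x x' t xx'.
  have t0 : 0 <= t := le_trans (normr_ge0 _) (xx' ord0).
  have -> : #|J|%:R * (\sum_i (p i)^-1) / e * t = #|J|%:R * (((\sum_i (p i)^-1) * t) / e).
    by ring.
  apply: smooth_payoff_dist => // i; rewrite mulrC; apply: ler_pM => //.
    by rewrite invr_ge0 ltW.
  by rewrite (bigD1 i)//= lerDl sumr_ge0// => j _; rewrite invr_ge0 ltW.
have Psi_lim : \int[alpha (phi n)]_x Psi x @[n --> \oo] --> \int[mu]_x Psi x.
  by apply: alpha_mu => //; exists (2^-1 * #|J|%:R).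
have J1 : 0 < #|J|%:R + 1 :> R by rewrite ltr_wpDl.
(* Errors of this size, one for each opponent, add up to at most 1. *)
have eps0 : 0 < (#|J|%:R + 1)^-1 :> R by rewrite invr_gt0.
have Jeps : #|J|%:R / (#|J|%:R + 1) <= 1 :> R by rewrite ler_pdivrMr// mul1r lerDl.
have [A0 [A0_ge0 tight]] := limit_tight eps0.
pose A := A0 + 1 + \sum_j \sum_i (`|y j ord0 i| + 1).
have sA : 0 <= \sum_j \sum_i (`|y j ord0 i| + 1).
  by apply: sumr_ge0 => j _; apply: sumr_ge0 => i _; rewrite addr_ge0.
have A_ge0 : 0 <= A by rewrite !addr_ge0.
have yA j i : `|y j ord0 i| + 1 <= A.
  rewrite /A ler_wpDl ?addr_ge0// (bigD1 j)//= (bigD1 i)//= -addrA lerDl.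
  rewrite addr_ge0//; first by apply: sumr_ge0 => i' _; rewrite addr_ge0.
  by apply: sumr_ge0 => j' _; apply: sumr_ge0 => i' _; rewrite addr_ge0.
have compare := increasing_seq_near phi_inc
  (smooth_payoff_le_token p_gt0 sum_p iid_Z YP e0 sum_y approx yA A_ge0 ltr01).
have opt := increasing_seq_near phi_inc (mean_token_payoff_le eps0).
have pos := increasing_seq_near phi_inc (nbhs_infty_gt 0).
rewrite -(cvg_lim (@Rhausdorff R) Psi_lim); apply: limr_le.
  by apply/cvg_ex; exists (\int[mu]_x Psi x).
near=> l; have phi0 : (0 < phi l)%N by near: l.
have : \int[alpha (phi l)]_x (\sum_i ramp (`|x ord0 i| - A0)) <= (#|J|%:R + 1)^-1.
  by near: l.
have : forall y, token_allocation p (phi l) y ->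
    \int[alpha (phi l)]_x token_payoff p Y (phi l) y x <= (#|J|%:R + 1)^-1 by near: l.
have : exists2 yn : J -> 'rV[R]_K.+1, forall j, token_allocation p (phi l) (yn j) &
    forall x, token_allocation p (phi l) x -> (forall i, `|x ord0 i| <= A) ->
      smooth_payoff p y e Z x <= \sum_j token_payoff p Y (phi l) (yn j) x + K.+1%:R + 1.
  by near: l.
set n := phi l in phi0 * => -[yn yn_tok yn_le] tok_le ramp_le.
pose r (x : 'rV[R]_K.+1) : R := \sum_i ramp (`|x ord0 i| - A0).
have bPsi : @bounded_measurable _ (borel_rV R K.+1) R Psi.
  by split; [exact: continuous_borel_rV|exists (2^-1 * #|J|%:R)].
have br : @bounded_measurable _ (borel_rV R K.+1) R r by exact: bounded_measurable_ramp_sum.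
have bt : @bounded_measurable _ (borel_rV R K.+1) R
    (fun x => \sum_j token_payoff p Y n (yn j) x).
  by apply: bounded_measurable_sum => j; exact: bounded_measurable_token_payoff.
(* Outside the box some ramp equals 1, and [#|J| * r x] covers the largest possible difference of
   the two sums. *)
have pointwise x : token_allocation p n x ->
    Psi x <= \sum_j token_payoff p Y n (yn j) x + (K.+1%:R + 1) + #|J|%:R * r x.
  move=> x_tok; have ramp0 i : 0 <= ramp (`|x ord0 i| - A0).
    by have /andP[] := ramp_itv (`|x ord0 i| - A0).
  have r0 : 0 <= r x by exact: sumr_ge0.
  have [xA|/existsNP[i /negP]] := pselect (forall i, `|x ord0 i| <= A).
    have := yn_le x x_tok xA; have : 0 <= #|J|%:R * r x by rewrite mulr_ge0.
    by rewrite -/Psi; lra.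
  rewrite -ltNge => xi; have r1 : 1 <= r x.
    rewrite /r (bigD1 i)//= ramp_ge1 ?lerDl ?sumr_ge0//.
    by rewrite lerBrDl (le_trans _ (ltW xi))// lerDl.
  have tok_ge : - (2^-1 * #|J|%:R) <= \sum_j token_payoff p Y n (yn j) x.
    rewrite -mulrN mulrC -sumr_const -sumrN mulr_suml; apply: ler_sum => j _.
    have := token_payoff_norm YP n (yn j) x; rewrite ler_norml => /andP[+ _].
    by rewrite mulN1r.
  have : #|J|%:R <= #|J|%:R * r x by rewrite ler_peMr.
  have := Psi_norm x; rewrite ler_norml => /andP[_ h].
  have := ler0n R K.+1; lra.
have mean_le_all : \int[alpha n]_x Psi x <= \int[alpha n]_x
    (\sum_j token_payoff p Y n (yn j) x + (K.+1%:R + 1) + #|J|%:R * r x).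
  have bd : @bounded_measurable _ (borel_rV R K.+1) R
      (fun x => \sum_j token_payoff p Y n (yn j) x + (K.+1%:R + 1) + #|J|%:R * r x).
    apply: bounded_measurableD; last exact: bounded_measurableZl.
    by apply: bounded_measurableD => //; exact: bounded_measurable_cst.
  rewrite -subr_le0 -meanB//.
  apply: (mean_full_le (@measurable_token_allocation R K p n) (alpha_opt.1 _ phi0)).
    exact: bounded_measurableB.
  by move=> x x_tok; rewrite subr_le0; exact: pointwise.
apply: le_trans mean_le_all _.
rewrite meanD; first last.
- exact: bounded_measurableZl.
- by apply: bounded_measurableD => //; exact: bounded_measurable_cst.
rewrite meanD//; last exact: bounded_measurable_cst.
rewrite mean_cst meanZl// mean_sum; last by move=> j; exact: bounded_measurable_token_payoff.
have h1 : \sum_j \int[alpha n]_x token_payoff p Y n (yn j) x <= 1.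
  apply: le_trans Jeps; apply: (@le_trans _ _ (\sum_(j : J) (#|J|%:R + 1)^-1)).
    by apply: ler_sum => j _; exact: tok_le.
  by rewrite sumr_const mulr_natl.
have h2 : #|J|%:R * \int[alpha n]_x r x <= 1.
  by apply: le_trans Jeps; rewrite ler_wpM2l.
by lra.
Unshelve. all: by end_near. Qed.

Lemma limit_optimal : (0 < K)%N -> cont_optimal p Z mu.
Proof.
move=> K0; apply: cont_optimal_intro => [|y sum_y]; first exact: cont_mixed_limit.
have bK y' : @bounded_measurable _ (borel_rV R K.+1) R (fun x => cont_payoff p Z y' x).
  apply: (@bounded_measurable_cont_payoff _ _ p _ _ _ _ _ (borel_rV R K.+1) (fun=> y')) => // i.
  exact: measurable_coord.
(* Here the payoffs of all allocations are controlled and no mass is lost: [D] is the whole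
   hyperplane, the weight is 1 and [c] is 0. *)
pose D : set 'rV[R]_K.+1 := [set y : 'rV[R]_K.+1 | \sum_i y ord0 i = 0].
have D_dense (y' : 'rV[R]_K.+1) : \sum_i y' ord0 i = 0 -> forall e : R, 0 < e ->
    exists2 x, D x & forall i, `|x ord0 i - y' ord0 i| < e.
  by move=> sum_y' e e0; exists y' => // i; rewrite subrr normr0.
suff : \int[mu]_x (1 * cont_payoff p Z y x) + 0 <= 0.
  by rewrite addr0; congr (_ <= _); apply: eq_Rintegral => x _; rewrite mul1r.
have b1 : @bounded_measurable _ (borel_rV R K.+1) R (fun=> 1).
  exact: bounded_measurable_cst.
apply: (@cont_payoff_criterion R K p p_gt0 _ Om P Z iid_Z K0 _ (borel_rV R K.+1) mu id
  (fun=> 1) (@measurable_coord R K.+1) b1 D D_dense 0 (K.+1%:R + 4 + K.+1%:R)) => //.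
move=> J yJ DyJ yJ_inj.
have [e e0 approx] := sum_sgr_clip p_gt0 yJ_inj.
have near := smooth_payoff_approx Z e0 approx.
have lim_le := mean_smooth_payoff_limit e0 DyJ approx.
have bPsi : @bounded_measurable _ (borel_rV R K.+1) R (smooth_payoff p yJ e Z).
  by apply: bounded_measurable_smooth_payoff => i; exact: measurable_coord.
rewrite mulr0 addr0.
have -> : \sum_j \int[mu]_x (1 * cont_payoff p Z (yJ j) x) =
    \int[mu]_x \sum_j cont_payoff p Z (yJ j) x.
  rewrite mean_sum//; apply: eq_bigr => j _; apply: eq_Rintegral => x _.
  by rewrite mul1r.
apply: (@le_trans _ _ (\int[mu]_x (smooth_payoff p yJ e Z x + K.+1%:R))).
  apply: mean_le.
  - exact: bounded_measurable_sum.
  - by apply: bounded_measurableD => //; exact: bounded_measurable_cst.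
  - by move=> x; have := near x; rewrite ler_norml => /andP[_]; rewrite lerBlDl.
rewrite meanD//; last exact: bounded_measurable_cst.
by rewrite mean_cst lerD2r.
Qed.

End Limit.

(** * The one-sided die and the conclusion *)

Lemma cont_mixed_exists (R : realType) (k : nat) d (Om : measurableType d)
    (P : probability Om R) : exists mu : probability (borel_rV R k) R, cont_mixed mu.
Proof.
have m0 : measurable_fun setT (fun _ : Om => 0 : borel_rV R k) by exact: measurable_cst.
exists (distribution P (mfun_of m0 : {RV P >-> borel_rV R k})).
rewrite /cont_mixed/= /distribution/= /pushforward (_ : _ @^-1` _ = setT) ?probability_setT//.
by apply/seteqP; split => // u _; apply: big1 => i _; rewrite mxE.
Qed.

Section OneSide.
Context (R : realType) (p : 'I_1 -> R).
Context d (Om : measurableType d) (P : probability Om R) (Z : 'I_1 -> {RV P >-> R}).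

(** With one side 0 is the only allocation, and its payoff against itself vanishes. [tilt] is then
    the zero vector, so the criterion does not cover this case. *)
Lemma cont_optimal_ord1 (mu : probability (borel_rV R 1) R) :
  cont_mixed mu -> cont_optimal p Z mu.
Proof.
move=> mm; apply: cont_optimal_intro => // y sum_y.
apply: (mean_full_le (@measurable_allocation R 1) mm) => [|x sum_x].
  apply: (@bounded_measurable_cont_payoff _ _ p _ _ _ _ _ (borel_rV R 1) (fun=> y)) => // i.
  exact: measurable_coord.
suff -> : x = y by rewrite cont_payoffxx.
apply/rowP => i; rewrite (ord1 i).
by move: sum_x sum_y; rewrite /allocation/= !big_ord1 => -> ->.
Qed.

End OneSide.

Theorem theorem3p1 (R : realType) (k : nat) (p : 'I_k -> R)
    (k_gt0 : (0 < k)%N) (p_gt0 : forall i, 0 < p i) (sum_p : \sum_i p i = 1)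
    (d : measure_display) (Om : measurableType d) (P : probability Om R)
    (Z : 'I_k -> {RV P >-> R}) (iid_Z : iid_standard_normal Z) :
  [/\ cont_lower_value p Z = 0%E,
      cont_upper_value p Z = 0%E,
      exists alpha : probability (borel_rV R k) R, cont_optimal p Z alpha &
      forall (d' : measure_display) (Om' : measurableType d')
        (P' : probability Om' R) (Y : 'I_k -> R -> {RV P' >-> nat}),
        independent_poisson_processes p Y ->
      forall alpha : nat -> probability (borel_rV R k) R,
        asymptotically_optimal p Y alpha ->
      forall (phi : nat -> nat) (mu : probability (borel_rV R k) R),
        increasing_seq phi ->
        weakly_converges (fun j => alpha (phi j)) mu ->
        cont_optimal p Z mu].
Proof.
case: k p k_gt0 p_gt0 sum_p Z iid_Z => // K p _ p_gt0 sum_p Z iid_Z.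
have [mu opt] : exists mu : probability (borel_rV R K.+1) R, cont_optimal p Z mu.
  (* One side is split off, since the criterion asks for [0 < K]. *)
  case: K p p_gt0 sum_p Z iid_Z => [|K] p p_gt0 sum_p Z iid_Z.
    have [mu mm] := cont_mixed_exists 1 P.
    by exists mu; exact: cont_optimal_ord1.
  exact: cont_optimal_exists.
have [low up] := cont_valueE opt.
split=> //; first by exists mu.
move=> d' Om' P' Y YP alpha alpha_opt phi nu phi_inc alpha_nu.
have mixed := cont_mixed_limit sum_p alpha_opt phi_inc alpha_nu.
case: K p p_gt0 sum_p Z iid_Z Y YP alpha alpha_opt nu alpha_nu mixed {mu opt low up} =>
  [|K] p p_gt0 sum_p Z iid_Z Y YP alpha alpha_opt nu alpha_nu mixed.
  exact: cont_optimal_ord1.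
exact: (limit_optimal p_gt0 sum_p iid_Z YP alpha_opt phi_inc alpha_nu).
Qed.
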